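(* Let $(\eta_t)_{t\ge0}$ be the multi-type TASEP with $\eta_0(x)=-x$ for all $x\in\mathbb{Z}$. Let $k\in\mathbb{Z}$, let $L_1(t)$ be the type of the $k$-leader at time $t$, let $X_1(t)$ be the position of the $k$-leader at time $t$, and let $x\in\mathbb{R}$. Then, as $t\to\infty$, the conditional law of $\dfrac{L_1(t)-k}{\sqrt{t}}$ given $X_1(t)=\lfloor t+x\sqrt{t}\rfloor$ converges in distribution to the probability measure with density $$\frac{1}{\sqrt{2\pi}}\exp\left(-\frac{(x+a)^2}{2}\right)\left(1+\frac{\sqrt{2\pi}}{2}\left(1+\mathrm{erf}\left(\frac{x}{\sqrt{2}}\right)\right)\exp\left(\frac{x^2}{2}\right)(a+x)\right)\mathbf{1}_{a\ge0}\,da .$$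
   Context: Multi-type TASEP: states are maps $\eta:\mathbb{Z}\to\mathbb{Z}$, $\eta(x)$ being the type of the particle at position $x$. Each pair of neighboring sites $(x,x+1)$ carries an independent exponential clock of rate $1$; when it rings, the values at $x$ and $x+1$ are swapped if $\eta(x)>\eta(x+1)$, and nothing happens otherwise. Started from $\eta_0(x)=-x$, the map $\eta_t$ is almost surely a bijection of $\mathbb{Z}$, and $\eta_t^{-1}(i)$ is the position at time $t$ of the unique particle of type $i$. The $k$-leader at time $t$ is the right-most among the particles of types $\ge k$: the particle of type $i\ge k$ such that $\eta_t^{-1}(i)\ge\eta_t^{-1}(z)$ for all $z\ge k$. $\mathrm{erf}(z)=\frac{2}{\sqrt{\pi}}\int_0^z e^{-s^2}ds$. *)

(* Defs.v *)
From HB Require Import structures.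
From mathcomp Require Import all_boot all_order all_algebra.
From mathcomp Require Import all_classical all_reals all_analysis.

Set Implicit Arguments.
Unset Strict Implicit.
Unset Printing Implicit Defensive.

Import Order.TTheory GRing.Theory Num.Theory.
Import numFieldNormedType.Exports.

Local Open Scope classical_set_scope.
Local Open Scope ring_scope.

Section Clocks.
Context {d : measure_display} {Omega : measurableType d} {R : realType}.
Variable P : probability Omega R.

Definition mutually_independent (I : eqType) (X : I -> {RV P >-> R}) : Prop :=
  forall (s : seq I) (A : I -> set R), uniq s ->
    (forall i, measurable (A i)) ->
    P (\bigcap_(i in [set` s]) (X i @^-1` A i)) =
    (\prod_(i <- s) P (X i @^-1` A i))%E.

(* [W x n] is the waiting time of the clock of the edge [(x, x + 1)] between
   its [n]-th and its [n.+1]-th ring (the 0-th ring being time 0). *)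
Definition rate1_clocks (W : int -> nat -> {RV P >-> R}) : Prop :=
  mutually_independent (fun j : int * nat => W j.1 j.2) /\
  forall x n (A : set R), measurable A ->
    distribution P (W x n) A = exponential_prob 1 A.

Definition rings (W : int -> nat -> {RV P >-> R}) (w : Omega)
    (x : int) (t : R) : Prop :=
  exists n : nat, t = \sum_(i < n.+1) W x i w.

End Clocks.

Section Dynamics.
Context {R : realType}.

Definition ring_update (xi : int -> int) (x : int) : int -> int :=
  fun y => if xi (x + 1) < xi x then
             if y == x then xi (x + 1)
             else if y == x + 1 then xi x
             else xi y
           else xi y.

(* Evolution of a trajectory [eta] under the rings [rg x t] of the edges
   [(x, x + 1)].  States are integer valued, so limits in time are expressed
   by eventual equality, site by site; [xi] is the state just before time [t].
   Almost surely two adjacent edges never ring simultaneously and, up to any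
   given time, infinitely many edges on either side of the origin have not
   rung; these conditions then determine the trajectory from [eta 0], block by
   block between silent edges. *)
Definition tasep_path (rg : int -> R -> Prop) (eta : R -> int -> int) : Prop :=
  (forall (t : R) (x : int), 0 <= t -> \forall s \near t^'+, eta s x = eta t x)
  /\
  (forall t : R, 0 < t -> exists xi : int -> int,
    [/\ forall x, \forall s \near t^'-, eta s x = xi x,
        forall x, rg x t ->
          eta t x = ring_update xi x x /\
          eta t (x + 1) = ring_update xi x (x + 1)
      & forall x, ~ rg (x - 1) t -> ~ rg x t -> eta t x = xi x]).

Definition multitype_TASEP {d : measure_display} {Omega : measurableType d}
    (P : probability Omega R) (W : int -> nat -> {RV P >-> R})
    (eta0 : int -> int) (eta : R -> Omega -> int -> int) : Prop :=
  [/\ rate1_clocks W,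
      forall (t : R) (x i : int), 0 <= t ->
        measurable [set w | eta t w x = i],
      {ae P, forall w, eta 0 w = eta0}
    & {ae P, forall w, tasep_path (rings W w) (fun t => eta t w)}].

End Dynamics.

Definition is_leader (k : int) (eta : int -> int) (i x : int) : Prop :=
  [/\ k <= i, eta x = i & forall z y, k <= z -> eta y = z -> y <= x].

(* There is at most one leader; the default values of [xget] are used only if
   there is none, which has probability 0 in the process considered here. *)
Definition leader_type (k : int) (eta : int -> int) : int :=
  xget k [set i | exists x, is_leader k eta i x].

Definition leader_position (k : int) (eta : int -> int) : int :=
  xget 0 [set x | exists i, is_leader k eta i x].

Section Laws.
Context {R : realType}.

(* Equal to 0 when [P E = 0]. *)
Definition conditional_law {d : measure_display} {Omega : measurableType d}
    (P : probability Omega R) (Y : Omega -> R) (E : set Omega)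
    (A : set R) : \bar R :=
  (P (Y @^-1` A `&` E) / P E)%E.

Definition law_with_density (f : R -> R) (A : set R) : \bar R :=
  (\int[lebesgue_measure]_(a in A) (f a)%:E)%E.

Definition probability_density (f : R -> R) : Prop :=
  [/\ measurable_fun setT f, forall a, 0 <= f a
    & law_with_density f setT = 1%E].

Definition converges_in_distribution (mu : R -> set R -> \bar R)
    (nu : set R -> \bar R) : Prop :=
  forall a : R, {for a, continuous (fun b : R => nu `]-oo, b]%classic)} ->
    mu t `]-oo, a]%classic @[t --> +oo] --> nu `]-oo, a]%classic.

(* The integral from 0 to [z] is oriented. *)
Definition erf (z : R) : R :=
  2 / Num.sqrt pi *
  (if 0 <= z then \int[lebesgue_measure]_(s in `[0, z]) expR (- s ^+ 2)
   else - \int[lebesgue_measure]_(s in `[z, 0]) expR (- s ^+ 2)).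

Definition limit_density (x a : R) : R :=
  1 / Num.sqrt (2 * pi) * expR (- ((x + a) ^+ 2 / 2)) *
  (1 + Num.sqrt (2 * pi) / 2 * (1 + erf (x / Num.sqrt 2)) *
       expR (x ^+ 2 / 2) * (a + x)) *
  \1_(`[0, +oo[%classic) a.

End Laws.

(* Main.v *)
(* The k-leader jumps exactly when the edge in front of it rings, so it performs
   a rate 1 walk, and the leaders of all levels read the same clocks.  When the
   k-leader sits at y, its type is < k + m if and only if the (k+m)-leader has
   not reached y yet.  Let tau <= sigma be the arrival times of these two
   leaders at y, and let H_n(v) be the probability that a walk started at time v
   makes its n-th jump after time t.  By the memorylessness of the clock of the
   edge y, the antisymmetric part in (i, j) of E[H_i(tau) H_j(sigma)] at y + 1
   equals that in (i + 1, j + 1) at y; going back to tau = 0 this yields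
     P(L1 - k < m, X1 = - k + n) = T_(n+1) T_(n+m) - T_n T_(n+m+1),
   where T_n is the probability that a Poisson variable of mean t is < n.
   Dividing by P(X1 = - k + n), which is the Poisson weight p_n, gives
     P(L1 - k < m | X1 = - k + n) = T_(n+m) - T_n p_(n+m) / p_n.
   With Phi and phi the standard normal distribution function and density, the
   central and local limit theorems for the Poisson law make this converge to
     Phi(x + a) - Phi(x) / phi(x) * phi(x + a),
   whose derivative in a is the density of the statement. *)

Require Import Defs.
From HB Require Import structures.
From mathcomp Require Import all_boot all_order all_algebra.
From mathcomp Require Import all_classical all_reals all_analysis.
From mathcomp Require Import measurable_realfun.
From mathcomp Require Import ring lra zify.

Set Implicit Arguments.
Unset Strict Implicit.
Unset Printing Implicit Defensive.

Import Order.TTheory GRing.Theory Num.Theory.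
Import numFieldNormedType.Exports.

Local Open Scope classical_set_scope.
Local Open Scope ring_scope.

(** * The error function and the normal law *)

(** E[H_i(tau) H_j(sigma)] alone has no closed recursion from one site to the next: if the edge does
    not ring between tau and sigma, both leaders leave with the same ring, and the product at that
    ring is not a function of the single tails. This unknown term is symmetric in i and j, which is
    why only antisymmetric parts are followed. The pair (1, 0) suffices: averaging over the clock
    ahead turns the event that the k-leader has not yet left y into H_1(tau), while in the exchanged
    expectation H_1(sigma) = 1 on {t < tau}.

    The trajectory allows no induction over its events, since the ring times of infinitely many
    edges are almost surely dense. Bounds on the type at a single site are propagated by real
    induction instead.

    Both Poisson limit theorems come from one Gaussian limit of gamma densities. As a function of
    its mean, a Poisson weight is minus the derivative of a tail sum. After scaling it converges
    under a bound independent of n: integrated over the line this gives Stirling's constant, over a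
    half-line the central limit theorem, and the integrand itself gives the local one. *)

Section gaussian.
Context {R : realType}.
Local Notation mu := (@lebesgue_measure R).

Definition std_density (x : R) : R := expR (- (x ^+ 2 / 2)) / Num.sqrt (2 * pi).

Definition std_cdf (x : R) : R := (1 + erf (x / Num.sqrt 2)) / 2.

Lemma sqrt2pi_gt0 : 0 < Num.sqrt (2 * pi) :> R.
Proof. by rewrite sqrtr_gt0 mulr_gt0 ?pi_gt0. Qed.

Lemma gauss_itv_integrable (i : interval R) :
  mu.-integrable [set` i] (EFin \o (fun s : R => expR (- s ^+ 2))).
Proof. by apply: integrableS (@integrableT_gauss R). Qed.

(** The definition of [erf] splits at 0. A base point [- M] to the left of both 0 and [z] replaces
    the two cases by one integral with variable upper end, to which the fundamental theorem of
    calculus applies, also at 0. *)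
Lemma erf_split (M z : R) : 0 <= M -> - M <= z ->
  erf z = 2 / Num.sqrt pi *
    (\int[mu]_(s in `[- M, z]) expR (- s ^+ 2) -
     \int[mu]_(s in `[- M, 0]) expR (- s ^+ 2)).
Proof.
move=> M0 Mz; rewrite /erf; congr (_ * _).
case: ifPn => z0.
  rewrite (@Rintegral_itvB _ _ (BLeft (-M)) (BRight z) 0)//.
  - by rewrite Rintegral_itv_obnd_cbnd//; exact: gauss_itv_integrable.
  - exact: gauss_itv_integrable.
  - by rewrite bnd_simp lerNl oppr0.
rewrite -ltNge in z0.
rewrite -[in RHS]opprB; congr (- _).
rewrite (@Rintegral_itvB _ _ (BLeft (-M)) (BRight 0) z)//.
- by rewrite Rintegral_itv_obnd_cbnd//; exact: gauss_itv_integrable.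
- exact: gauss_itv_integrable.
- by rewrite bnd_simp ltW.
Qed.

Lemma erfN (z : R) : erf (- z) = - erf z.
Proof.
wlog z0 : z / 0 < z.
  move=> H; case: (ltgtP z 0) => [z0|z0|->].
  - by rewrite -[z in RHS]opprK (H (- z)) ?opprK// oppr_gt0.
  - exact: H.
  - by rewrite oppr0 /erf lexx set_itv1 Rintegral_set1 mulr0 oppr0.
rewrite /erf oppr_ge0 leNgt z0/= (ltW z0) mulrN; congr (- (_ * _)).
rewrite -{1}[0]oppr0 /Rintegral integration_by_substitution_oppr//.
- by congr fine; apply: eq_integral => s _ /=; rewrite sqrrN.
- exact: ltW.
- exact: continuous_subspaceT (@continuous_gauss_fun R).
Qed.

Lemma is_derive_erf (z : R) :
  is_derive z 1 (@erf R) (2 / Num.sqrt pi * expR (- z ^+ 2)).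
Proof.
pose M : R := `|z| + 1.
have M0 : 0 <= M by rewrite /M addr_ge0.
have Mz : - M < z.
  rewrite ltrNl /M; apply: (@le_lt_trans _ _ `|z|); last by rewrite ltrDl.
  by rewrite -normrN ler_norm.
pose F (x : R) : R := \int[mu]_(s in `[- M, x]) expR (- s ^+ 2).
have [dF F'] : derivable F z 1 /\ derive1 F z = expR (- z ^+ 2).
  apply: (@continuous_FTC1_closed _ _ _ _ (z + 1)) => //.
  - by rewrite ltrDl.
  - exact: gauss_itv_integrable.
  - exact: continuous_gauss_fun.
have HF : is_derive z 1 F (expR (- z ^+ 2)).
  by apply: DeriveDef; [exact: dF|rewrite -derive1E F'].
apply: (@near_eq_is_derive _ _ _ (fun x => 2 / Num.sqrt pi * (F x - F 0))).
  near=> x; rewrite (@erf_split M)//; apply/ltW.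
  by near: x; exact: lt_nbhsr.
by apply: is_derive_eq; rewrite subr0.
Unshelve. all: by end_near. Qed.

Lemma erf_cvgy : @erf R x @[x --> +oo] --> (1 : R).
Proof.
have spi : 0 < Num.sqrt pi :> R by rewrite sqrtr_gt0 pi_gt0.
have -> : (1 : R) = 2 / Num.sqrt pi * (Num.sqrt pi / 2).
  by field; exact: lt0r_neq0.
apply: (@cvg_trans _ ((2 / Num.sqrt pi * gauss_integral_proof.integral0_gauss x)
   @[x --> (+oo : set_system R)])).
  apply: near_eq_cvg; near=> x; rewrite /erf ifT//.
apply: cvgM; first exact: cvg_cst.
have -> : Num.sqrt pi / 2 = Num.sqrt (pi / 4) :> R.
  rewrite sqrtrM ?pi_ge0// sqrtrV// (_ : 4 = 2 ^+ 2) ?sqrtr_sqr ?ger0_norm//.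
  by rewrite expr2 -natrM.
(* The known limit is that of the square, pi / 4. *)
have -> : gauss_integral_proof.integral0_gauss =
    (fun x : R => Num.sqrt (gauss_integral_proof.integral0_gauss x ^+ 2)).
  apply/funext => x; rewrite sqrtr_sqr ger0_norm//.
  exact: gauss_integral_proof.integral0_gauss_ge0.
apply: continuous_cvg; first exact: sqrt_continuous.
exact: gauss_integral_proof.cvg_integral0_gauss_sqr.
Unshelve. all: by end_near. Qed.

Lemma is_derive_std_cdf (x : R) : is_derive x 1 std_cdf (std_density x).
Proof.
have s2 : 0 < Num.sqrt 2 :> R by rewrite sqrtr_gt0.
have spi : 0 < Num.sqrt pi :> R by rewrite sqrtr_gt0 pi_gt0.
have H := is_derive_erf (x / Num.sqrt 2).
have H1 : is_derive x 1 (fun x : R => x / Num.sqrt 2) (Num.sqrt 2)^-1.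
  by apply: is_derive_eq; rewrite !scaler0 add0r [LHS]mulr1.
have H2 := @is_derive1_comp _ _ (fun x : R => x / Num.sqrt 2) _ _ _ H H1.
have H3 : is_derive x 1 std_cdf
    (2^-1 * (2 / Num.sqrt pi * expR (- (x / Num.sqrt 2) ^+ 2) / Num.sqrt 2)).
  rewrite (_ : std_cdf = fun x => 2^-1 * (1 + (erf \o (fun x => x / Num.sqrt 2)) x)).
    move: H2; move: (erf \o _) (2 / _ * _ / _) => f f' Hf.
    by apply: is_derive_eq; rewrite add0r mul1r.
  by apply/funext => y; rewrite /std_cdf mulrC.
apply: (is_derive_eq H3); rewrite /std_density sqrtrM//.
rewrite exprMn exprVn sqr_sqrtr//.
by field; rewrite !gt_eqF.
Qed.

Lemma std_cdfN (x : R) : std_cdf (- x) = 1 - std_cdf x.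
Proof. by rewrite /std_cdf mulNr erfN; field. Qed.

Lemma std_cdf_cvgy : std_cdf x @[x --> +oo] --> (1 : R).
Proof.
rewrite (_ : (1 : R) = (1 + 1) / 2); last by field.
apply: cvgMl; apply: cvgD; first exact: cvg_cst.
apply: (@cvg_comp _ _ _ (fun x : R => x / Num.sqrt 2) _ _ (pinfty_nbhs R)); last exact: erf_cvgy.
by apply: gt0_cvgMly; rewrite ?invr_gt0 ?sqrtr_gt0.
Qed.

Lemma std_cdf_cvgNy : std_cdf x @[x --> -oo] --> (0 : R).
Proof.
rewrite (_ : std_cdf = (fun x => 1 - std_cdf (- x))); last first.
  by apply/funext => x; rewrite std_cdfN opprB addrCA subrr addr0.
rewrite -[X in _ --> X](subrr 1); apply: cvgB; first exact: cvg_cst.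
apply: (@cvg_comp _ _ _ (fun x : R => - x) _ _ (pinfty_nbhs R)); last exact: std_cdf_cvgy.
by apply/cvgNry; exact: cvg_id.
Qed.
End gaussian.

(** * Poisson weights and gamma tails *)

Section log_expansion.
Context {R : realType}.

Lemma is_derive_ge0_le (f f' : R -> R) (a : R) :
  (forall x, a < x -> is_derive x 1 f (f' x)) ->
  (forall x, a < x -> 0 <= f' x) ->
  forall x y, a < x -> x <= y -> f x <= f y.
Proof.
move=> df f'0 x y ax xy; apply: (@ger0_derive1_ndecr _ f x y) => //.
- by move=> z /[!in_itv]/= /andP[xz _]; have /df [] := lt_trans ax xz.
- move=> z /[!in_itv]/= /andP[xz _]; have az := lt_trans ax xz.
  by rewrite derive1E (@derive_val _ _ _ _ _ _ _ (df _ az)) f'0.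
- apply: derivable_within_continuous => z /[!in_itv]/= /andP[xz _].
  by have /df [] := lt_le_trans ax xz.
Qed.

Let is_derive_ln1D (v : R) : -1 < v ->
  is_derive v 1 (fun x : R => ln (1 + x)) (1 + v)^-1.
Proof.
move=> v1; have v0 : 0 < 1 + v by rewrite addrC -ltrBlDr sub0r.
have H1 : is_derive v 1 (fun x : R => 1 + x) 1.
  by apply: is_derive_eq; rewrite add0r mulr1.
have := @is_derive1_comp _ _ (fun x : R => 1 + x) _ _ _ (is_derive1_ln v0) H1.
by rewrite mulr1.
Qed.

(** This function has derivative v^2 / (1 + v), and [ln1D_high] has derivative - v^2 / (2 (1 +
    v)^2). Both are monotone and vanish at 0. *)
Let ln1D_low (v : R) : R := ln (1 + v) - v + v ^+ 2 / 2.

Let ln1D_high (v : R) : R := ln (1 + v) - v + v ^+ 2 / (2 * (1 + v)).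

Let ln1D_low_le (x y : R) : -1 < x -> x <= y -> ln1D_low x <= ln1D_low y.
Proof.
apply: (@is_derive_ge0_le _ (fun x => x ^+ 2 / (1 + x))) => {}x x1.
  have x0 : 0 < 1 + x by rewrite addrC -ltrBlDr sub0r.
  have H := is_derive_ln1D x1.
  apply: is_derive_eq.
  by rewrite /GRing.scale/=; field; rewrite gt_eqF.
have x0 : 0 < 1 + x by rewrite addrC -ltrBlDr sub0r.
by rewrite divr_ge0 ?sqr_ge0 ?ltW.
Qed.

Let ln1D_high_ge (x y : R) : -1 < x -> x <= y -> ln1D_high y <= ln1D_high x.
Proof.
move=> x1 xy; rewrite -lerN2; move: x y x1 xy.
apply: (@is_derive_ge0_le (fun x => - ln1D_high x) (fun x => x ^+ 2 / (2 * (1 + x) ^+ 2))) => x x1.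
  have x0 : 0 < 1 + x by rewrite addrC -ltrBlDr sub0r.
  have H := is_derive_ln1D x1.
  have x0' : 2 * (1 + x) != 0 by rewrite mulf_neq0// gt_eqF.
  apply: is_derive_eq.
  by rewrite /GRing.scale/=; field; rewrite gt_eqF.
have x0 : 0 < 1 + x by rewrite addrC -ltrBlDr sub0r.
by rewrite divr_ge0 ?sqr_ge0 // mulr_ge0 ?sqr_ge0.
Qed.

(** [ln1D_low v] and [ln1D_high v] have opposite signs, so each is bounded by their difference v^3 /
    (2 (1 + v)). *)
Lemma ln1D_error (v : R) : -1 < v ->
  `|ln (1 + v) - v + v ^+ 2 / 2| <= `|v| ^+ 3 / (2 * (1 + v)).
Proof.
move=> v1; have v0 : 0 < 1 + v by rewrite addrC -ltrBlDr sub0r.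
have lowE : ln (1 + v) - v + v ^+ 2 / 2 = ln1D_low v by [].
have highE : ln1D_high v = ln1D_low v - v ^+ 3 / (2 * (1 + v)).
  by rewrite /ln1D_low /ln1D_high; field; rewrite gt_eqF.
have low0 : ln1D_low 0 = 0 by rewrite /ln1D_low addr0 ln1; field.
have high0 : ln1D_high 0 = 0 by rewrite /ln1D_high addr0 ln1; field.
have [vge0|vle0] := leP 0 v.
  have L : 0 <= ln1D_low v by rewrite -low0 ln1D_low_le// ltrN10.
  have : ln1D_high v <= 0 by rewrite -high0 ln1D_high_ge// ltrN10.
  by rewrite lowE highE ger0_norm// subr_le0 ger0_norm.
have L : ln1D_low v <= 0 by rewrite -low0 ln1D_low_le// ltW.
have : 0 <= ln1D_high v by rewrite -high0 ln1D_high_ge// ltW.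
rewrite lowE highE ler0_norm// subr_ge0 (ltr0_norm vle0) -lerN2 => H.
by rewrite (le_trans H)// exprNn -mulNr; lra.
Qed.

(** The denominator gives one formula for both signs, with a gain that is quadratic for small v and
    linear for large v. This is what dominates all gamma shapes at once. *)
Lemma ln1D_le (v : R) : -1 < v -> ln (1 + v) <= v - v ^+ 2 / (2 * (1 + `|v|)).
Proof.
move=> v1; rewrite -subr_le0 opprB addrA.
have low0 : ln1D_low 0 = 0 by rewrite /ln1D_low addr0 ln1; field.
have high0 : ln1D_high 0 = 0 by rewrite /ln1D_high addr0 ln1; field.
have [vge0|vle0] := leP 0 v.
  have : ln1D_high v <= 0 by rewrite -high0 ln1D_high_ge// ltrN10.
  by rewrite /ln1D_high ger0_norm//; lra.
have : ln1D_low v <= 0 by rewrite -low0 ln1D_low_le// ltW.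
rewrite /ln1D_low.
suff : v ^+ 2 / (2 * (1 + `|v|)) <= v ^+ 2 / 2 by lra.
apply: ler_wpM2l; first exact: sqr_ge0.
rewrite lef_pV2 ?posrE ?mulr_gt0// ?ltr_pwDl//.
by rewrite ler_pMr// lerDl.
Qed.
End log_expansion.

Section poisson_tail.
Context {R : realType}.

Definition poisson_weight (n : nat) (b : R) : R := expR (- b) * b ^+ n / n`!%:R.

(* The probability that a sum of [n] independent exponential times exceeds [b]. *)
Definition gamma_tail (n : nat) (b : R) : R :=
  if b < 0 then 1 else \sum_(i < n) poisson_weight i b.

Lemma poisson_weight_ge0 n b : 0 <= b -> 0 <= poisson_weight n b.
Proof. by move=> b0; rewrite !mulr_ge0 ?invr_ge0 ?expR_ge0 ?exprn_ge0. Qed.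

Lemma gamma_tailS n b : 0 <= b ->
  gamma_tail n.+1 b = gamma_tail n b + poisson_weight n b.
Proof. by move=> b0; rewrite /gamma_tail ltNge b0/= big_ord_recr. Qed.

Lemma is_derive_poisson_weight n (b : R) :
  is_derive b 1 (poisson_weight n)
    ((if n is n'.+1 then poisson_weight n' b else 0) - poisson_weight n b).
Proof.
have H : is_derive b 1 (fun b : R => expR (- b)) (- expR (- b)).
  have := @is_derive1_comp _ _ (fun x : R => - x) _ _ _
    (is_derive_expR (- b)) (is_deriveNid b 1).
  by rewrite mulrN1.
rewrite /poisson_weight; case: n => [|n].
  rewrite (_ : (fun _ => _) = (fun b => expR (- b))); last first.
    by apply/funext => c; rewrite expr0 mulr1 fact0 divr1.
  by apply: (is_derive_eq H); rewrite expr0 mulr1 fact0 divr1 sub0r.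
have HX : is_derive b 1 (fun b : R => b ^+ n.+1) (n.+1%:R * b ^+ n).
  apply: DeriveDef; first exact: exprn_derivable.
  by rewrite exp_derive [LHS]mulr1.
have := is_deriveZ (n.+1)`!%:R^-1 (is_deriveM H HX).
rewrite (_ : (_ \*: _) = (fun b => expR (- b) * b ^+ n.+1 / (n.+1)`!%:R)); last first.
  by apply/funext => c; rewrite [RHS]mulrC.
move=> H'; apply: (is_derive_eq H'); rewrite /GRing.scale/= factS natrM.
have nf : n`!%:R != 0 :> R by rewrite pnatr_eq0 -lt0n fact_gt0.
rewrite exprS; field; rewrite ?nf ?pnatr_eq0//=.
Qed.

Lemma is_derive_poisson_sum n (b : R) :
  is_derive b 1 (fun b => \sum_(i < n.+1) poisson_weight i b)
    (- poisson_weight n b).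
Proof.
elim: n => [|n IH].
  rewrite (_ : (fun _ => _) = poisson_weight 0); last first.
    by apply/funext => c; rewrite big_ord1.
  apply: (is_derive_eq (is_derive_poisson_weight 0 b)); by rewrite sub0r.
rewrite (_ : (fun _ => _) = (fun b => \sum_(i < n.+1) poisson_weight i b) + poisson_weight n.+1); last first.
  by apply/funext => c; rewrite big_ord_recr.
apply: (is_derive_eq (is_deriveD IH (is_derive_poisson_weight n.+1 b))).
by rewrite addKr.
Qed.

Lemma poisson_weight_cvgy n : poisson_weight n b @[b --> +oo] --> (0 : R).
Proof.
apply: (@squeeze_cvgr _ _ _ _ (fun=> 0) (fun b => n.+1%:R / b)); last 2 first.
- exact: cvg_cst.
- rewrite -[X in _ --> X](mulr0 n.+1%:R); apply: cvgMr.
  apply/gtr0_cvgV0; [exact: nbhs_pinfty_gt|exact: cvg_id].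
near=> b; have b0 : 0 < b by near: b; exact: nbhs_pinfty_gt.
apply/andP; split; first exact/poisson_weight_ge0/ltW.
have nf : 0 < n`!%:R :> R by rewrite ltr0n fact_gt0.
(* The term of degree n + 1 of the exponential series bounds the weight by (n + 1) / b. *)
have := expR_ge1Dxn n (ltW b0).
have -> : n.+1%:R / b = (n.+1%:R * expR b * n`!%:R) * (expR (- b) / (b * n`!%:R)).
  by rewrite expRN; field; rewrite !gt_eqF ?expR_gt0.
have -> : poisson_weight n b = b ^+ n.+1 * (expR (- b) / (b * n`!%:R)).
  by rewrite /poisson_weight exprS; field; rewrite !gt_eqF.
move=> H; apply: ler_wpM2r.
  by rewrite divr_ge0 ?expR_ge0// mulr_ge0 ?ltW.
rewrite mulrAC -natrM -factS mulrC -ler_pdivrMr ?ltr0n ?fact_gt0//.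
by apply: le_trans H; rewrite lerDr.
Unshelve. all: by end_near. Qed.
End poisson_tail.

(** * Gaussian limit of the scaled gamma densities and Stirling's constant *)

Section gamma_shape.
Context {R : realType}.
Local Notation mu := (@lebesgue_measure R).

(* [sqrt n] times the Poisson weight of [n] at mean [n + r * sqrt n] is
   [stirling n * gamma_shape n r]; as a function of [r] the latter is the
   density of a centred and scaled gamma law. *)
Definition gamma_shape (n : nat) (r : R) : R :=
  (1 + r / Num.sqrt n%:R) ^+ n * expR (- (r * Num.sqrt n%:R)).

Definition stirling (n : nat) : R :=
  Num.sqrt n%:R * (n%:R ^+ n * expR (- n%:R) / n`!%:R).

Lemma stirling_gt0 n : (0 < n)%N -> 0 < stirling n.
Proof.
move=> n0; rewrite /stirling !mulr_gt0 ?invr_gt0 ?expR_gt0 ?exprn_gt0 ?sqrtr_gt0 ?ltr0n//.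
exact: fact_gt0.
Qed.

Lemma poisson_weight_shape n (r : R) : (0 < n)%N ->
  Num.sqrt n%:R * poisson_weight n (n%:R + r * Num.sqrt n%:R) =
  stirling n * gamma_shape n r.
Proof.
move=> n0; have s0 : Num.sqrt n%:R != 0 :> R by rewrite gt_eqF ?sqrtr_gt0 ?ltr0n.
have s2 : Num.sqrt n%:R ^+ 2 = n%:R :> R by rewrite sqr_sqrtr ?ler0n.
rewrite /poisson_weight /gamma_shape /stirling.
move: (Num.sqrt n%:R) s0 s2 => s s0 s2.
have -> : n%:R + r * s = n%:R * (1 + r / s) by rewrite -s2; field.
rewrite exprMn [n%:R * (1 + _)]mulrDr mulr1.
have -> : n%:R * (r / s) = r * s by rewrite -s2; field.
by rewrite opprD expRD; ring.
Qed.

Lemma gamma_shape_ge0 n (r : R) : (0 < n)%N -> - Num.sqrt n%:R <= r ->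
  0 <= gamma_shape n r.
Proof.
move=> n0 rn; rewrite mulr_ge0 ?expR_ge0// exprn_ge0//.
have s0 : 0 < Num.sqrt n%:R :> R by rewrite sqrtr_gt0 ?ltr0n.
by rewrite -lerBlDl sub0r ler_pdivlMr// mulN1r.
Qed.

Lemma continuous_gamma_shape n : continuous (gamma_shape n).
Proof.
move=> r; rewrite /gamma_shape; apply: cvgM.
  apply: (@continuous_comp _ _ _ (fun r : R => 1 + r / Num.sqrt n%:R) (fun x => x ^+ n)).
    by apply: cvgD; [exact: cvg_cst|apply: cvgMl; exact: cvg_id].
  exact: exprn_continuous.
apply: (@continuous_comp _ _ _ (fun r : R => - (r * Num.sqrt n%:R)) expR).
  by apply: cvgN; apply: cvgMl; exact: cvg_id.
exact: continuous_expR.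
Qed.

Lemma poisson_sum_cvgy n : \sum_(i < n) poisson_weight i b @[b --> +oo] --> (0 : R).
Proof.
elim: n => [|n IH].
  rewrite (_ : (fun _ => _) = cst 0); first exact: cvg_cst.
  by apply/funext => b; rewrite big_ord0.
rewrite (_ : (fun _ => _) = fun b => \sum_(i < n) poisson_weight i b + poisson_weight n b);
  last first.
  by apply/funext => b; rewrite big_ord_recr.
by rewrite -[X in _ --> X](addr0 0); apply: cvgD; [exact: IH|exact: poisson_weight_cvgy].
Qed.

(** Poisson-gamma duality: the sum of the weights 0, ..., n has derivative minus the n-th weight,
    and the affine change of variables [l] turns that weight into [gamma_shape n]. At z = - sqrt n
    the mean is 0 and the tail is 1, so the total mass is 1 / [stirling n]. *)
Lemma integral_gamma_shape n (z : R) : (0 < n)%N -> - Num.sqrt n%:R <= z ->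
  (\int[mu]_(r in `[z, +oo[) (gamma_shape n r)%:E =
   (gamma_tail n.+1 (n%:R + z * Num.sqrt n%:R) / stirling n)%:E)%E.
Proof.
move=> n0 zn.
have s0 : 0 < Num.sqrt n%:R :> R by rewrite sqrtr_gt0 ?ltr0n.
have s2 : Num.sqrt n%:R ^+ 2 = n%:R :> R by rewrite sqr_sqrtr ?ler0n.
have C0 := stirling_gt0 n0.
pose S (b : R) : R := \sum_(i < n.+1) poisson_weight i b.
pose l (r : R) : R := n%:R + r * Num.sqrt n%:R.
pose F (r : R) : R := - (stirling n)^-1 * S (l r).
have dF (r : R) : is_derive r 1 F (gamma_shape n r).
  have dl : is_derive r 1 l (Num.sqrt n%:R).
    by apply: is_derive_eq; rewrite !add0r scaler0 add0r mul1r [LHS]mulr1.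
  have := @is_derive1_comp _ _ l _ _ _ (is_derive_poisson_sum n (l r)) dl.
  move=> /(is_deriveZ (- (stirling n)^-1)) H; apply: (is_derive_eq H).
  transitivity ((stirling n)^-1 * (Num.sqrt n%:R * poisson_weight n (l r))).
    by rewrite /GRing.scale/=; ring.
  by rewrite (poisson_weight_shape _ n0) mulKf// gt_eqF.
have l0 : 0 <= l z.
  rewrite /l; move: (Num.sqrt n%:R) zn s0 s2 => s zn s0 <-; nra.
rewrite (@ge0_continuous_FTC2y _ _ F _ 0).
- rewrite add0e -EFinN /F /gamma_tail ltNge l0/=; congr EFin.
  by rewrite mulNr opprK mulrC.
- by move=> r zr; apply: gamma_shape_ge0 => //; exact: le_trans zr.
- exact/continuous_subspaceT/continuous_gamma_shape.
- rewrite -[X in _ --> X](mulr0 (- (stirling n)^-1)); apply: cvgMr.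
  apply: (@cvg_comp _ _ _ l S _ (pinfty_nbhs R)).
    apply: (@cvg_comp _ _ _ (fun r => r * Num.sqrt n%:R) (fun r => n%:R + r) _ (pinfty_nbhs R)).
      by apply: gt0_cvgMly => //; exact: cvg_id.
    exact: cvg_addrl.
  exact: poisson_sum_cvgy.
- by move=> r _; have [] := dF r.
- apply: cvg_at_right_filter; apply/differentiable_continuous/derivable1_diffP.
  by have [] := dF z.
- by move=> r _; rewrite derive1E (@derive_val _ _ _ _ _ _ _ (dF r)).
Qed.

Lemma cvg_sqrtn_y (T : Type) (F : set_system T) {FF : Filter F} (N : T -> nat) :
  N t @[t --> F] --> \oo -> Num.sqrt (N t)%:R @[t --> F] --> (+oo : set_system R).
Proof.
move=> /cvgrnyP /cvgryPge NF; apply/cvgryPge => A.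
apply: filterS (NF R (A ^+ 2)) => t At.
by rewrite (le_trans (ler_norm A))// -sqrtr_sqr ler_wsqrtr.
Qed.

Lemma gamma_shapeE n (r : R) : (0 < n)%N -> - Num.sqrt n%:R < r ->
  gamma_shape n r =
  expR (n%:R * ln (1 + r / Num.sqrt n%:R) - r * Num.sqrt n%:R).
Proof.
move=> n0 rn; have s0 : 0 < Num.sqrt n%:R :> R by rewrite sqrtr_gt0 ?ltr0n.
have v0 : 0 < 1 + r / Num.sqrt n%:R.
  by rewrite -ltrBlDl sub0r ltr_pdivlMr// mulN1r.
by rewrite expRD expRM_natl lnK// posrE.
Qed.

(** By [ln1D_le] the exponent is at most - r^2 / (2 (1 + |r| / sqrt n)), hence at most - r^2 / (2 (1
    + |r|)) as sqrt n >= 1; lowering r^2 to r^2 - 1 leaves (1 - |r|) / 2. The bound is free of n, as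
    dominated convergence requires. *)
Lemma gamma_shape_le n (r : R) : (0 < n)%N -> - Num.sqrt n%:R <= r ->
  gamma_shape n r <= expR ((1 - `|r|) / 2).
Proof.
move=> n0; rewrite le_eqVlt => /predU1P[<-|rn].
  have s0 : 0 < Num.sqrt n%:R :> R by rewrite sqrtr_gt0 ?ltr0n.
  rewrite /gamma_shape mulNr divff ?gt_eqF// subrr expr0n gtn_eqF// mul0r.
  exact: expR_ge0.
rewrite gamma_shapeE// ler_expR.
have s1 : 1 <= Num.sqrt n%:R :> R by rewrite -[leLHS]sqrtr1 ler_sqrt ?ltr0n// ler1n.
have s2 : Num.sqrt n%:R ^+ 2 = n%:R :> R by rewrite sqr_sqrtr ?ler0n.
move: (Num.sqrt n%:R) rn s1 s2 => s rn s1 s2.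
have s0 : 0 < s by exact: lt_le_trans s1.
have v1 : -1 < r / s by rewrite ltr_pdivlMr// mulN1r.
have := ln1D_le v1; rewrite -(ler_pM2l (_ : 0 < n%:R)) ?ltr0n// => H.
rewrite lerBlDr (le_trans H)// -s2 normrM normfV (gtr0_norm s0).
have -> : s ^+ 2 * (r / s - (r / s) ^+ 2 / (2 * (1 + `|r| / s))) =
    r * s - r ^+ 2 / (2 * (1 + `|r| / s)).
  by field; rewrite !gt_eqF//= ltr_wpDr.
rewrite addrC lerD2r.
have r0 : 0 <= `|r| by [].
have -> : (1 - `|r|) / 2 = - ((r ^+ 2 - 1) / (2 * (1 + `|r|))).
  by rewrite -(real_normK (num_real r)); field; rewrite gt_eqF// ltr_wpDr.
rewrite lerN2 (@le_trans _ _ (r ^+ 2 / (2 * (1 + `|r|))))//.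
  by rewrite ler_wpM2r ?invr_ge0 ?mulr_ge0 ?addr_ge0// lerBlDr lerDl.
apply: ler_wpM2l; first exact: sqr_ge0.
have d1 : 0 < 2 * (1 + `|r|) by rewrite mulr_gt0// ltr_wpDr.
have d2 : 0 < 2 * (1 + `|r| / s).
  by rewrite mulr_gt0// ltr_wpDr// divr_ge0//; exact: ltW.
rewrite lef_pV2 ?posrE//.
by rewrite ler_pM2l// lerD2l ler_pdivrMr// ler_peMr.
Qed.

(** The argument r may move along the filter: the same statement serves as pointwise limit under the
    integral and as local limit theorem at a moving index. *)
Lemma gamma_shape_cvg (T : Type) (F : set_system T) {FF : Filter F}
    (N : T -> nat) (r : T -> R) (rho : R) :
  N t @[t --> F] --> \oo -> r t @[t --> F] --> rho ->
  gamma_shape (N t) (r t) @[t --> F] --> expR (- (rho ^+ 2 / 2)).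
Proof.
move=> NF rF.
pose s t : R := Num.sqrt (N t)%:R.
have N0 : \forall t \near F, (0 < N t)%N by exact: (NF _ (nbhs_infty_gt 0)).
have sV : (s t)^-1 @[t --> F] --> (0 : R).
  apply/gtr0_cvgV0; first by near=> t; rewrite sqrtr_gt0 ltr0n; near: t.
  exact: cvg_sqrtn_y.
have vF : r t * (s t)^-1 @[t --> F] --> (0 : R).
  by rewrite -[X in _ --> X](mulr0 rho); apply: cvgM.
have eF : (N t)%:R * ln (1 + r t / s t) - r t * s t @[t --> F] --> - (rho ^+ 2 / 2).
  have eE t : (N t)%:R * ln (1 + r t / s t) - r t * s t =
      ((N t)%:R * ln (1 + r t / s t) - r t * s t + r t ^+ 2 / 2) + - (r t ^+ 2 / 2).
    by rewrite addrK.
  rewrite (funext eE).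
  rewrite -[X in _ --> X]add0r; apply: cvgD; last first.
    by apply: cvgN; apply: cvgMl; apply: cvgM.
  apply: norm_cvg0.
  apply: (@squeeze_cvgr _ _ _ _ (fun=> 0) (fun t => `|r t| ^+ 3 * (s t)^-1)).
  - near=> t; rewrite normr_ge0/=.
    have Nt : (0 < N t)%N by near: t.
    have st0 : 0 < s t by rewrite sqrtr_gt0 ltr0n.
    have s2 : s t ^+ 2 = (N t)%:R by rewrite sqr_sqrtr.
    (* Beyond - 1/2 the denominator 2 (1 + v) in [ln1D_error] is at least 1, which leaves an error
       of at most |r|^3 / sqrt n. *)
    have vt : - 2^-1 < r t / s t.
      by near: t; apply: (cvgr_gt 0 vF); rewrite oppr_lt0 invr_gt0.
    have v1 : -1 < r t / s t by apply: le_lt_trans vt; rewrite lerN2 invf_le1// ler1n.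
    have := ln1D_error v1; rewrite -(ler_pM2l (_ : 0 < (N t)%:R)) ?ltr0n// => H.
    rewrite -{1}(gtr0_norm (_ : 0 < (N t)%:R)) ?ltr0n// -normrM in H.
    rewrite [X in `|X|](_ : _ = (N t)%:R *
      (ln (1 + r t / s t) - r t / s t + (r t / s t) ^+ 2 / 2)); last first.
      by rewrite -s2; field; rewrite gt_eqF.
    apply: (le_trans H); rewrite -s2 normrM normfV (gtr0_norm st0).
    have w1 : 1 <= 2 * (1 + r t / s t) by lra.
    have -> (w : R) : s t ^+ 2 * ((`|r t| / s t) ^+ 3 / w) = (`|r t| ^+ 3 / s t) / w.
      by rewrite mulrA; congr (_ / _); field; rewrite gt_eqF.
    rewrite ler_pdivrMr ?(lt_le_trans ltr01)//.
    by rewrite ler_peMr// divr_ge0 ?exprn_ge0// ltW.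
  - exact: cvg_cst.
  - rewrite -[X in _ --> X](mulr0 (`|rho| ^+ 3)); apply: cvgM => //.
    apply: (cvg_comp _ (fun x => x ^+ 3) (cvg_norm rF)); exact: exprn_continuous.
apply: (@cvg_trans _ (expR ((N t)%:R * ln (1 + r t / s t) - r t * s t) @[t --> F])).
  apply: near_eq_cvg; near=> t; rewrite gamma_shapeE//.
    by near: t.
  have Nt : (0 < N t)%N by near: t.
  have st0 : 0 < s t by rewrite sqrtr_gt0 ltr0n.
  have vt : - 1 < r t / s t.
    by near: t; apply: (cvgr_gt 0 vF); rewrite oppr_lt0.
  by rewrite -mulN1r -ltr_pdivlMr.
exact: (cvg_comp _ expR eF (@continuous_expR R _)).
Unshelve. all: by end_near. Qed.

Lemma is_derive_continuous (f : R -> R) (x df : R) :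
  is_derive x 1 f df -> {for x, continuous f}.
Proof. by move=> [df' _]; exact/differentiable_continuous/derivable1_diffP. Qed.

Lemma is_derive_affine (a b r : R) : is_derive r 1 (fun x : R => a + b * x) b.
Proof.
have H := is_deriveD (is_derive_cst a r 1) (is_deriveZ b (is_derive_id r 1)).
by apply: (is_derive_eq H); rewrite add0r [LHS]mulr1.
Qed.

Lemma integrable_expRNnorm : mu.-integrable setT (fun r => (expR ((1 - `|r|) / 2))%:E).
Proof.
have cf : continuous (fun r : R => expR ((1 - `|r|) / 2)).
  move=> r; apply: (@continuous_comp _ _ _ (fun r : R => (1 - `|r|) / 2) expR).
    by apply: cvgMl; apply: cvgB; [exact: cvg_cst|exact: norm_continuous].
  exact: continuous_expR.
apply/integrableP; split.
  by apply/measurable_EFinP; exact: continuous_measurable_fun.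
under eq_integral do rewrite gee0_abs ?lee_fin ?expR_ge0//.
rewrite ge0_symfun_integralT//=; last by move=> r; rewrite /= normrN.
rewrite [X in (\int[_]_(_ in X) _)%E](_ : _ = `[0, +oo[%classic); last first.
  by apply/seteqP; split => r /=; rewrite in_itv/= andbT.
rewrite [X in (_ * X)%E](_ : _ = \int[mu]_(r in `[0%R, +oo[) (expR ((1 - r) / 2))%:E)%E; last first.
  by apply: eq_integral => r; rewrite inE/= in_itv/= andbT => r0; rewrite ger0_norm.
have dF (r : R) : is_derive r 1 (fun r : R => -2 * expR ((1 - r) / 2)) (expR ((1 - r) / 2)).
  have dl : is_derive r 1 (fun r : R => (1 - r) / 2) (- 2^-1).
    rewrite (_ : (fun _ => _) = (fun r : R => 2^-1 + (- 2^-1) * r)).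
      exact: is_derive_affine.
    by apply/funext => y; field.
  have := @is_derive1_comp _ _ (fun r : R => (1 - r) / 2) _ _ _ (is_derive_expR _) dl.
  move=> /(is_deriveZ (-2)) H; apply: (is_derive_eq H).
  by rewrite /GRing.scale/=; field.
rewrite (@ge0_continuous_FTC2y _ _ (fun r => -2 * expR ((1 - r) / 2)) _ 0).
- by rewrite -EFinB -EFinM ltry.
- by move=> r _; exact: expR_ge0.
- apply: continuous_subspaceT => r; apply: (@continuous_comp _ _ _ (fun r : R => (1 - r) / 2) expR).
    by apply: cvgMl; apply: cvgB; [exact: cvg_cst|exact: cvg_id].
  exact: continuous_expR.
- rewrite -[X in _ --> X](mulr0 (-2)); apply: cvgMr.
  rewrite (_ : (fun _ => _) = (fun y : R => expR (- y)) \o (fun x : R => (x - 1) / 2)).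
    apply: (@cvg_comp _ _ _ _ _ _ (pinfty_nbhs R)); last exact: cvgr_expR.
    by apply: gt0_cvgMly; [rewrite invr_gt0|exact: cvg_addrr].
  by apply/funext => x /=; rewrite -mulNr opprB.
- by move=> r _; have [] := dF r.
- by apply: cvg_at_right_filter; apply: is_derive_continuous (dF 0).
- by move=> r _; rewrite derive1E (@derive_val _ _ _ _ _ _ _ (dF r)).
Qed.

Lemma std_densityE (x : R) : std_density x = normal_pdf 0 1 x.
Proof.
rewrite normal_pdfE ?oner_eq0//= /normal_fun /normal_peak /std_density.
by rewrite subr0 expr1n mul1r mulNr mulr_natl mulrC.
Qed.

Lemma integral_std_density_y (z : R) :
  (\int[mu]_(r in `[z, +oo[) (std_density r)%:E = (1 - std_cdf z)%:E)%E.
Proof.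
rewrite EFinB; apply: ge0_continuous_FTC2y.
- by move=> r _; rewrite std_densityE normal_pdf_ge0.
- rewrite (funext std_densityE); apply: continuous_subspaceT.
  by apply: continuous_normal_pdf; rewrite oner_eq0.
- exact: std_cdf_cvgy.
- by move=> r _; have [] := is_derive_std_cdf r.
- by apply: cvg_at_right_filter; apply: is_derive_continuous (is_derive_std_cdf z).
- by move=> r _; rewrite derive1E (@derive_val _ _ _ _ _ _ _ (is_derive_std_cdf r)).
Qed.

Lemma measurable_gamma_shape n :
  measurable_fun setT (gamma_shape n \_ `[- Num.sqrt n%:R, +oo[).
Proof.
apply/(measurable_restrictT _ _).1 => //; apply: measurable_funTS.
by apply: continuous_measurable_fun; exact: continuous_gamma_shape.
Qed.

(** Left of - sqrt n the mean is negative and the shape is not a density, so it is cut off there;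
    each fixed r lies inside the cutoff for large n. *)
Lemma integral_gamma_shape_cvg (D : set R) : measurable D ->
  (\int[mu]_(r in D) ((gamma_shape n \_ `[- Num.sqrt n%:R, +oo[) r)%:E)%E @[n --> \oo]
  --> (\int[mu]_(r in D) (expR (- (r ^+ 2 / 2)))%:E)%E.
Proof.
(* The shift makes the index positive, as the bounds on the shape demand. *)
move=> mD; rewrite -(cvg_shiftS _).
pose f_ (n : nat) (r : R) : \bar R := ((gamma_shape n.+1 \_ `[- Num.sqrt n.+1%:R, +oo[) r)%:E.
have [] // := @dominated_convergence _ _ _ mu D mD f_ (fun r => (expR (- (r ^+ 2 / 2)))%:E) (fun r => (expR ((1 - `|r|) / 2))%:E).
- move=> n; apply/measurable_EFinP; apply: measurable_funTS; exact: measurable_gamma_shape.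
- apply/measurable_EFinP; apply: measurable_funTS; apply: continuous_measurable_fun.
  move=> r; apply: (@continuous_comp _ _ _ (fun r : R => - (r ^+ 2 / 2)) expR).
    by apply: cvgN; apply: cvgMl; exact: exprn_continuous.
  exact: continuous_expR.
- apply: aeW => r Dr; apply: cvg_EFin; first exact: nearW.
  have NS : (fun n : nat => n.+1) @ \oo --> \oo by apply/cvgnyPge => A; near=> n; apply: leqW;
    near: n; exact: nbhs_infty_ge.
  have H : gamma_shape n.+1 r @[n --> \oo] --> expR (- (r ^+ 2 / 2)).
    by apply: (gamma_shape_cvg (r := fun=> r) NS); exact: cvg_cst.
  apply: cvg_trans H; apply: near_eq_cvg.
  have SN : Num.sqrt n.+1%:R @[n --> \oo] --> (+oo : set_system R).
    exact: (@cvg_sqrtn_y _ _ _ (fun n => n.+1) NS).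
  move/cvgryPge/(_ (- r)) : SN.
  apply: filterS => n rn /=; rewrite patchE mem_set//= in_itv/= andbT.
  by rewrite lerNl.
- exact: integrableS integrable_expRNnorm.
- apply: aeW => r n Dr; rewrite /f_ lee_fin patchE.
  case: ifPn => [|_]; last by rewrite normr0 expR_ge0.
  rewrite inE/= in_itv/= andbT => rn.
  by rewrite ger0_norm ?gamma_shape_le// gamma_shape_ge0.
Unshelve. all: by end_near. Qed.

Lemma expR_std_density (r : R) : expR (- (r ^+ 2 / 2)) = Num.sqrt (2 * pi) * std_density r.
Proof. by rewrite /std_density mulrCA divff ?mulr1// gt_eqF// sqrt2pi_gt0. Qed.

Lemma integral_expR_sqr (D : set R) : measurable D ->
  (\int[mu]_(r in D) (expR (- (r ^+ 2 / 2)))%:E =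
   (Num.sqrt (2 * pi))%:E * \int[mu]_(r in D) (std_density r)%:E)%E.
Proof.
move=> mD; under eq_integral do rewrite expR_std_density EFinM.
rewrite ge0_integralZl ?lee_fin ?ltW ?sqrt2pi_gt0//.
- apply/measurable_EFinP; rewrite (funext std_densityE).
  by apply: measurable_funTS; exact: measurable_normal_pdf.
- by move=> r _; rewrite lee_fin std_densityE normal_pdf_ge0.
Qed.

(** Stirling's formula read off from masses: over the whole line the cut-off shape has mass 1 /
    [stirling n], and its limit has the Gaussian mass sqrt (2 pi). *)
Lemma stirlingV_cvg : (stirling n)^-1 @[n --> \oo] --> (Num.sqrt (2 * pi) : R).
Proof.
have H := integral_gamma_shape_cvg measurableT.
rewrite integral_expR_sqr// in H.
have E1 : (\int[mu]_r (std_density r)%:E = 1)%E.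
  by under eq_integral do rewrite std_densityE; exact: integral_normal_pdf.
rewrite E1 mule1 in H.
have /fine_cvgP[_ H'] := H.
apply: cvg_trans H'; apply: near_eq_cvg; near=> n.
have n0 : (0 < n)%N by near: n; exact: nbhs_infty_gt.
rewrite /= (_ : (\int[mu]_r _)%E = (\int[mu]_(r in `[(- Num.sqrt n%:R)%R,
  +oo[) (gamma_shape n r)%:E)%E).
  rewrite integral_gamma_shape// mulNr -expr2 sqr_sqrtr ?ler0n// subrr.
  rewrite /gamma_tail ltxx big_ord_recl big1 ?addr0 /=.
    by rewrite /poisson_weight oppr0 expR0 expr0 fact0 divr1 mulr1 mul1r.
  by move=> i _; rewrite /poisson_weight expr0n/= mulr0 mul0r.
by rewrite [RHS]integral_mkcond; apply: eq_integral => r _; rewrite restrict_EFin.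
Unshelve. all: by end_near. Qed.

Lemma stirling_cvg : stirling n @[n --> \oo] --> ((Num.sqrt (2 * pi))^-1 : R).
Proof.
rewrite (_ : stirling = (fun n => ((stirling n)^-1)^-1)).
  by apply: cvgV stirlingV_cvg; exact: lt0r_neq0 sqrt2pi_gt0.
by apply/funext => n; rewrite invrK.
Qed.

Lemma gamma_tail_cvg_fixed (z : R) :
  gamma_tail n.+1 (n%:R + z * Num.sqrt n%:R) @[n --> \oo] --> 1 - std_cdf z.
Proof.
have := integral_gamma_shape_cvg (measurable_itv `[z, +oo[).
rewrite integral_expR_sqr// integral_std_density_y -EFinM => /fine_cvgP[_ H].
have := cvgM stirling_cvg H.
rewrite mulKf ?gt_eqF ?sqrt2pi_gt0// => /(_ eventually_filter) {}H.
apply: cvg_trans H; apply: near_eq_cvg; near=> n.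
have n0 : (0 < n)%N by near: n; exact: nbhs_infty_gt.
have zn : - Num.sqrt n%:R <= z.
  rewrite lerNl; near: n.
  have SN : Num.sqrt n%:R @[n --> \oo] --> (+oo : set_system R).
    exact: (@cvg_sqrtn_y _ _ _ id cvg_id).
  by move/cvgryPge : SN; exact.
rewrite /= (_ : (\int[mu]_(r in _) _)%E = (\int[mu]_(r in `[z, +oo[) (gamma_shape n r)%:E)%E).
  by rewrite integral_gamma_shape//= mulrC divfK// gt_eqF// stirling_gt0.
apply: eq_integral => r; rewrite inE/= in_itv/= andbT => zr.
by rewrite patchE mem_set//= in_itv/= andbT (le_trans zn).
Unshelve. all: by end_near. Qed.

Lemma gamma_tail_nincr n (a b : R) : 0 < a -> a <= b -> gamma_tail n.+1 b <= gamma_tail n.+1 a.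
Proof.
move=> a0 ab; rewrite /gamma_tail !ltNge (ltW a0) (ltW (lt_le_trans a0 ab))/=.
rewrite -lerN2.
apply: (@is_derive_ge0_le _ (fun b => - \sum_(i < n.+1) poisson_weight i b) (poisson_weight n) 0) => //.
- move=> x _; have H := is_deriveN (is_derive_poisson_sum n x).
  by apply: (is_derive_eq H); rewrite opprK.
- by move=> x x0; exact/poisson_weight_ge0/ltW.
Qed.

(** Limits at fixed arguments and monotonicity in the mean suffice for a moving z: it is caught
    between z0 - d / 2 and z0 + d / 2, where the continuous limit differs from its value at z0 by
    less than e / 2. *)
Lemma gamma_tail_cvg (T : Type) (F : set_system T) {FF : ProperFilter F}
    (N : T -> nat) (z : T -> R) (z0 : R) :
  N t @[t --> F] --> \oo -> z t @[t --> F] --> z0 ->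
  gamma_tail (N t).+1 ((N t)%:R + z t * Num.sqrt (N t)%:R) @[t --> F] --> 1 - std_cdf z0.
Proof.
move=> NF zF.
pose L (z : R) : R := 1 - std_cdf z.
have cL : {for z0, continuous L}.
  by apply: cvgB; [exact: cvg_cst|exact: is_derive_continuous (is_derive_std_cdf z0)].
apply/cvgrPdist_le => e e0; rewrite -/(L z0).
have alg (l lm lp X Y Z : R) : `|l - lm| < e / 2 -> `|l - lp| < e / 2 ->
    `|lm - X| < e / 2 -> `|lp - Y| < e / 2 -> Z <= X -> Y <= Z -> `|l - Z| <= e.
  clear; rewrite !ltr_distl ler_distl => /andP[? _] /andP[_ ?] /andP[? _] /andP[_ ?] ? ?.
  by apply/andP; split; lra.
have e2 : 0 < e / 2 by rewrite divr_gt0.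
have /cvgrPdist_lt/(_ _ e2) := cL.
move=> /nbhs_ballP[d /= d0 Hd].
have d2 : 0 < d / 2 by rewrite divr_gt0.
have NL (w : R) : gamma_tail (N t).+1 ((N t)%:R + w * Num.sqrt (N t)%:R) @[t --> F] --> L w.
  by move=> A HA; exact: (NF _ (@gamma_tail_cvg_fixed w A HA)).
have Lm : `|L z0 - L (z0 - d / 2)| < e / 2.
  by apply: Hd; rewrite /ball/= opprB addrC subrK gtr0_norm// ltr_pdivrMr// ltr_pMr// ltr1n.
have Lp : `|L z0 - L (z0 + d / 2)| < e / 2.
  by apply: Hd; rewrite /ball/= opprD addrA subrr sub0r normrN gtr0_norm// ltr_pdivrMr// ltr_pMr// ltr1n.
have SN : Num.sqrt (N t)%:R @[t --> F] --> (+oo : set_system R) by exact: cvg_sqrtn_y.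
near=> t.
have Nt : (0 < N t)%N by near: t; exact: (NF _ (nbhs_infty_gt 0)).
have s0 : 0 < Num.sqrt (N t)%:R :> R by rewrite sqrtr_gt0 ltr0n.
have zt : `|z0 - z t| <= d / 2 by near: t; move/cvgrPdist_le : zF; exact.
have Tm : `|L (z0 - d / 2) - gamma_tail (N t).+1 ((N t)%:R + (z0 - d / 2) * Num.sqrt (N t)%:R)| < e / 2.
  by near: t; move/cvgrPdist_lt : (NL (z0 - d / 2)); exact.
have Tp : `|L (z0 + d / 2) - gamma_tail (N t).+1 ((N t)%:R + (z0 + d / 2) * Num.sqrt (N t)%:R)| < e / 2.
  by near: t; move/cvgrPdist_lt : (NL (z0 + d / 2)); exact.
have s2 : Num.sqrt (N t)%:R ^+ 2 = (N t)%:R :> R by rewrite sqr_sqrtr.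
(* Keeps the lower of the two means positive, where the tail is known to decrease. *)
have sl : `|z0 - d / 2| < Num.sqrt (N t)%:R.
  by near: t; move/cvgryPgt : SN; exact.
have pos : 0 < (N t)%:R + (z0 - d / 2) * Num.sqrt (N t)%:R.
  move: s2 sl s0; move: (Num.sqrt (N t)%:R) => s <- sl s0.
  by move: sl; rewrite ltr_norml => /andP[sl _]; rewrite expr2 -mulrDl mulr_gt0//; lra.
move: zt; rewrite ler_distl => /andP[z1 z2].
have A : gamma_tail (N t).+1 ((N t)%:R + z t * Num.sqrt (N t)%:R) <=
    gamma_tail (N t).+1 ((N t)%:R + (z0 - d / 2) * Num.sqrt (N t)%:R).
  by apply: gamma_tail_nincr => //; rewrite lerD2l ler_wpM2r ?(ltW s0)//; lra.
have B : gamma_tail (N t).+1 ((N t)%:R + (z0 + d / 2) * Num.sqrt (N t)%:R) <=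
    gamma_tail (N t).+1 ((N t)%:R + z t * Num.sqrt (N t)%:R).
  apply: gamma_tail_nincr; last by rewrite lerD2l ler_wpM2r ?(ltW s0)//; lra.
  by apply: (lt_le_trans pos); rewrite lerD2l ler_wpM2r ?(ltW s0)//; lra.
exact: alg Lm Lp Tm Tp A B.
Unshelve. all: by end_near. Qed.

(** * Central and local limit theorems along an index t + y sqrt t + O(1) *)

Section index_asymptotics.
Variables (N : R -> nat) (y K : R).
Hypothesis NE : \forall t \near +oo, `|(N t)%:R - (t + y * Num.sqrt t)| <= K.

Let sqrtV_cvg0 : (Num.sqrt t)^-1 @[t --> +oo] --> (0 : R).
Proof.
apply/gtr0_cvgV0.
  by near=> t; rewrite sqrtr_gt0; near: t; exact: nbhs_pinfty_gt.
apply/cvgryPge => A; near=> t.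
apply: (le_trans (ler_norm A)); rewrite -sqrtr_sqr; apply: ler_wsqrtr.
by near: t; apply: nbhs_pinfty_ge; exact: num_real.
Unshelve. all: by end_near. Qed.

Let dev_cvg : ((N t)%:R - t) / Num.sqrt t @[t --> +oo] --> y.
Proof.
apply/subr_cvg0; apply: norm_cvg0.
apply: (@squeeze_cvgr _ _ _ _ (fun=> 0) (fun t => K * (Num.sqrt t)^-1)).
- near=> t; rewrite normr_ge0/=.
  have s0 : 0 < Num.sqrt t :> R.
    by rewrite sqrtr_gt0; near: t; exact: nbhs_pinfty_gt.
  have -> : ((N t)%:R - t) / Num.sqrt t - y =
      ((N t)%:R - (t + y * Num.sqrt t)) / Num.sqrt t.
    by field; rewrite gt_eqF.
  rewrite normrM normfV (gtr0_norm s0) ler_pM2r ?invr_gt0//.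
  by near: t.
- exact: cvg_cst.
- by rewrite -[X in _ --> X](mulr0 K); apply: cvgMr.
Unshelve. all: by end_near. Qed.

Let ratio_cvg : (N t)%:R / t @[t --> +oo] --> (1 : R).
Proof.
have H : 1 + ((N t)%:R - t) / Num.sqrt t * (Num.sqrt t)^-1 @[t --> +oo] --> (1 + y * 0 : R).
  by apply: cvgD; [exact: cvg_cst|exact: cvgM].
rewrite mulr0 addr0 in H.
apply: cvg_trans H; apply: near_eq_cvg; near=> t.
have t0 : 0 < t by near: t; exact: nbhs_pinfty_gt.
have s2 : Num.sqrt t ^+ 2 = t by rewrite sqr_sqrtr// ltW.
have s0 : 0 < Num.sqrt t by rewrite sqrtr_gt0.
rewrite /= -mulrA -invfM -expr2 s2; field; by rewrite gt_eqF.
Unshelve. all: by end_near. Qed.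

Lemma index_cvgy : N t @[t --> +oo] --> \oo.
Proof.
apply/cvgrnyP/cvgryPge => A; near=> t.
have t0 : 0 < t by near: t; exact: nbhs_pinfty_gt.
have : 2^-1 < (N t)%:R / t.
  by near: t; apply: (cvgr_gt _ ratio_cvg); rewrite invf_lt1// ltr1n.
rewrite ltr_pdivlMr// => H; apply: le_trans (ltW H).
rewrite mulrC ler_pdivlMr//; near: t; apply: nbhs_pinfty_ge; exact: num_real.
Unshelve. all: by end_near. Qed.

Lemma sqrt_index_cvg : Num.sqrt t / Num.sqrt (N t)%:R @[t --> +oo] --> (1 : R).
Proof.
have H1 : Num.sqrt ((N t)%:R / t) @[t --> +oo] --> (1 : R).
  rewrite -[X in _ --> X]sqrtr1.
  apply: (cvg_comp _ Num.sqrt ratio_cvg); exact: sqrt_continuous.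
have H : (Num.sqrt ((N t)%:R / t))^-1 @[t --> +oo] --> (1^-1 : R).
  by apply: cvgV => //; exact: oner_neq0.
rewrite invr1 in H; apply: cvg_trans H; apply: near_eq_cvg; near=> t.
have t0 : 0 < t by near: t; exact: nbhs_pinfty_gt.
by rewrite /= sqrtrM ?ler0n// sqrtrV ?ltW// invfM invrK mulrC.
Unshelve. all: by end_near. Qed.

(** The roles change here: the index is given relative to the mean t, but the shape is centred at
    the index. Hence the sign of y flips, and it flips back through the symmetry of the normal
    law. *)
Lemma index_dev_cvg : (t - (N t)%:R) / Num.sqrt (N t)%:R @[t --> +oo] --> - y.
Proof.
have H : - (((N t)%:R - t) / Num.sqrt t) * (Num.sqrt t / Num.sqrt (N t)%:R)
    @[t --> +oo] --> (- y * 1 : R).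
  by apply: cvgM; [exact: cvgN|exact: sqrt_index_cvg].
rewrite mulr1 in H; apply: cvg_trans H; apply: near_eq_cvg; near=> t.
have t0 : 0 < t by near: t; exact: nbhs_pinfty_gt.
have s0 : 0 < Num.sqrt t by rewrite sqrtr_gt0.
by rewrite /= -mulNr opprB mulrA divfK// gt_eqF.
Unshelve. all: by end_near. Qed.

Let indexK : \forall t \near +oo,
  (N t)%:R + (t - (N t)%:R) / Num.sqrt (N t)%:R * Num.sqrt (N t)%:R = t.
Proof.
near=> t; have Nt : (0 < N t)%N by near: t; exact: (index_cvgy (nbhs_infty_gt 0)).
by rewrite divfK ?gt_eqF ?sqrtr_gt0 ?ltr0n// addrC subrK.
Unshelve. all: by end_near. Qed.

Lemma gamma_tailS_index_cvg : gamma_tail (N t).+1 t @[t --> +oo] --> std_cdf y.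
Proof.
have H : gamma_tail (N t).+1 ((N t)%:R + (t - (N t)%:R) / Num.sqrt (N t)%:R * Num.sqrt (N t)%:R)
    @[t --> +oo] --> 1 - std_cdf (- y).
  exact: (gamma_tail_cvg index_cvgy index_dev_cvg).
rewrite std_cdfN opprB addrCA subrr addr0 in H.
apply: cvg_trans H; apply: near_eq_cvg; near=> t.
by congr gamma_tail; near: t.
Unshelve. all: by end_near. Qed.

Lemma poisson_weight_index_cvg :
  Num.sqrt t * poisson_weight (N t) t @[t --> +oo] --> std_density y.
Proof.
have Sc : stirling (N t) @[t --> +oo] --> ((Num.sqrt (2 * pi))^-1 : R).
  by move=> A HA; exact: (index_cvgy (stirling_cvg HA)).
have H : Num.sqrt t / Num.sqrt (N t)%:R * (gamma_shape (N t) ((t - (N t)%:R) / Num.sqrt (N t)%:R)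
    * stirling (N t)) @[t --> +oo] --> 1 * (expR (- ((- y) ^+ 2 / 2)) / Num.sqrt (2 * pi)).
  apply: cvgM; first exact: sqrt_index_cvg.
  by apply: cvgM => //; exact: (gamma_shape_cvg index_cvgy index_dev_cvg).
rewrite mul1r sqrrN -/(std_density y) in H.
apply: cvg_trans H; apply: near_eq_cvg; near=> t.
have Nt : (0 < N t)%N by near: t; exact: (index_cvgy (nbhs_infty_gt 0)).
have s0 : 0 < Num.sqrt (N t)%:R :> R by rewrite sqrtr_gt0 ltr0n.
rewrite /= [_ * stirling _]mulrC -poisson_weight_shape// mulrA divfK ?gt_eqF//.
by congr (_ * poisson_weight _ _); near: t.
Unshelve. all: by end_near. Qed.

End index_asymptotics.

(** Lowering the index by one only enlarges the constant K. *)
Lemma gamma_tail_index_cvg (N : R -> nat) (y K : R) :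
  (\forall t \near +oo, `|(N t)%:R - (t + y * Num.sqrt t)| <= K) ->
  gamma_tail (N t) t @[t --> +oo] --> std_cdf y.
Proof.
move=> NE; have H : gamma_tail (N t).-1.+1 t @[t --> +oo] --> std_cdf y.
  apply: (@gamma_tailS_index_cvg (fun t => (N t).-1) y (K + 1)).
  near=> t; have Nt : (0 < N t)%N.
    by near: t; exact: (index_cvgy NE (nbhs_infty_gt 0)).
  rewrite -subn1 natrB// addrAC (le_trans (ler_normB _ _))// normr1 lerD2r.
  by near: t.
apply: cvg_trans H; apply: near_eq_cvg; near=> t.
by rewrite prednK//; near: t; exact: (index_cvgy NE (nbhs_infty_gt 0)).
Unshelve. all: by end_near. Qed.
End gamma_shape.

(** * The limit law *)

Section limit_law.
Context {R : realType}.
Local Notation mu := (@lebesgue_measure R).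
Implicit Types x a z : R.

Lemma std_density_gt0 x : 0 < std_density x.
Proof. by rewrite divr_gt0 ?expR_gt0 ?sqrt2pi_gt0. Qed.

Lemma is_derive_std_density x : is_derive x 1 std_density (- (x * std_density x)).
Proof.
have dl : is_derive x 1 (fun x : R => - (x ^+ 2 / 2)) (- x).
  have dX : is_derive x 1 (fun x : R => x ^+ 2) (2 * x).
    by apply: DeriveDef; [exact: exprn_derivable|rewrite exp_derive [LHS]mulr1].
  have H := is_deriveZ (- 2^-1) dX.
  rewrite (_ : (fun x : R => - (x ^+ 2 / 2)) = (- 2^-1 \*: (fun x : R => x ^+ 2))).
    by apply: (is_derive_eq H); rewrite /GRing.scale/=; field.
  by apply/funext => y; rewrite [RHS]mulNr [in RHS]mulrC.
have := @is_derive1_comp _ _ (fun x : R => - (x ^+ 2 / 2)) _ _ _ (is_derive_expR _) dl.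
move=> /(is_deriveZ (Num.sqrt (2 * pi))^-1) H.
have E : ((Num.sqrt (2 * pi))^-1 \*: (expR \o (fun x : R => - (x ^+ 2 / 2)))) = std_density.
  by apply/funext => y; rewrite /std_density [RHS]mulrC.
rewrite E in H; apply: (is_derive_eq H).
by rewrite /GRing.scale/= /std_density; ring.
Qed.

Lemma std_density_cvgy : std_density x @[x --> +oo] --> (0 : R).
Proof.
apply: (@squeeze_cvgr _ _ _ _ (fun=> 0) (fun x => expR (- x) * (expR 1 / Num.sqrt (2 * pi)))).
- near=> x; rewrite ltW ?std_density_gt0//= /std_density mulrA ler_pM2r ?invr_gt0 ?sqrt2pi_gt0//.
  rewrite -expRD ler_expR; have := sqr_ge0 (x - 1); rewrite sqrrB; nra.
- exact: cvg_cst.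
- rewrite -[X in _ --> X](mul0r (expR 1 / Num.sqrt (2 * pi))); apply: cvgMl; exact: cvgr_expR.
Unshelve. all: by end_near. Qed.

(** The function Phi(y) + phi(y) / y has derivative - phi(y) / y^2, so it decreases to its limit 1.
    The bound decides the sign of the limit density for negative x. *)
Lemma mills_ratio z : 0 < z -> z * (1 - std_cdf z) <= std_density z.
Proof.
move=> z0.
pose f (y : R) : R := std_cdf y + std_density y / y.
have fnincr y : z <= y -> f y <= f z.
  move=> zy; rewrite -lerN2.
  apply: (@is_derive_ge0_le _ (fun y => - f y) (fun y => std_density y / y ^+ 2) 0);
    [| |exact: z0|exact: zy] => w w0.
    have H1 := is_derive_std_cdf w; have H2 := is_derive_std_density w.
    have H3 := is_deriveV (lt0r_neq0 w0) (is_derive_id w 1).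
    have H := is_deriveN (is_deriveD H1 (is_deriveM H2 H3)).
    apply: (is_derive_eq H); rewrite /GRing.scale/=; field; exact: lt0r_neq0.
  by rewrite divr_ge0 ?sqr_ge0// ltW ?std_density_gt0.
have fy : f y @[y --> +oo] --> (1 : R).
  rewrite -[X in _ --> X]addr0 -[X in _ --> _ + X](mulr0 0).
  apply: cvgD; first exact: std_cdf_cvgy.
  apply: cvgM; first exact: std_density_cvgy.
  by apply/gtr0_cvgV0; [exact: nbhs_pinfty_gt|exact: cvg_id].
have f1 : 1 <= f z.
  rewrite -(cvg_lim _ fy)//; apply: limr_le; first by apply/cvg_ex; eexists; exact: fy.
  near=> y; apply: fnincr; near: y; apply: nbhs_pinfty_ge; exact: num_real.
rewrite -ler_pdivlMl// mulrC; move: f1; rewrite /f; lra.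
Unshelve. all: by end_near. Qed.

(** The limit density without its cutoff at 0. It is continuous on the whole line, so that the
    fundamental theorem of calculus applies up to the end point 0. *)
Definition limit_core x a : R :=
  std_density (x + a) + std_cdf x / std_density x * ((x + a) * std_density (x + a)).

Definition limit_cdf x a : R :=
  std_cdf (x + a) - std_cdf x / std_density x * std_density (x + a).

Lemma limit_densityE x a :
  limit_density x a = (limit_core x \_ `[0, +oo[) a.
Proof.
rewrite patch_indic /limit_density /limit_core; congr (_ * _).
have -> : 1 + Num.sqrt (2 * pi) / 2 * (1 + erf (x / Num.sqrt 2)) * expR (x ^+ 2 / 2) * (a + x) =
    1 + std_cdf x / std_density x * (x + a).
  by rewrite /std_density invfM expRN !invrK /std_cdf; field.
have -> : 1 / Num.sqrt (2 * pi) * expR (- ((x + a) ^+ 2 / 2)) = std_density (x + a).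
  by rewrite /std_density mul1r mulrC.
by ring.
Qed.

Lemma std_cdf_ge0 x : 0 <= std_cdf x.
Proof.
have std_cdf_ndecr y z : y <= z -> std_cdf y <= std_cdf z.
  apply: (@is_derive_ge0_le _ std_cdf std_density (y - 1)); last by rewrite ltrBlDr ltrDl.
    by move=> w _; exact: is_derive_std_cdf.
  by move=> w _; exact/ltW/std_density_gt0.
rewrite -(cvg_lim _ std_cdf_cvgNy)//; apply: limr_le; first by apply/cvg_ex; eexists;
  exact: std_cdf_cvgNy.
near=> y; apply: std_cdf_ndecr; near: y; apply: nbhs_ninfty_le; exact: num_real.
Unshelve. all: by end_near. Qed.

(** The sign is that of 1 + (x + a) Phi(x) / phi(x), which is smallest at a = 0. For x < 0 its
    non-negativity there is exactly [mills_ratio] at - x. *)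
Lemma limit_core_ge0 x a : 0 <= a -> 0 <= limit_core x a.
Proof.
move=> a0; have d0 := std_density_gt0 x.
rewrite /limit_core mulrA -[X in X + _]mul1r -mulrDl mulr_ge0 ?(ltW (std_density_gt0 _))//.
have c0 := std_cdf_ge0 x.
have [x0|x0] := leP 0 x.
  by rewrite addr_ge0// mulr_ge0 ?addr_ge0// divr_ge0// ltW.
have := @mills_ratio (- x); rewrite oppr_gt0 std_cdfN subKr => /(_ x0).
have -> : std_density (- x) = std_density x by rewrite /std_density sqrrN.
move=> H; rewrite mulrDr addrA addr_ge0//; last by rewrite mulr_ge0// divr_ge0// ltW.
rewrite mulrAC -lerBlDl sub0r ler_pdivlMr// mulN1r; lra.
Qed.

Lemma is_derive_limit_cdf x a : is_derive a 1 (limit_cdf x) (limit_core x a).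
Proof.
have dl : is_derive a 1 (fun a : R => x + a) 1.
  rewrite (_ : (fun a : R => x + a) = (fun a => x + 1 * a)); first exact: is_derive_affine.
  by apply/funext => y; rewrite mul1r.
have H1 := @is_derive1_comp _ _ (fun a : R => x + a) _ _ _ (is_derive_std_cdf (x + a)) dl.
have H2 := @is_derive1_comp _ _ (fun a : R => x + a) _ _ _ (is_derive_std_density (x + a)) dl.
have H := is_deriveB H1 (is_deriveZ (std_cdf x / std_density x) H2).
by apply: (is_derive_eq H); rewrite /GRing.scale/= /limit_core; ring.
Qed.

Lemma limit_cdf0 x : limit_cdf x 0 = 0.
Proof. by rewrite /limit_cdf addr0 divfK ?subrr// gt_eqF// std_density_gt0. Qed.

Lemma continuous_std_density : continuous (@std_density R).
Proof. by move=> x; exact: is_derive_continuous (is_derive_std_density x). Qed.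

Lemma continuous_limit_core x : continuous (limit_core x).
Proof.
have cD a : {for a, continuous (fun a : R => std_density (x + a))}.
  apply: (@continuous_comp _ _ _ (fun a : R => x + a) std_density).
    by apply: cvgD; [exact: cvg_cst|exact: cvg_id].
  exact: continuous_std_density.
move=> a; apply: cvgD; first exact: cD.
by apply: cvgMr; apply: cvgM; [apply: cvgD; [exact: cvg_cst|exact: cvg_id]|exact: cD].
Qed.

Lemma law_limit_densityE x (A : set R) : measurable A ->
  law_with_density (limit_density x) A =
  (\int[mu]_(a in A `&` `[0%R, +oo[) (limit_core x a)%:E)%E.
Proof.
move=> mA; rewrite integral_mkcondr; apply: eq_integral => a _.
by rewrite limit_densityE !patchE; case: ifP.
Qed.

Lemma law_limit_density_itv x a :
  law_with_density (limit_density x) `]-oo, a]%classic =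
  (if 0 <= a then limit_cdf x a else 0)%:E.
Proof.
rewrite law_limit_densityE//; case: ifPn => [|/negP]; last first.
  move=> /negP; rewrite -ltNge => a0; rewrite (_ : _ `&` _ = set0) ?integral_set0//.
  by apply/seteqP; split => // y /=; rewrite !in_itv/= andbT => -[ya y0]; lra.
move=> a0; rewrite (_ : _ `&` _ = `[0, a]%classic); last first.
  apply/seteqP; split => y /=; rewrite !in_itv/= andbT; first by move=> [-> ->].
  by move=> /andP[-> ->].
move: a0; rewrite le_eqVlt => /predU1P[<-|a0].
  by rewrite set_itv1 integral_set1 limit_cdf0.
rewrite (@continuous_FTC2 _ _ (limit_cdf x))//.
- by rewrite limit_cdf0 sube0.
- exact/continuous_subspaceT/continuous_limit_core.
- split.
  + by move=> y _; have [] := is_derive_limit_cdf x y.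
  + by apply: cvg_at_right_filter; apply: is_derive_continuous (is_derive_limit_cdf x 0).
  + by apply: cvg_at_left_filter; apply: is_derive_continuous (is_derive_limit_cdf x a).
- by move=> y _; rewrite derive1E (@derive_val _ _ _ _ _ _ _ (is_derive_limit_cdf x y)).
Qed.

Lemma limit_density_probability x : probability_density (limit_density x).
Proof.
split.
- rewrite (funext (limit_densityE x)); apply/(measurable_restrictT _ _).1 => //.
  by apply: measurable_funTS; apply: continuous_measurable_fun; exact: continuous_limit_core.
- move=> a; rewrite limit_densityE patchE; case: ifPn => //.
  by rewrite inE/= in_itv/= andbT; exact: limit_core_ge0.
- rewrite law_limit_densityE// setTI.
  rewrite (@ge0_continuous_FTC2y _ _ (limit_cdf x) _ 1).
  + by rewrite limit_cdf0 sube0.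
  + by move=> a; exact: limit_core_ge0.
  + exact/continuous_subspaceT/continuous_limit_core.
  + rewrite -[X in _ --> X]subr0 -[X in _ --> _ - X](mulr0 (std_cdf x / std_density x)).
    apply: cvgB; last apply: cvgMr.
      apply: (@cvg_comp _ _ _ (fun a => x + a) std_cdf _ (pinfty_nbhs R)); last exact: std_cdf_cvgy.
      exact: cvg_addrl.
    apply: (@cvg_comp _ _ _ (fun a => x + a) std_density _ (pinfty_nbhs R));
      last exact: std_density_cvgy.
    exact: cvg_addrl.
  + by move=> y _; have [] := is_derive_limit_cdf x y.
  + by apply: cvg_at_right_filter; apply: is_derive_continuous (is_derive_limit_cdf x 0).
  + by move=> y _; rewrite derive1E (@derive_val _ _ _ _ _ _ _ (is_derive_limit_cdf x y)).
Qed.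

(** A factor sqrt t on both weights lets the local limit theorem apply to each of them, and cancels
    in the ratio. *)
Lemma limit_cdf_cvg (j M : R -> nat) x a (K : R) :
  (\forall t \near +oo, `|(j t)%:R - (t + x * Num.sqrt t)| <= K) ->
  (\forall t \near +oo, `|(M t)%:R - (t + (x + a) * Num.sqrt t)| <= K) ->
  gamma_tail (M t) t - gamma_tail (j t) t * (poisson_weight (M t) t / poisson_weight (j t) t)
    @[t --> +oo] --> limit_cdf x a.
Proof.
move=> jE ME.
have Hw : Num.sqrt t * poisson_weight (M t) t / (Num.sqrt t * poisson_weight (j t) t)
    @[t --> +oo] --> std_density (x + a) / std_density x.
  apply: cvgM; first exact: poisson_weight_index_cvg ME.
  apply: cvgV; last exact: poisson_weight_index_cvg jE.
  by rewrite gt_eqF// std_density_gt0.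
have Hw' : poisson_weight (M t) t / poisson_weight (j t) t
    @[t --> +oo] --> std_density (x + a) / std_density x.
  apply: cvg_trans Hw; apply: near_eq_cvg; near=> t.
  by rewrite -mulf_div divff ?mul1r// gt_eqF// sqrtr_gt0; near: t; exact: nbhs_pinfty_gt.
rewrite /limit_cdf -[X in _ --> _ - X]mulrA [_^-1 * _]mulrC.
apply: cvgB; first exact: gamma_tail_index_cvg ME.
by apply: cvgM => //; exact: gamma_tail_index_cvg jE.
Unshelve. all: by end_near. Qed.
End limit_law.

(** * Independence *)

Section independence.
Context {d : measure_display} {Omega : measurableType d} {R : realType}.
Variable P : probability Omega R.

Definition indep_events (G1 G2 : set (set Omega)) : Prop :=
  forall A B, G1 A -> G2 B -> P (A `&` B) = (P A * P B)%E.

Lemma indep_events_sym G1 G2 : indep_events G1 G2 -> indep_events G2 G1.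
Proof. by move=> H A B GA GB; rewrite setIC H// muleC. Qed.

(** For fixed B the events A satisfying the product rule form a Dynkin system, which contains the
    pi-system G1. *)
Lemma indep_events_sigma (G1 G2 : set (set Omega)) :
  setI_closed G1 -> G1 `<=` measurable -> G2 `<=` measurable ->
  indep_events G1 G2 -> indep_events <<s G1 >> G2.
Proof.
move=> I1 M1 M2 H A B sA GB.
suff : <<s G1 >> `<=` [set A | measurable A /\ P (A `&` B) = (P A * P B)%E].
  by move=> /(_ _ sA)[].
have mB := M2 _ GB.
apply: lambda_system_subset => //; last first.
  by move=> C GC; split; [exact: M1|exact: H].
apply/dynkin_lambda_system; split => /=.
- by rewrite setTI probability_setT mul1e.
- move=> C [mC HC]; split; first exact: measurableC.
  rewrite probability_setC// setIC -setDE measureD ?ltey_eq ?fin_num_measure//.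
  rewrite [X in (_ - X)%E](_ : _ = P C * P B)%E ?muleBl ?mul1e//; last by rewrite setIC.
  by rewrite fin_num_measure.
- move=> F tF HF; split; first by apply: bigcup_measurable => k _; exact: (HF k).1.
  rewrite setI_bigcupl measure_bigcup//; last 2 first.
  + by move=> k _; apply: measurableI => //; exact: (HF k).1.
  + exact: trivIset_setIr.
  rewrite measure_bigcup//; last by move=> k _; exact: (HF k).1.
  have PB : P B = (fine (P B))%:E by rewrite fineK// fin_num_measure.
  rewrite muleC PB -nneseriesZl//.
  by apply: eq_eseriesr => k _; rewrite [LHS](HF k).2 -PB muleC.
Qed.

Section cylinders.
Context {I : eqType}.
Variable X : I -> {RV P >-> R}.

(** A pi-system generating the sigma-algebra of the variables X i with i in J. Blocks of clocks
    enter the proof as such sigma-algebras on Omega itself. *)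
Definition cylinders (J : set I) : set (set Omega) :=
  [set B | exists (s : seq I) (A : I -> set R),
    [/\ uniq s, [set` s] `<=` J, forall i, measurable (A i)
      & B = \bigcap_(i in [set` s]) (X i @^-1` A i)]].

Lemma cylinders_measurable J : cylinders J `<=` measurable.
Proof.
move=> _ [s [A [us sJ mA ->]]]; apply: fin_bigcap_measurable => // i _.
by rewrite -[X in measurable X]setTI; exact: measurable_funP.
Qed.

Lemma cylinders_setI J : setI_closed (cylinders J).
Proof.
move=> _ _ [s1 [A1 [u1 J1 m1 ->]]] [s2 [A2 [u2 J2 m2 ->]]].
exists (undup (s1 ++ s2)), (fun i => (if i \in s1 then A1 i else setT) `&`
  (if i \in s2 then A2 i else setT)); split.
- exact: undup_uniq.
- by move=> i /=; rewrite mem_undup mem_cat => /orP[/J1|/J2].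
- by move=> i; apply: measurableI; case: ifP.
- apply/seteqP; split => w /=.
    by move=> [H1 H2] i _; split; case: ifP => // i12; [exact: H1|exact: H2].
  move=> H; split => i /= i12.
    by have := H i; rewrite /= mem_undup mem_cat i12 => /(_ isT)[].
  by have := H i; rewrite /= mem_undup mem_cat i12 orbT => /(_ isT)[].
Qed.

Lemma indep_cylinders J1 J2 : mutually_independent X -> J1 `&` J2 = set0 ->
  indep_events (cylinders J1) (cylinders J2).
Proof.
move=> mi J12 _ _ [s1 [A1 [u1 J1' m1 ->]]] [s2 [A2 [u2 J2' m2 ->]]].
have disj i : i \in s1 -> i \in s2 -> False.
  by move=> /J1' i1 /J2' i2; have : (J1 `&` J2) i by []; rewrite J12.
pose A i := if i \in s1 then A1 i else A2 i.
have E1 : \bigcap_(i in [set` s1]) (X i @^-1` A1 i) = \bigcap_(i in [set` s1]) (X i @^-1` A i).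
  by apply: eq_bigcapr => i /= i1; rewrite /A i1.
have E2 : \bigcap_(i in [set` s2]) (X i @^-1` A2 i) = \bigcap_(i in [set` s2]) (X i @^-1` A i).
  apply: eq_bigcapr => i /= i2; rewrite /A ifF//; apply/negP => i1; exact: disj i1 i2.
have mA i : measurable (A i) by rewrite /A; case: ifP.
rewrite E1 E2 -bigcap_setU (_ : _ `|` _ = [set` s1 ++ s2]); last first.
  apply/seteqP; split => i /=; rewrite mem_cat; first by move=> [->|->] //; rewrite orbT.
  by move=> /orP.
rewrite (mi (s1 ++ s2))// ?big_cat ?mi//=.
rewrite cat_uniq u1 u2 andbT/=; apply/hasPn => i i2; apply/negP => i1; exact: disj i1 i2.
Qed.

Lemma indep_blocks J1 J2 : mutually_independent X -> J1 `&` J2 = set0 ->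
  indep_events <<s cylinders J1 >> <<s cylinders J2 >>.
Proof.
move=> mi J12; apply: indep_events_sigma.
- exact: cylinders_setI.
- exact: cylinders_measurable.
- apply: smallest_sub; last exact: cylinders_measurable.
  exact: sigma_algebra_measurable.
- apply: indep_events_sym; apply: indep_events_sigma.
  + exact: cylinders_setI.
  + exact: cylinders_measurable.
  + exact: cylinders_measurable.
  + by apply: indep_cylinders => //; rewrite setIC.
Qed.

Lemma cylinders_measurable_fun J i : J i ->
  measurable_fun (T := g_sigma_algebraType (cylinders J)) setT (X i).
Proof.
move=> Ji _ A mA; rewrite setTI; apply: sub_sigma_algebra.
exists [:: i], (fun=> A); split => //.
  by move=> j /=; rewrite inE => /eqP ->.
by apply/seteqP; split => w /=; [move=> H j /=; rewrite inE => /eqP ->|apply; rewrite /= inE].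
Qed.

End cylinders.
End independence.

(** * Tonelli's theorem for independent random elements *)

Section indep_fubini.
Context {d d1 d2 : measure_display} {Omega : measurableType d}
  {T1 : measurableType d1} {T2 : measurableType d2} {R : realType}.
Variable P : probability Omega R.
Local Open Scope ereal_scope.

(** The law of the pair is the product law. The maps may be the identity of Omega into the
    sigma-algebra of a block of clocks; the statement then says that one block can be frozen while
    the other is resampled. *)
Lemma indep_integral (X1 : Omega -> T1) (X2 : Omega -> T2)
    (f : T1 * T2 -> \bar R) :
  measurable_fun setT X1 -> measurable_fun setT X2 ->
  (forall A B, measurable A -> measurable B ->
    P (X1 @^-1` A `&` X2 @^-1` B) = P (X1 @^-1` A) * P (X2 @^-1` B)) ->
  measurable_fun setT f -> (forall z, 0 <= f z) ->
  \int[P]_w f (X1 w, X2 w) = \int[P]_w \int[P]_v f (X1 w, X2 v).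
Proof.
move=> mX1 mX2 indep mf f0.
pose Y1 : {mfun Omega >-> T1} := HB.pack X1 (isMeasurableFun.Build _ _ _ _ _ mX1).
pose Y2 : {mfun Omega >-> T2} := HB.pack X2 (isMeasurableFun.Build _ _ _ _ _ mX2).
have mX : measurable_fun setT (fun w => (X1 w, X2 w)) by exact/measurable_fun_pair.
pose Y : {mfun Omega >-> (T1 * T2)%type} := HB.pack (fun w => (X1 w,
  X2 w)) (isMeasurableFun.Build _ _ _ _ _ mX).
pose m1 : probability T1 R := distribution P Y1.
pose m2 : probability T2 R := distribution P Y2.
have mu12 (A : set (T1 * T2)) : measurable A -> (m1 \x m2) A = distribution P Y A.
  move=> mA; apply: (@product_measure_unique _ _ _ _ _ m1 m2 (distribution P Y)) => // B C mB mC; exact: indep.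
transitivity (\int[distribution P Y]_z f z).
  by rewrite ge0_integral_pushforward//.
transitivity (\int[m1 \x m2]_z f z).
  apply: eq_measure_integral => //= A mA _. exact/esym/mu12.
rewrite fubini_tonelli1// /fubini_F.
rewrite ge0_integral_pushforward//; last 2 first.
- exact: measurable_fun_fubini_tonelli_F.
- by move=> x _; exact: integral_ge0.
apply: eq_integral => w _ /=.
rewrite ge0_integral_pushforward//.
exact: measurableT_comp.
Qed.
End indep_fubini.

(** * Exponential clocks *)

Section exponential_integral.
Context {R : realType}.
Local Notation mu := (@lebesgue_measure R).
Local Notation nu := (@exponential_prob R 1).

Lemma exponential_pdf1E (r : R) : exponential_pdf 1 r = if 0 <= r then expR (- r) else 0.
Proof. by rewrite /exponential_pdf patchE mem_setE in_itv/= andbT mul1r mulN1r. Qed.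

Lemma exponential_prob_dominates : exponential_prob 1 `<< mu.
Proof.
apply/null_content_dominatesP => A mA A0; rewrite /exponential_prob.
apply: null_set_integral => //; apply: measurable_funTS; apply/measurable_EFinP.
exact: measurable_exponential_pdf.
Qed.

(** The Radon-Nikodym derivative of [exponential_prob] agrees almost everywhere with the density
    that defines it. *)
Lemma integral_exponential_prob (f : R -> \bar R) :
  measurable_fun setT f -> (\int[nu]_x `|f x| < +oo)%E ->
  (\int[nu]_x f x = \int[mu]_x (f x * (exponential_pdf 1 x)%:E))%E.
Proof.
move=> mf finf.
rewrite -(Radon_Nikodym_change_of_variables exponential_prob_dominates)//=; last first.
  by apply/integrableP; split.
apply: ae_eq_integral => //.
- apply: emeasurable_funM => //; apply: (measurable_int mu).
  apply: (integrableS _ _ (@subsetT _ _)) => //=.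
  by apply: Radon_Nikodym_integrable; exact: exponential_prob_dominates.
- apply: emeasurable_funM => //=; apply/measurableT_comp => //=.
  exact: measurable_exponential_pdf.
- apply: ae_eqe_mul2l => /=.
  rewrite Radon_NikodymE//=; first exact: exponential_prob_dominates.
  move=> abmu; case: cid => /= h [h1 h2 h3].
  apply: integral_ae_eq => //=.
  + by apply/measurableT_comp => //; exact: measurable_exponential_pdf.
  + by move=> E _ mE; rewrite -h3.
Qed.
End exponential_integral.

Section exponential_tail.
Context {R : realType}.
Local Notation mu := (@lebesgue_measure R).
Local Notation nu := (@exponential_prob R 1).

Lemma is_derive_expRN (r : R) : is_derive r 1 (fun r : R => expR (- r)) (- expR (- r)).
Proof.
have := @is_derive1_comp _ _ (fun x : R => - x) _ _ _ (is_derive_expR (- r)) (is_deriveNid r 1).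
by rewrite mulrN1.
Qed.

Lemma continuous_expRN : continuous (fun r : R => expR (- r)).
Proof. by move=> r; exact: is_derive_continuous (is_derive_expRN r). Qed.

Lemma integral_expRN_y (c : R) :
  (\int[mu]_(r in `[c, +oo[) (expR (- r))%:E = (expR (- c))%:E)%E.
Proof.
rewrite (@ge0_continuous_FTC2y _ _ (fun r => - expR (- r)) _ 0).
- by rewrite -EFinB sub0r opprK.
- by move=> r _; exact: expR_ge0.
- exact/continuous_subspaceT/continuous_expRN.
- by rewrite -oppr0; apply: cvgN; exact: cvgr_expR.
- by move=> r _; have [] := is_deriveN (is_derive_expRN r).
- by apply: cvg_at_right_filter; apply: cvgN; exact: continuous_expRN.
- move=> r _; rewrite derive1E (@derive_val _ _ _ _ _ _ _ (is_deriveN (is_derive_expRN r))).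
  by rewrite opprK.
Qed.

Lemma integral_exponential_pdfE (f : R -> \bar R) (A : set R) :
  (\int[mu]_(x in A) (f x * (exponential_pdf 1 x)%:E) =
   \int[mu]_(x in A `&` `[0%R, +oo[) (f x * (expR (- x))%:E))%E.
Proof.
rewrite [RHS]integral_mkcondr; apply: eq_integral => r _.
rewrite exponential_pdf1E patchE mem_setE in_itv/= andbT.
by case: ifP; rewrite ?mule0.
Qed.

Lemma exponential_prob_oy (c : R) :
  nu `]c, +oo[ = (expR (- Num.max c 0))%:E.
Proof.
rewrite /exponential_prob; under eq_integral do rewrite -[_%:E]mul1e.
rewrite (integral_exponential_pdfE (fun=> 1%E)).
under eq_integral do rewrite mul1e.
have [c0|c0] := ltP c 0.
  rewrite (_ : _ `&` _ = `[0, +oo[%classic).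
    exact: integral_expRN_y.
  apply/seteqP; split => r /=; rewrite !in_itv/= !andbT; first by case.
  by move=> r0; split => //; exact: lt_le_trans c0 r0.
rewrite (_ : _ `&` _ = `]c, +oo[%classic).
  rewrite integral_itv_obnd_cbnd ?integral_expRN_y//.
  apply: measurable_funTS; apply/measurable_EFinP; apply: continuous_measurable_fun.
  exact: continuous_expRN.
apply/seteqP; split => r /=; rewrite !in_itv/= !andbT; first by case.
by move=> cr; split => //; exact: ltW (le_lt_trans c0 cr).
Qed.

Lemma measurable_gamma_tail n : measurable_fun setT (@gamma_tail R n).
Proof.
apply: measurable_fun_ifT.
- exact: measurable_fun_ltr.
- exact: measurable_cst.
apply: measurable_sum => i; apply: continuous_measurable_fun => b.
exact: is_derive_continuous (is_derive_poisson_weight i b).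
Qed.

Lemma gamma_tail_ge0 n (b : R) : 0 <= gamma_tail n b.
Proof.
rewrite /gamma_tail; case: ltP => // b0.
by apply: sumr_ge0 => i _; exact: poisson_weight_ge0.
Qed.

Lemma gamma_tail_le1 n (b : R) : gamma_tail n b <= 1.
Proof.
case: n => [|n]; first by rewrite /gamma_tail; case: ifP => // _; rewrite big_ord0.
rewrite /gamma_tail; case: ltP => // b0.
rewrite -(_ : \sum_(i < n.+1) poisson_weight i (0 : R) = 1); last first.
  rewrite big_ord_recl big1 ?addr0 /=.
    by rewrite /poisson_weight oppr0 expR0 expr0 fact0 divr1 mulr1.
  by move=> i _; rewrite /poisson_weight expr0n/= mulr0 mul0r.
rewrite -lerN2.
have cS : {within `[0, b], continuous (fun b => - \sum_(i < n.+1) poisson_weight i b)}.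
  apply: continuous_subspaceT => x.
  exact: is_derive_continuous (is_deriveN (is_derive_poisson_sum n x)).
apply: (ger0_derive1_ndecr _ _ cS) => // x /[!in_itv]/= /andP[x0 _].
  by have [] := is_deriveN (is_derive_poisson_sum n x).
rewrite derive1E (@derive_val _ _ _ _ _ _ _ (is_deriveN (is_derive_poisson_sum n x))).
by rewrite opprK poisson_weight_ge0// ltW.
Qed.

Lemma continuous_poisson_sum n : continuous (fun b : R => \sum_(i < n) poisson_weight i b).
Proof.
case: n => [|n] b; last exact: is_derive_continuous (is_derive_poisson_sum n b).
by rewrite (_ : (fun _ => _) = cst 0); [exact: cvg_cst|apply/funext => x; rewrite big_ord0].
Qed.

(** The two contributions of p_(i+1) to the derivative of e^(-r) p_(i+1)(b - r) cancel, which leaves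
    - e^(-r) p_i(b - r). This gives the antiderivative in the convolution of a gamma and an
    exponential law. *)
Lemma is_derive_gamma_conv n (b r : R) :
  is_derive r 1 (fun r : R => - (expR (- r) * \sum_(i < n) poisson_weight i.+1 (b - r)))
    (expR (- r) * \sum_(i < n) poisson_weight i (b - r)).
Proof.
elim: n => [|n IH].
  rewrite big_ord0 mulr0 (_ : (fun _ => _) = cst 0); first exact: is_derive_cst.
  by apply/funext => x; rewrite big_ord0 mulr0 oppr0.
have dl : is_derive r 1 (fun r : R => b - r) (- 1).
  rewrite (_ : (fun r : R => b - r) = (fun r => b + (- 1) * r)); first exact: is_derive_affine.
  by apply/funext => x; rewrite mulN1r.
have H1 := @is_derive1_comp _ _ (fun r : R => b - r) _ _ _ (is_derive_poisson_weight n.+1 (b - r)) dl.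
have H2 := is_deriveN (is_deriveM (is_derive_expRN r) H1).
have H3 := is_deriveD IH H2.
rewrite (_ : (fun _ => _) = (fun r : R => - (expR (- r) * \sum_(i < n) poisson_weight i.+1 (b - r)))
   + - ((fun r : R => expR (- r)) * (poisson_weight n.+1 \o (fun r : R => b - r)))).
  by apply: (is_derive_eq H3); rewrite big_ord_recr/= /GRing.scale/=; ring.
by apply/funext => x; rewrite big_ord_recr/= mulrDr opprD.
Qed.

(** Renewal at one of the times, r: if r > b it alone exceeds b, which contributes e^(-b), the
    weight of 0; otherwise the other n times must exceed b - r. *)
Lemma gamma_tail_exponential n (b : R) :
  (\int[nu]_r (gamma_tail n (b - r))%:E = (gamma_tail n.+1 b)%:E)%E.
Proof.
have mg : measurable_fun setT (fun r : R => gamma_tail n (b - r)).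
  apply: measurableT_comp; first exact: measurable_gamma_tail.
  exact: measurable_funB.
have mE : measurable_fun setT (fun r : R => (expR (- r))%:E).
  by apply/measurable_EFinP; apply: continuous_measurable_fun; exact: continuous_expRN.
rewrite integral_exponential_prob; last 2 first.
- exact/measurable_EFinP.
- apply: (@le_lt_trans _ _ (\int[nu]_x cst 1 x)%E); last first.
    by rewrite integral_cst//= mul1e probability_setT ?ltry.
  apply: ge0_le_integral => //=.
    apply/measurable_EFinP; exact: (measurableT_comp (@normr_measurable R setT) mg).
  by move=> r _; rewrite lee_fin ger0_norm ?gamma_tail_le1// gamma_tail_ge0.
rewrite integral_exponential_pdfE setTI.
have [b0|b0] := ltP b 0.
  rewrite (_ : gamma_tail n.+1 b = expR (- 0)); last by rewrite /gamma_tail b0 oppr0 expR0.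
  rewrite -integral_expRN_y; apply: eq_integral => r; rewrite inE/= in_itv/= andbT => r0.
  by rewrite /gamma_tail ifT ?mul1e// subr_lt0 (lt_le_trans b0).
rewrite (_ : `[0, +oo[%classic = `[0, b] `|` `]b, +oo[)%classic; last first.
  apply/seteqP; split => r /=; rewrite !in_itv/= !andbT.
    by move=> ->/=; case: leP => ?; [left|right].
  by move=> [/andP[]//|br]; exact: ltW (le_lt_trans b0 br).
rewrite ge0_integral_setU//=; last 3 first.
- by apply: measurable_funTS; apply: emeasurable_funM => //; exact/measurable_EFinP.
- by move=> r _; rewrite mule_ge0 ?lee_fin ?gamma_tail_ge0 ?expR_ge0.
- apply/disj_setPS => r /= []; rewrite !in_itv/= andbT => /andP[_ rb] br.
  by move: (lt_le_trans br rb); rewrite ltxx.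
rewrite [X in (_ + X)%E](_ : _ = (expR (- b))%:E); last first.
  rewrite -integral_expRN_y -integral_itv_obnd_cbnd; last exact: measurable_funTS.
  apply: eq_integral => r; rewrite inE/= in_itv/= andbT => br.
  by rewrite /gamma_tail ifT ?mul1e// subr_lt0.
rewrite [X in (X + _)%E](_ : _ = (\sum_(i < n) poisson_weight i.+1 b)%:E).
  rewrite -EFinD; congr EFin; rewrite /gamma_tail ltNge b0/= big_ord_recl addrC/=.
  by rewrite /poisson_weight expr0 fact0 divr1 mulr1.
transitivity (\int[mu]_(r in `[0%R, b]) (expR (- r) * \sum_(i < n) poisson_weight i (b - r))%:E)%E.
  apply: eq_integral => r; rewrite inE/= in_itv/= => /andP[r0 rb].
  by rewrite /gamma_tail ltNge subr_ge0 rb/= -EFinM mulrC.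
have pw0 : \sum_(i < n) poisson_weight i.+1 (0 : R) = 0.
  by apply: big1 => i _; rewrite /poisson_weight expr0n/= mulr0 mul0r.
move: b0; rewrite le_eqVlt => /predU1P[b0|b0].
  by rewrite -b0 set_itv1 integral_set1 pw0.
pose F (r : R) : R := - (expR (- r) * \sum_(i < n) poisson_weight i.+1 (b - r)).
have dF (r : R) : is_derive r 1 F (expR (- r) * \sum_(i < n) poisson_weight i (b - r)).
  exact: is_derive_gamma_conv.
rewrite (@continuous_FTC2 _ _ F)//.
- by rewrite /F subrr pw0 subr0 mulr0 oppr0 expR0 mul1r sub0e EFinN oppeK.
- have cS : continuous (fun r : R => \sum_(i < n) poisson_weight i (b - r)).
    move=> r; apply: (@continuous_comp _ _ _ (fun r : R => b - r)
      (fun x => \sum_(i < n) poisson_weight i x)); last exact: continuous_poisson_sum.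
    by apply: cvgB; [exact: cvg_cst|exact: cvg_id].
  by apply: continuous_subspaceT => r; apply: cvgM; [exact: continuous_expRN|exact: cS].
- split.
  + by move=> y _; have [] := dF y.
  + by apply: cvg_at_right_filter; apply: is_derive_continuous (dF 0).
  + by apply: cvg_at_left_filter; apply: is_derive_continuous (dF b).
- by move=> y _; rewrite derive1E (@derive_val _ _ _ _ _ _ _ (dF y)).
Qed.
End exponential_tail.

(** * The first ring after a given time *)

Section next_after.
Context {R : realType}.
Local Open Scope ereal_scope.
Implicit Types (v : nat -> R) (s u : \bar R).

(* [+oo] if no time of [v] comes after [s]. *)
Definition next_after v s : \bar R :=
  ereal_inf (range (fun n => if s < (v n)%:E then (v n)%:E else +oo)).

Lemma next_after_le v s n : s < (v n)%:E -> next_after v s <= (v n)%:E.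
Proof. by move=> sn; apply: ereal_inf_lbound; exists n => //; rewrite sn. Qed.

Lemma next_after_ge v s : s <= next_after v s.
Proof.
by apply: le_ereal_inf_tmp => _ [n _ <-]; case: ifP => [/ltW//|_]; exact: leey.
Qed.

Lemma next_afteroo v : next_after v +oo = +oo.
Proof. by apply/eqP; rewrite -leye_eq next_after_ge. Qed.

Lemma le_next_after v s u : s <= u -> next_after v s <= next_after v u.
Proof.
move=> su; apply: le_ereal_inf_tmp => _ [n _ <-]; case: ifP => [un|_]; last exact: leey.
by apply: next_after_le; exact: le_lt_trans un.
Qed.

(** No ring falls after s and up to u, so both infima run over the same times. *)
Lemma next_after_const v s u : s <= u -> u < next_after v s ->
  next_after v u = next_after v s.
Proof.
move=> su us; apply: (congr1 (fun f : nat -> \bar R => ereal_inf (range f))).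
apply/funext => n.
have [un|un] := boolP (u < (v n)%:E); first by rewrite (le_lt_trans su un).
case: ifP => // sn; move: un; rewrite -leNgt => vu.
by have := lt_le_trans us (next_after_le sn); rewrite ltNge vu.
Qed.

Lemma next_after_attained v s : nondecreasing_seq v ->
  (forall x : R, exists n, (x < v n)%R) -> s < +oo ->
  exists2 n, s < (v n)%:E & next_after v s = (v n)%:E.
Proof.
move=> ndv uv soo.
have ex : exists n, s < (v n)%:E.
  case: s soo => [r _|//|_]; last by exists 0%N; rewrite ltNyr.
  by have [n rn] := uv r; exists n; rewrite lte_fin.
exists (ex_minn ex); case: ex_minnP => // n sn nmin.
apply/eqP; rewrite eq_le next_after_le//=.
apply: le_ereal_inf_tmp => _ [m _ <-]; case: ifP => [sm|_]; last exact: leey.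
by rewrite lee_fin; apply: ndv; exact: nmin.
Qed.

Lemma next_after_gt v s : nondecreasing_seq v ->
  (forall x : R, exists n, (x < v n)%R) -> s < +oo -> s < next_after v s.
Proof. by move=> ndv uv /(next_after_attained ndv uv)[n sn ->]. Qed.

(** Joint measurability is what is used, because the starting time will be the random arrival time
    of a leader. *)
Lemma measurable_next_after {d : measure_display} {T : measurableType d}
    (V : nat -> T -> R) :
  (forall n, measurable_fun setT (V n)) ->
  measurable_fun setT (fun z : \bar R * T => next_after (V^~ z.2) z.1).
Proof.
move=> mV.
pose h (z : \bar R * T) n := if z.1 < (V n z.2)%:E then (V n z.2)%:E else +oo.
rewrite (_ : (fun _ => _) = (fun z => einfs (h z) 0%N)); last first.
  apply/funext => z; rewrite /einfs /next_after; congr ereal_inf.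
  by apply/seteqP; split => _ /= [n _ <-]; exists n.
apply: (@measurable_fun_einfs _ _ _ _ (fun n z => h z n)) => n; rewrite /h.
have mVn : measurable_fun setT (fun z : \bar R * T => (V n z.2)%:E).
  apply/measurable_EFinP; exact: measurableT_comp.
apply: measurable_fun_ifT => //.
exact: measurable_fun_lte.
Qed.
End next_after.

Section measurable_comparison.
Context {d : measure_display} {T : measurableType d} {R : realType}.

Lemma measurable_set_lt (f g : T -> R) : measurable_fun setT f ->
  measurable_fun setT g -> measurable [set w | f w < g w].
Proof.
move=> mf mg; have := measurable_fun_ltr mf mg measurableT (I : measurable [set true]).
by rewrite setTI.
Qed.

Lemma measurable_set_le (f g : T -> R) : measurable_fun setT f ->
  measurable_fun setT g -> measurable [set w | f w <= g w].
Proof.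
move=> mf mg; have := measurable_fun_ler mf mg measurableT (I : measurable [set true]).
by rewrite setTI.
Qed.

Lemma measurable_set_lte (f g : T -> \bar R) : measurable_fun setT f ->
  measurable_fun setT g -> measurable [set w | (f w < g w)%E].
Proof.
move=> mf mg; have := measurable_fun_lte mf mg measurableT (I : measurable [set true]).
by rewrite setTI.
Qed.
End measurable_comparison.

(** * One clock: its rings diverge and have gamma laws *)

Section clock.
Context {d : measure_display} {Omega : measurableType d} {R : realType}.
Variable P : probability Omega R.

Section exponential_sequence.
Variable W : nat -> {RV P >-> R}.
Hypothesis Wi : mutually_independent W.
Hypothesis We : forall n A, measurable A ->
  distribution P (W n) A = exponential_prob 1 A.

Lemma exponential_seq_gt n (c : R) :
  P [set w | c < W n w] = (expR (- Num.max c 0))%:E.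
Proof.
rewrite -exponential_prob_oy -(We n (measurable_itv _)).
by congr (P _); apply/seteqP; split => w /=; rewrite in_itv/= andbT.
Qed.

Lemma exponential_seq_le n (c : R) :
  P [set w | W n w <= c] = (1 - expR (- Num.max c 0))%:E.
Proof.
rewrite EFinB -(exponential_seq_gt n) -probability_setC; last exact: measurable_set_lt.
by congr (P _); apply/seteqP; split => w /=; rewrite leNgt => /negP.
Qed.

Lemma exponential_seq_unbounded (c : R) :
  P (\bigcap_n [set w | W n w <= c]) = 0%E.
Proof.
pose q : R := 1 - expR (- Num.max c 0).
have mle n : measurable [set w | W n w <= c] by exact: measurable_set_le.
have q0 : 0 <= q.
  by rewrite /q subr_ge0 -expR0 ler_expR oppr_le0 le_max lexx orbT.
have q1 : `|q| < 1 by rewrite ger0_norm// /q ltrBlDr ltrDl expR_gt0.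
have Pn n : (P (\bigcap_n [set w | (W n w <= c)%R]) <= (q ^+ n)%:E)%E.
  have -> : (q ^+ n)%:E = P (\bigcap_(i in [set` iota 0 n]) (W i @^-1` `]-oo, c])).
    rewrite (Wi (A := fun=> `]-oo, c]%classic)) ?iota_uniq//.
    rewrite (eq_bigr (fun=> q%:E)); last first.
      by move=> i _; rewrite -(exponential_seq_le i c); congr (P _).
    by rewrite prodEFin big_const_seq count_predT size_iota iter_mulr_1.
  apply: le_measure; rewrite ?inE.
  - exact: bigcapT_measurable.
  - apply: fin_bigcap_measurable => // i _.
    by rewrite -[X in measurable X]setTI; exact: measurable_funP.
  - by move=> w H i _; rewrite /= in_itv/=; exact: H.
apply/eqP; rewrite eq_le measure_ge0 andbT.
have H : (q ^+ n)%:E @[n --> \oo] --> (0 : \bar R).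
  by apply: cvg_EFin; [exact: nearW|exact: cvg_expr].
by apply: cvge_ge H; exact: nearW.
Qed.

Definition good_clock (w : Omega) : Prop :=
  (forall n, 0 < W n w) /\ (forall x : R, exists n, x < \sum_(i < n.+1) W i w).

(** The ring times diverge because almost surely a single waiting time already exceeds any given
    integer. *)
Lemma good_clock_ae : {ae P, forall w, good_clock w}.
Proof.
have H1 : {ae P, forall w, forall n, 0 < W n w}.
  apply: ae_foralln => n.
  exists [set w | W n w <= 0]; split.
  - exact: measurable_set_le.
  - by rewrite [LHS]exponential_seq_le maxxx oppr0 expR0 subrr.
  - by move=> w /= /negP; rewrite -leNgt.
have H2 : {ae P, forall w, forall k : nat, exists n, k%:R < W n w}.
  apply: ae_foralln => k.
  exists (\bigcap_n [set w | W n w <= k%:R]); split.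
  - by apply: bigcapT_measurable => n; exact: measurable_set_le.
  - exact: exponential_seq_unbounded.
  - move=> w /= H n _ /=; rewrite leNgt; apply/negP => kn; apply: H; by exists n.
apply: filterS2 H1 H2 => w W0 Wu; split => // x.
have [k xk] : exists k : nat, x <= k%:R.
  exists (Num.truncn x).+1; exact/ltW/truncnS_gt.
have [n kn] := Wu k; exists n; rewrite big_ord_recr/=.
by rewrite ltr_wpDl ?(le_lt_trans xk)// sumr_ge0// => i _; exact: ltW.
Qed.

Lemma partial_sum_measurable (J : set nat) m : (forall i, (i < m)%N -> J i) ->
  measurable_fun (T := g_sigma_algebraType (cylinders W J)) setT
    (fun w => \sum_(i < m) W i w).
Proof.
by move=> mJ; apply: measurable_sum => i; apply: cylinders_measurable_fun; exact: mJ.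
Qed.

(** The last waiting time is independent of the earlier ones; integrating over it is the recursion
    of [gamma_tail_exponential]. *)
Lemma partial_sum_gt n (b : R) :
  P [set w | b < \sum_(i < n) W i w] = (gamma_tail n b)%:E.
Proof.
elim: n b => [|n IH] b.
  rewrite /gamma_tail big_ord0; case: ltP => b0.
    rewrite -(probability_setT P); congr (P _); apply/seteqP; split => // w _ /=.
    by rewrite big_ord0.
  rewrite (_ : [set w | _] = set0) ?measure0//; apply/seteqP; split => // w /=.
  by rewrite big_ord0 ltNge b0.
have mW m : measurable_fun setT (fun w => \sum_(i < m) W i w) by exact: measurable_sum.
pose A := [set z : R * R | b < z.1 + z.2].
have mA : measurable A by apply: measurable_set_lt => //; exact: measurable_funD.
have -> : P [set w | b < \sum_(i < n.+1) W i w] =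
    (\int[P]_w (\1_A (W n w, \sum_(i < n) W i w)%R)%:E)%E.
  rewrite -[X in P X]setIT -integral_indic//; last exact: measurable_set_lt.
  apply: eq_integral => w _; congr (_%:E); rewrite !indicE; congr (_%:R); congr nat_of_bool.
  by apply/idP/idP; rewrite !inE /A /= big_ord_recr/= addrC.
rewrite (@indep_integral _ _ _ _ _ _ _ P (W n) (fun w => \sum_(i < n) W i w)
  (fun z => (\1_A z)%:E))//; last 2 first.
- move=> B C mB mC.
  apply: (indep_blocks (X := W) (J1 := [set n]) (J2 := [set i | (i < n)%N])) => //.
  + by apply/seteqP; split => // i /= [-> ]; rewrite ltnn.
  + by rewrite -[X in <<s _ >> X]setTI; exact: (cylinders_measurable_fun (J := [set n])).
  + rewrite -[X in <<s _ >> X]setTI.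
    exact: (@partial_sum_measurable [set i | (i < n)%N] n).
- by apply/measurable_EFinP; exact: measurable_indic.
transitivity (\int[P]_w (gamma_tail n (b - W n w))%:E)%E.
  apply: eq_integral => w _; rewrite -IH -[X in P X]setIT -integral_indic//; last first.
    exact: measurable_set_lt.
  apply: eq_integral => v _; congr (_%:E); rewrite !indicE; congr (_%:R); congr nat_of_bool.
  by apply/idP/idP; rewrite !inE /A /= ltrBlDl.
have mWn : measurable_fun setT (W n : Omega -> measurableTypeR R).
  by move=> _ B mB; exact: (@measurable_funP _ _ _ _ setT (W n) measurableT B mB).
pose Y : {mfun Omega >-> measurableTypeR R} :=
  HB.pack (W n : Omega -> measurableTypeR R) (isMeasurableFun.Build _ _ _ _ _ mWn).
transitivity (\int[distribution P Y]_r (gamma_tail n (b - r))%:E)%E.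
  rewrite ge0_integral_distribution//.
  - apply/measurable_EFinP; apply: measurableT_comp; first exact: measurable_gamma_tail.
    exact: measurable_funB.
  - by move=> r; rewrite lee_fin gamma_tail_ge0.
rewrite -gamma_tail_exponential; apply: eq_measure_integral => B mB _; exact: We.
Qed.
End exponential_sequence.
End clock.

Section subsigma.
Context {d : measure_display} {Omega : measurableType d} {R : realType}.
Variable P : probability Omega R.
Context {I : eqType}.
Variable W : I -> {RV P >-> R}.

Lemma sigma_cylinders_measurable J : <<s cylinders W J >> `<=` measurable.
Proof.
apply: smallest_sub; last exact: cylinders_measurable.
exact: sigma_algebra_measurable.
Qed.

Lemma measurable_id_cylinders J :
  measurable_fun setT (id : Omega -> g_sigma_algebraType (cylinders W J)).
Proof. by move=> _ B mB; rewrite setTI; exact: (sigma_cylinders_measurable mB). Qed.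

Lemma measurable_fun_cylinders {d'} {T : measurableType d'} J (f : Omega -> T) :
  measurable_fun (T := g_sigma_algebraType (cylinders W J)) setT f ->
  measurable_fun setT f.
Proof.
move=> mf _ B mB; rewrite setTI; apply: (@sigma_cylinders_measurable J).
by rewrite -[X in <<s _ >> X]setTI; exact: mf.
Qed.
End subsigma.

(** * Memorylessness of one clock, for one walker and for two *)

Section ring_after.
Context {d : measure_display} {Omega : measurableType d} {R : realType}.
Variable P : probability Omega R.
Variable W : nat -> {RV P >-> R}.
Hypothesis Wi : mutually_independent W.
Hypothesis We : forall n A, measurable A ->
  distribution P (W n) A = exponential_prob 1 A.
Local Open Scope ereal_scope.

Let V m w := (\sum_(i < m) W i w)%R.

Definition ring_after s (w : Omega) := next_after (fun n => \sum_(i < n.+1) W i w)%R s.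

Let VS m w : V m.+1 w = (V m w + W m w)%R.
Proof. by rewrite /V big_ord_recr. Qed.

Let V_nd w : good_clock W w -> nondecreasing_seq (fun n => V n w).
Proof.
move=> [W0 _]; apply/nondecreasing_seqP => n.
by rewrite VS lerDl; exact: ltW.
Qed.

Lemma good_clock_nd w : good_clock W w -> nondecreasing_seq (fun n => V n.+1 w).
Proof. by move=> gw m n mn; apply: V_nd. Qed.

Let ring_afterE u m w : good_clock W w -> (V m w <= u < V m.+1 w)%R ->
  ring_after u%:E w = (V m.+1 w)%:E.
Proof.
move=> gw /andP[Vu uV]; apply/eqP; rewrite eq_le next_after_le ?lte_fin//=.
apply: le_ereal_inf_tmp => _ [n _ <-]; case: ifP => [un|_]; last exact: leey.
rewrite lee_fin; apply: (good_clock_nd gw); rewrite leqNgt; apply/negP => nm.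
have := V_nd gw nm; rewrite /= leNgt => /negP; apply.
by apply: le_lt_trans Vu _; move: un; rewrite lte_fin.
Qed.

Let exists_V u w : good_clock W w -> (0 <= u)%R -> exists m, (V m w <= u < V m.+1 w)%R.
Proof.
move=> [W0 Wu] u0.
have ex : exists n, (u < V n.+1 w)%R by exact: Wu.
exists (ex_minn ex); case: ex_minnP => -[|n] un nmin; rewrite un andbT.
  by rewrite /V big_ord0.
by rewrite leNgt; apply/negP => /nmin; rewrite ltnn.
Qed.

Lemma measurable_ring_after s : measurable_fun setT (ring_after s).
Proof.
have mV n : measurable_fun setT (fun w => (\sum_(i < n.+1) W i w)%R) by exact: measurable_sum.
have mp : measurable_fun setT (fun w : Omega => (s, w)) by exact: measurable_fun_pair.
exact: (measurableT_comp (measurable_next_after mV) mp).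
Qed.

Let Phi (F_ : nat -> Omega -> \bar R) u m (c : R) :=
  \int[P]_w (F_ m w * (\1_[set w | V m w <= u]%R w)%:E * (\1_[set w | c < V m w + W m w]%R w)%:E).

(** Given the first m waiting times, with V m <= u, the next one exceeds c - V m with probability
    e^(-(c - u)) e^(-(u - V m)), whose first factor no longer involves the clock. *)
Let Phi_exp (F_ : nat -> Omega -> \bar R) u m (c : R) :
  measurable_fun (T := g_sigma_algebraType (cylinders W [set i | (i < m)%N])) setT (F_ m) ->
  (forall w, 0 <= F_ m w) -> (u <= c)%R ->
  Phi F_ u m c = (expR (- (c - u)))%:E *
    \int[P]_w (F_ m w * (\1_[set w | V m w <= u]%R w)%:E * (expR (- (u - V m w)))%:E).
Proof.
move=> mF F0 uc.
set J := [set i | (i < m)%N] in mF *.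
pose T1 := g_sigma_algebraType (cylinders W J).
have mV : measurable_fun (T := T1) setT (V m) by exact: partial_sum_measurable.
pose A := [set z : T1 * R | c < V m z.1 + z.2]%R.
have mV1 : measurable_fun setT (fun z : T1 * R => V m z.1) by exact: measurableT_comp.
have mA : measurable A.
  by apply: measurable_set_lt => //; exact: measurable_funD.
have mB : measurable ([set w | V m w <= u]%R : set T1) by exact: measurable_set_le.
pose f (z : T1 * R) : \bar R :=
  F_ m z.1 * (\1_[set w | V m w <= u]%R z.1)%:E * (\1_A z)%:E.
transitivity (\int[P]_w f (w, W m w)); first by [].
rewrite (@indep_integral _ _ _ _ _ _ _ P (id : Omega -> T1) (W m) f)//; first last.
- by move=> z; rewrite !mule_ge0// lee_fin.
- apply: emeasurable_funM; last exact/measurable_EFinP/measurable_indic.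
  apply: emeasurable_funM; first exact: (measurableT_comp mF).
  apply/measurable_EFinP; exact: (measurableT_comp (measurable_indic mB)).
- move=> B C sB mC; apply: (indep_blocks (X := W) (J1 := J) (J2 := [set m])) => //.
  + by apply/seteqP; split => // i /= [im ie]; move: im; rewrite /J /= ie ltnn.
  + by rewrite -[X in <<s _ >> X]setTI; exact: (cylinders_measurable_fun (J := [set m])).
- exact: measurable_id_cylinders.
have mF' := measurable_fun_cylinders mF.
have mV' := measurable_fun_cylinders mV.
have mB' : measurable [set w | V m w <= u]%R by exact: measurable_set_le.
rewrite -ge0_integralZl//; last 2 first.
- apply: emeasurable_funM.
    by apply: emeasurable_funM => //; apply/measurable_EFinP; exact: measurable_indic.
  apply/measurable_EFinP; apply: measurableT_comp; first exact: measurable_expR.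
  by apply: measurableT_comp => //; exact: measurable_funB.
- by move=> w _; rewrite !mule_ge0// lee_fin ?expR_ge0.
apply: eq_integral => w _.
pose B := [set v | c - V m w < W m v]%R.
have mBw : measurable B by exact: measurable_set_lt.
have AE v : \1_A (w, W m v) = \1_B v :> R.
  rewrite !indicE; congr (_%:R); congr nat_of_bool.
  by apply/idP/idP; rewrite !inE /A /B /= ltrBlDl.
rewrite /f/=; under eq_integral do rewrite AE.
rewrite ge0_integralZl//; last 2 first.
- by apply/measurable_EFinP; exact: measurable_indic.
- by rewrite mule_ge0// lee_fin.
have IB : \int[P]_x (\1_B x)%:E = (expR (- Num.max (c - V m w) 0))%:E.
  by rewrite integral_indic// setIT; exact: (exponential_seq_gt We m).
rewrite IB.
rewrite indicE; have [|_] := boolP (w \in _); last by rewrite mule0 !mul0e mule0.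
rewrite inE/= => Vu; rewrite max_l; last by rewrite subr_ge0 (le_trans Vu).
rewrite !mule1 muleCA -EFinM -expRD; congr (_ * (expR _)%:E); ring.
Qed.

(** Disjoint by construction; on good clocks this is the event that exactly m rings occur up to
    u. *)
Let before u m := seqDU (fun n => [set w | u < V n.+1 w]%R) m.

Let beforeE u m w : good_clock W w -> (0 <= u)%R ->
  before u m w <-> (V m w <= u < V m.+1 w)%R.
Proof.
move=> gw u0; rewrite /before /seqDU /=; split.
  move=> [um /= H]; rewrite um andbT; case: m um H => [|m] um H.
    by rewrite /V big_ord0.
  rewrite leNgt; apply/negP => um'; apply: H.
  by rewrite -(bigcup_mkord _ (fun k => [set w | u < V k.+1 w]%R)); exists m => /=.
move=> /andP[Vu um]; split => //.
rewrite -(bigcup_mkord _ (fun k => [set w | u < V k.+1 w]%R)) => -[i /= im].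
by rewrite ltNge (le_trans _ Vu)//; exact: V_nd.
Qed.

(** On the event of exactly m rings up to u, F is a function of the first m waiting times, and
    [Phi_exp] extracts the same factor for every m. The integral of F itself is the case c = u. *)
Lemma ring_after_memoryless (u c : R) (F : Omega -> \bar R) (F_ : nat -> Omega -> \bar R) :
  (0 <= u)%R -> (u <= c)%R -> measurable_fun setT F -> (forall w, 0 <= F w) ->
  (forall m, measurable_fun (T := g_sigma_algebraType (cylinders W [set i | (i < m)%N]))
     setT (F_ m)) ->
  (forall m w, 0 <= F_ m w) ->
  (forall m w, good_clock W w -> (V m w <= u < V m.+1 w)%R -> F w = F_ m w) ->
  \int[P]_w (F w * (\1_[set w | (c%:E < ring_after u%:E w)%E] w)%:E) =
  (expR (- (c - u)))%:E * \int[P]_w F w.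
Proof.
move=> u0 uc mF F0 mF_ F_0 FE.
have mVm m : measurable_fun setT (V m) by exact: measurable_sum.
have mbefore m : measurable (before u m).
  rewrite /before /seqDU; apply: measurableD; first exact: measurable_set_lt.
  rewrite -(bigcup_mkord _ (fun k => [set w | u < V k.+1 w]%R)).
  by apply: bigcup_measurable => i _; exact: measurable_set_lt.
have mR c' : measurable [set w | (c'%:E < ring_after u%:E w)%E].
  by apply: measurable_set_lte => //; exact: measurable_ring_after.
have sumE c' : (u <= c')%R ->
    \int[P]_w (F w * (\1_[set w | (c'%:E < ring_after u%:E w)%E] w)%:E) =
    \sum_(0 <= m <oo) Phi F_ u m c'.
  move=> uc'; set g := fun w => _ * _.
  have mg : measurable_fun setT g.
    by apply: emeasurable_funM => //; apply/measurable_EFinP; exact: measurable_indic.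
  have g0 w : 0 <= g w by rewrite mule_ge0// lee_fin.
  transitivity (\int[P]_(w in \bigcup_m before u m) g w).
    rewrite [RHS]integral_mkcond; apply: ge0_ae_eq_integral => //.
    - by apply/(measurable_restrictT _ _).1; [exact: bigcupT_measurable|exact: measurable_funTS].
    - by move=> w _; exact: g0.
    - by move=> w _; rewrite patchE; case: ifP.
    - apply: filterS (good_clock_ae Wi We) => w gw _; rewrite patchE mem_set//.
      by have [m Hm] := exists_V gw u0; exists m => //; exact/beforeE.
  rewrite ge0_integral_bigcup//; last 2 first.
  - exact: measurable_funTS.
  - exact: trivIset_seqDU.
  apply: eq_eseriesr => m _; rewrite integral_mkcond; apply: ge0_ae_eq_integral => //.
  - by apply/(measurable_restrictT _ _).1 => //; exact: measurable_funTS.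
  - have mF' := measurable_fun_cylinders (mF_ m).
    apply: emeasurable_funM.
      apply: emeasurable_funM => //; apply/measurable_EFinP; apply: measurable_indic.
      exact: measurable_set_le.
    apply/measurable_EFinP; apply: measurable_indic.
    by apply: measurable_set_lt => //; exact: measurable_funD.
  - by move=> w _; rewrite patchE; case: ifP.
  - by move=> w _; rewrite !mule_ge0// lee_fin.
  - apply: filterS (good_clock_ae Wi We) => w gw _; rewrite patchE.
    have [|/negP nb] := boolP (w \in before u m).
      rewrite inE => /(beforeE _ gw u0) Hm; have /andP[Vu uV] := Hm.
      rewrite /g (FE _ _ gw Hm) !indicE (mem_set (A := [set w | _ <= _]%R))// mule1.
      congr (_ * _%:R%:E); congr nat_of_bool; apply/idP/idP; rewrite !inE/=.
        by rewrite (ring_afterE gw Hm) lte_fin VS.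
      by rewrite (ring_afterE gw Hm) lte_fin VS.
    rewrite !indicE; have [|] := boolP (w \in [set w | V m w <= u]%R); last by rewrite mule0 mul0e.
    rewrite inE/= => Vu; rewrite memNset ?mule0//= -VS => cV; apply: nb.
    by rewrite inE; apply/(beforeE _ gw u0); rewrite Vu (le_lt_trans uc' cV).
have intF : \int[P]_w F w = \int[P]_w (F w * (\1_[set w | (u%:E < ring_after u%:E w)%E] w)%:E).
  apply: ge0_ae_eq_integral => //.
  - by apply: emeasurable_funM => //; apply/measurable_EFinP; exact: measurable_indic.
  - by move=> w _; rewrite mule_ge0// lee_fin.
  - apply: filterS (good_clock_ae Wi We) => w gw _.
    rewrite indicE mem_set ?mule1//=; apply: next_after_gt;
      [exact: good_clock_nd|exact: gw.2|exact: ltry].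
rewrite intF !sumE// -nneseriesZl; last first.
  by move=> m _; apply: integral_ge0 => w _; rewrite !mule_ge0// lee_fin.
apply: eq_eseriesr => m _; rewrite !Phi_exp// subrr oppr0 expR0 mul1e//.
Qed.

(* The probability that a rate 1 walk started at time [v] makes its [n]-th jump
   after time [t], the 0-th jump being the start; the value at [-oo] is junk. *)
Definition arrival_tail (t : R) n (v : \bar R) : \bar R :=
  if v is r%:E then (gamma_tail n (t - r))%:E else 1.

Lemma arrival_tail_ge0 t n v : 0 <= arrival_tail t n v.
Proof. by case: v => [r| |] //=; rewrite lee_fin gamma_tail_ge0. Qed.

Lemma arrival_tail_gt t n v : t%:E < v -> arrival_tail t n v = 1.
Proof.
case: v => [r| |] //=; rewrite lte_fin => tr.
by rewrite /gamma_tail ifT// subr_lt0.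
Qed.

Lemma arrival_tail0 t v : 0 <= v -> arrival_tail t 0 v = (\1_[set v | (t%:E < v)%E] v)%:E.
Proof.
move=> v0; rewrite indicE; have [|/negP tv] := boolP (v \in _).
  by rewrite inE/= => /arrival_tail_gt ->.
case: v v0 tv => [r r0| |//] /=; last by move=> _; rewrite inE/= ltry.
by rewrite inE/= lte_fin => tv; rewrite /gamma_tail subr_lt0 ifN ?big_ord0//; exact/negP.
Qed.

(** Represents the n jumps by a second, independent copy of the clock, so that integrals can be
    exchanged. *)
Lemma arrival_tailE t n v : -oo < v ->
  arrival_tail t n v = \int[P]_w (\1_[set w | (t%:E < v + (V n w)%:E)%E] w)%:E.
Proof.
have mV : measurable_fun setT (V n) by exact: measurable_sum.
case: v => [r _| _|//] /=.
  rewrite -(partial_sum_gt Wi We) integral_indic//.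
    by rewrite setIT; congr (P _); apply/seteqP; split => w /=; rewrite -EFinD lte_fin ltrBlDl.
  by apply: measurable_set_lte => //; apply/measurable_EFinP; exact: measurable_funD.
rewrite (_ : [set w | _] = setT); last by apply/seteqP; split => // w _ /=; rewrite addye// ltry.
by rewrite integral_indic// setIT; apply/esym/probability_setT.
Qed.

Lemma measurable_arrival_tail t n : measurable_fun setT (arrival_tail t n).
Proof.
rewrite (_ : arrival_tail t n =
  fun v => if (-oo < v) && (v < +oo) then (gamma_tail n (t - fine v))%:E else 1).
  apply: measurable_fun_ifT => //.
    by apply: measurable_and; exact: measurable_fun_lte.
  apply/measurable_EFinP; apply: measurableT_comp; first exact: measurable_gamma_tail.
  by apply: measurable_funB => //; exact: measurable_fine.
by apply/funext => -[r| |] //=; rewrite ltNyr ltry.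
Qed.

(** The integrand is the probability that one more waiting time exceeds b - V n. *)
Lemma partial_sum_exp n (b : R) :
  \int[P]_w (expR (- Num.max (b - V n w) 0))%:E = (gamma_tail n.+1 b)%:E.
Proof.
rewrite -(partial_sum_gt Wi We).
pose A := [set z : R * R | b < z.1 + z.2]%R.
have mA : measurable A by apply: measurable_set_lt => //; exact: measurable_funD.
have mV m : measurable_fun setT (V m) by exact: measurable_sum.
have -> : P [set w | b < \sum_(i < n.+1) W i w]%R = \int[P]_w (\1_A (V n w, W n w))%:E.
  rewrite -[X in P X]setIT -integral_indic//; last first.
    by apply: measurable_set_lt => //; exact: (mV n.+1).
  apply: eq_integral => w _; congr (_%:E); rewrite !indicE; congr (_%:R); congr nat_of_bool.
  by apply/idP/idP; rewrite !inE /A /= big_ord_recr.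
rewrite (@indep_integral _ _ _ _ _ _ _ P (V n) (W n) (fun z => (\1_A z)%:E))//; last 2 first.
- move=> B C mB mC.
  apply: (indep_blocks (X := W) (J1 := [set i | (i < n)%N]) (J2 := [set n])) => //.
  + by apply/seteqP; split => // i /= [im ie]; move: im; rewrite /= ie ltnn.
  + rewrite -[X in <<s _ >> X]setTI.
    exact: (@partial_sum_measurable _ _ _ _ W [set i | (i < n)%N] n).
  + by rewrite -[X in <<s _ >> X]setTI; exact: (cylinders_measurable_fun (J := [set n])).
- by apply/measurable_EFinP; exact: measurable_indic.
apply: eq_integral => w _; rewrite -(exponential_seq_gt We n) -[X in P X]setIT -integral_indic//; last first.
  exact: measurable_set_lt.
apply: eq_integral => v _; congr (_%:E); rewrite !indicE; congr (_%:R); congr nat_of_bool.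
by apply/idP/idP; rewrite !inE /A /= ltrBlDl.
Qed.

(* [F] only depends on the rings up to time [u]: when exactly [m] of them have
   occurred, it is a function of the first [m] waiting times. *)
Definition memoryless_factor (u : R) (F : Omega -> \bar R) : Prop :=
  [/\ measurable_fun setT F, (forall w, 0 <= F w) &
   exists F_ : nat -> Omega -> \bar R, [/\
     (forall m, measurable_fun (T := g_sigma_algebraType (cylinders W [set i | (i < m)%N]))
       setT (F_ m)),
     (forall m w, 0 <= F_ m w) &
     (forall m w, good_clock W w ->
       (\sum_(i < m) W i w <= u < \sum_(i < m.+1) W i w)%R -> F w = F_ m w)]].

(** The n jumps after the ring are taken from an independent copy v of the clock. For fixed v,
    memorylessness with c = t - V n v separates F from the factor e^(-max(t - u - V n v, 0)), and
    the average of this factor over v is the tail for n + 1 jumps. *)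
Lemma arrival_tail_ring t n (u : R) (F : Omega -> \bar R) : (0 <= u)%R ->
  memoryless_factor u F ->
  \int[P]_w (F w * arrival_tail t n (ring_after u%:E w)) =
  arrival_tail t n.+1 u%:E * \int[P]_w F w.
Proof.
move=> u0 [mF F0 [F_ [mF_ F_0 FE]]].
have mV : measurable_fun setT (V n) by exact: measurable_sum.
have mRu := measurable_ring_after u%:E.
pose g (z : Omega * Omega) : \bar R :=
  F z.1 * (\1_[set z : Omega * Omega | (t%:E < ring_after u%:E z.1 + (V n z.2)%:E)%E] z)%:E.
have mA : measurable [set z : Omega * Omega | (t%:E < ring_after u%:E z.1 + (V n z.2)%:E)%E].
  apply: measurable_set_lte => //; apply: emeasurable_funD.
    exact: measurableT_comp.
  apply/measurable_EFinP; exact: measurableT_comp.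
have mg : measurable_fun setT g.
  apply: emeasurable_funM; first exact: measurableT_comp.
  by apply/measurable_EFinP; exact: measurable_indic.
have g0 z : 0 <= g z by rewrite mule_ge0// lee_fin.
have RuNy w : -oo < ring_after u%:E w.
  by apply: lt_le_trans (next_after_ge _ _); exact: ltNyr.
transitivity (\int[P]_w \int[P]_v g (w, v)).
  apply: eq_integral => w _; rewrite arrival_tailE// -ge0_integralZl//.
  apply/measurable_EFinP; apply: measurable_indic.
  apply: measurable_set_lte => //; apply: emeasurable_funD => //.
  exact/measurable_EFinP.
rewrite (fubini_tonelli g)//.
transitivity (\int[P]_v ((expR (- Num.max (t - u - V n v) 0))%:E * \int[P]_w F w)).
  apply: eq_integral => v _.
  transitivity (\int[P]_w (F w * (\1_[set w | ((t - V n v)%:E < ring_after u%:E w)%E] w)%:E)).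
    apply: eq_integral => w _; rewrite /g/= !indicE; congr (_ * _%:R%:E); congr nat_of_bool.
    by apply/idP/idP; rewrite !inE/= EFinB lteBlDr.
  have mF' : memoryless_factor u F by split => //; exists F_.
  have [vu|uv] := leP (t - u - V n v)%R 0%R.
    rewrite oppr0 expR0 mul1e; apply: ge0_ae_eq_integral => //.
    - apply: emeasurable_funM => //; apply/measurable_EFinP; apply: measurable_indic.
      exact: measurable_set_lte.
    - by move=> w _; rewrite mule_ge0// lee_fin.
    - apply: filterS (good_clock_ae Wi We) => w gw _; rewrite indicE mem_set ?mule1//=.
      apply: (@le_lt_trans _ _ u%:E); first by rewrite lee_fin; lra.
      by apply: next_after_gt; [exact: good_clock_nd|exact: gw.2|exact: ltry].
  rewrite (ring_after_memoryless u0 _ mF F0 mF_ F_0 FE); last by lra.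
  by congr ((expR _)%:E * _); ring.
rewrite ge0_integralZr//; last 2 first.
- apply/measurable_EFinP; apply: measurableT_comp; first exact: measurable_expR.
  by apply: measurableT_comp => //; apply: measurable_maxr => //; exact: measurable_funB.
- exact: integral_ge0.
by rewrite partial_sum_exp.
Qed.

Lemma arrival_tail_ring1 t n s : 0 <= s ->
  \int[P]_w arrival_tail t n (ring_after s w) = arrival_tail t n.+1 s.
Proof.
case: s => [u| |]//; last 1 first.
  move=> _; under eq_integral do rewrite /ring_after next_afteroo/=.
  by rewrite integral_cst// mul1e; exact: probability_setT.
rewrite lee_fin => u0.
have mf : memoryless_factor u (cst 1).
  by split => //; exists (fun=> cst 1); split => // m; exact: measurable_cst.
have := arrival_tail_ring t n u0 mf.
under eq_integral do rewrite mul1e.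
move=> ->; rewrite integral_cst// mul1e.
rewrite [X in _ * X](_ : _ = 1) ?mule1//; exact: probability_setT.
Qed.

(* The first ring after [s] among the first [m] rings, when [0 < m]. *)
Let trunc m w s := next_after (fun n => V (minn n.+1 m) w) s.

Let measurable_trunc (h : \bar R -> \bar R) m s : measurable_fun setT h ->
  measurable_fun (T := g_sigma_algebraType (cylinders W [set i | (i < m)%N])) setT
    (fun w => h (trunc m w s)).
Proof.
move=> mh.
pose T1 := g_sigma_algebraType (cylinders W [set i | (i < m)%N]).
have mV n : measurable_fun (T := T1) setT (fun w => V (minn n.+1 m) w).
  by apply: partial_sum_measurable => i /= im; exact: leq_trans im (geq_minr _ _).
have mp : measurable_fun setT (fun w : T1 => (s, w)) by exact: measurable_fun_pair.
exact: (measurableT_comp mh (measurableT_comp (measurable_next_after mV) mp)).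
Qed.

Let trunc_ge m w s u : good_clock W w -> 0 <= s -> (V m w <= u < V m.+1 w)%R ->
  ring_after s w <= trunc m w s.
Proof.
move=> gw s0 /andP[Vu _]; apply: le_ereal_inf_tmp => _ [n _ <-].
case: ifP => [sn|_]; last exact: leey.
case: m Vu sn => [|m] Vu sn.
  (* With m = 0 the only candidate is time 0, which does not come after s. *)
  by move: sn; rewrite minn0 /V big_ord0 ltNge s0.
rewrite minnSS in sn *; exact: next_after_le.
Qed.

(** A ring up to u is one of the first m, so the truncation does not lose it. *)
Let trunc_eq m w s u : good_clock W w -> (V m w <= u < V m.+1 w)%R -> 0 <= s ->
  ring_after s w <= u%:E -> trunc m w s = ring_after s w.
Proof.
move=> gw Vu s0 Ru; apply/eqP; rewrite eq_le (trunc_ge gw s0 Vu) andbT.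
have soo : s < +oo by apply: le_lt_trans (next_after_ge _ _) (le_lt_trans Ru (ltry _)).
have [n sn Rn] := next_after_attained (good_clock_nd gw) gw.2 soo.
have nm : (n < m)%N.
  rewrite ltnNge; apply/negP => mn; move: Ru; rewrite /ring_after Rn lee_fin leNgt => /negP; apply.
  by have /andP[_ uV] := Vu; apply: (lt_le_trans uV); exact: good_clock_nd.
have e : V n.+1 w = V (minn n.+1 m) w by rewrite (minn_idPl nm).
by rewrite /ring_after Rn e; apply: (@next_after_le _ (fun n => V (minn n.+1 m) w) s n); rewrite -e.
Qed.

(** Whether a ring occurs after s and up to u, and when the first one does, is decided by the rings
    up to u; [trunc] exhibits this as a function of the first m waiting times. *)
Let memoryless_trunc (u : R) s (g : \bar R -> \bar R) : 0 <= s -> s <= u%:E ->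
  measurable_fun setT g -> (forall v, 0 <= g v) ->
  memoryless_factor u (fun w => g (ring_after s w) * (\1_[set v | (v <= u%:E)%E] (ring_after s w))%:E).
Proof.
move=> s0 su mg g0.
have mle : measurable [set v : \bar R | v <= u%:E] by exact: emeasurable_itv `]-oo, u%:E].
split.
- apply: emeasurable_funM; first exact: (measurableT_comp mg (measurable_ring_after s)).
  apply/measurable_EFinP; exact: (measurableT_comp (measurable_indic mle) (measurable_ring_after s)).
- by move=> w; rewrite mule_ge0// lee_fin.
- exists (fun m w => g (trunc m w s) * (\1_[set v | (v <= u%:E)%E] (trunc m w s))%:E); split.
  + move=> m; apply: (@measurable_trunc (fun v => g v * (\1_[set v | (v <= u%:E)%E] v)%:E)).
    by apply: emeasurable_funM => //; exact/measurable_EFinP/measurable_indic.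
  + by move=> m w; rewrite mule_ge0// lee_fin.
  + move=> m w gw Vu; have [Ru|uR] := leP (ring_after s w) u%:E.
      by rewrite (trunc_eq gw Vu s0 Ru).
    rewrite !indicE !memNset ?mule0//=.
      by apply/negP; rewrite -ltNge (lt_le_trans uR)// (trunc_ge gw s0 Vu).
    by apply/negP; rewrite -ltNge.
Qed.

Let memoryless_gt (u : R) s : 0 <= s -> s <= u%:E ->
  memoryless_factor u (fun w => (\1_[set v | (u%:E < v)%E] (ring_after s w))%:E).
Proof.
move=> s0 su.
have mgt : measurable [set v : \bar R | u%:E < v] by exact:
  (measurable_set_lte (measurable_cst u%:E) (@measurable_id _ _ setT)).
split.
- apply/measurable_EFinP; exact: (measurableT_comp (measurable_indic mgt) (measurable_ring_after s)).
- by move=> w; rewrite lee_fin.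
- exists (fun m w => (\1_[set v | (u%:E < v)%E] (trunc m w s))%:E); split.
  + by move=> m; apply: (@measurable_trunc (fun v => (\1_[set v | (u%:E < v)%E] v)%:E));
    exact/measurable_EFinP/measurable_indic.
  + by move=> m w; rewrite lee_fin.
  + move=> m w gw Vu; have [Ru|uR] := leP (ring_after s w) u%:E.
      by rewrite (trunc_eq gw Vu s0 Ru).
    by rewrite !indicE !mem_set//= (lt_le_trans uR)// (trunc_ge gw s0 Vu).
Qed.

(* Either both walkers take the same ring, the first one after [u], or the
   walker at [s] takes a ring before [u], which leaves the clock of the other
   one fresh; the first case is symmetric in [i] and [j]. *)
Lemma arrival_tail_ring2 t i j s u : 0 <= s -> s <= u ->
  \int[P]_w (arrival_tail t i (ring_after s w) * arrival_tail t j (ring_after u w))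
    + arrival_tail t j.+1 s * arrival_tail t i.+1 u =
  \int[P]_w (arrival_tail t j (ring_after s w) * arrival_tail t i (ring_after u w))
    + arrival_tail t i.+1 s * arrival_tail t j.+1 u.
Proof.
move=> s0 su; have u0 := le_trans s0 su.
case: u u0 su => [u| |]// u0 su; last first.
  (* A walker starting at +oo never jumps, so its tails are 1. *)
  have E k l : \int[P]_w (arrival_tail t k (ring_after s w) *
      arrival_tail t l (ring_after +oo w)) = arrival_tail t k.+1 s.
    by under eq_integral do rewrite [ring_after +oo _]next_afteroo/= mule1;
      exact: arrival_tail_ring1.
  by rewrite !E !mule1 addeC.
pose H := arrival_tail t.
have H0 n v : 0 <= H n v by exact: arrival_tail_ge0.
have mH n : measurable_fun setT (H n) by exact: measurable_arrival_tail.
pose L w : \bar R := (\1_[set v | (v <= u%:E)%E] (ring_after s w))%:E.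
pose G w : \bar R := (\1_[set v | (u%:E < v)%E] (ring_after s w))%:E.
have LG w : L w + G w = 1.
  rewrite /L /G !indicE; case: (leP (ring_after s w) u%:E) => h.
    by rewrite mem_set// memNset ?adde0//=; apply/negP; rewrite -leNgt.
  by rewrite memNset ?mem_set ?add0e//=; apply/negP; rewrite -ltNge.
have RG w n : H n (ring_after s w) * G w = G w * H n (ring_after u%:E w).
  rewrite /G indicE; have [|_] := boolP (_ \in _); last by rewrite mule0 mul0e.
  rewrite inE/= => uR; rewrite mule1 mul1e.
  by rewrite /ring_after (next_after_const su uR).
have mG : measurable_fun setT G by have [] := memoryless_gt s0 su.
have mLH n : measurable_fun setT (fun w => H n (ring_after s w) * L w).
  by have [] := memoryless_trunc s0 su (mH n) (H0 n).
have G0 w : 0 <= G w by rewrite lee_fin.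
have L0 w : 0 <= L w by rewrite lee_fin.
have mHR n v : measurable_fun setT (fun w => H n (ring_after v w)).
  exact: (measurableT_comp (mH n) (measurable_ring_after v)).
pose a n := \int[P]_w (H n (ring_after s w) * L w).
pose c := \int[P]_w G w.
pose J := \int[P]_w (G w * H i (ring_after u%:E w) * H j (ring_after u%:E w)).
have u0' : (0 <= u)%R by rewrite -lee_fin.
(* The walker at s either takes a ring up to u, which contributes [a n], or, with probability [c],
   is still waiting at u and starts afresh there. *)
have HS n : H n.+1 s = a n + c * H n.+1 u%:E.
  rewrite -[H n.+1 s]arrival_tail_ring1//.
  transitivity (\int[P]_w (H n (ring_after s w) * L w + G w * H n (ring_after u%:E w))).
    by apply: eq_integral => w _; rewrite -RG -ge0_muleDr// LG mule1.
  rewrite ge0_integralD//; last 3 first.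
  - by move=> w _; exact: mule_ge0.
  - by move=> w _; exact: mule_ge0.
  - exact: emeasurable_funM.
  by rewrite (arrival_tail_ring t n u0' (memoryless_gt s0 su)) muleC.
(* If s has a ring up to u, the two factors separate; otherwise both tails are taken at the same
   ring, which is symmetric in k and l. *)
have E k l : \int[P]_w (H k (ring_after s w) * H l (ring_after u%:E w)) =
    a k * H l.+1 u%:E + \int[P]_w (G w * H k (ring_after u%:E w) * H l (ring_after u%:E w)).
  transitivity (\int[P]_w (H k (ring_after s w) * L w * H l (ring_after u%:E w) +
      G w * H k (ring_after u%:E w) * H l (ring_after u%:E w))).
    apply: eq_integral => w _; rewrite -RG -ge0_muleDl ?mule_ge0//.
    by rewrite -ge0_muleDr// LG mule1.
  rewrite ge0_integralD//; last 4 first.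
  - by move=> w _; rewrite !mule_ge0.
  - exact: emeasurable_funM.
  - by move=> w _; rewrite !mule_ge0.
  - by apply: emeasurable_funM => //; exact: emeasurable_funM.
  by rewrite (arrival_tail_ring t l u0' (memoryless_trunc s0 su (mH k) (H0 k))) muleC.
have a0 n : 0 <= a n by apply: integral_ge0 => w _; exact: mule_ge0.
have c0 : 0 <= c by exact: integral_ge0.
clearbody a c.
rewrite -/(H i) -/(H j) !E -!/(H _ _) -/(H i.+1 s) -/(H j.+1 s) !HS.
rewrite !ge0_muleDl ?mule_ge0//.
have -> : \int[P]_w (G w * H j (ring_after u%:E w) * H i (ring_after u%:E w)) = J.
  by apply: eq_integral => w _; rewrite muleAC.
(* Both sides consist of J, a i H_(j+1)(u), a j H_(i+1)(u) and c H_(i+1)(u) H_(j+1)(u). *)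
rewrite -/J addeACA [in RHS]addeACA; congr (_ + (_ + _)); first exact: addeC.
by rewrite muleAC.
Qed.
End ring_after.

Section reindex.
Context {d : measure_display} {Omega : measurableType d} {R : realType}.
Variable P : probability Omega R.

Lemma mutually_independent_inj (J I : eqType) (X : I -> {RV P >-> R}) (f : J -> I) :
  injective f -> mutually_independent X -> mutually_independent (fun j => X (f j)).
Proof.
move=> fI mi s A us mA.
pose A' i := \bigcap_(j in [set j | f j = i]) A j.
have A'f j : A' (f j) = A j.
  apply/seteqP; split => r; first by apply.
  by move=> Ar j' /= /fI ->.
have mA' i : measurable (A' i).
  have [[j <-]|nj] := pselect (exists j, f j = i); first by rewrite A'f.
  rewrite (_ : A' i = setT)//; apply/seteqP; split => // r _ j ji.
  by exfalso; apply: nj; exists j.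
have := mi (map f s) A'; rewrite map_inj_uniq// => /(_ us mA').
rewrite big_map (_ : \bigcap_(i in _) _ = \bigcap_(j in [set` s]) (X (f j) @^-1` A j)).
  by move=> ->; apply: eq_bigr => j _; rewrite A'f.
apply/seteqP; split => w H.
  by move=> j js; rewrite /= -A'f; apply: H => /=; exact: map_f.
by move=> _ /= /mapP[j js ->]; rewrite A'f; exact: H.
Qed.
End reindex.

(** * The walk of a leader *)

Section arrival.
Context {d : measure_display} {Omega : measurableType d} {R : realType}.
Variable P : probability Omega R.
Variable W : int -> nat -> {RV P >-> R}.
Hypothesis HW : rate1_clocks W.
Local Open Scope ereal_scope.

(* The time at which the [k]-leader arrives at the site [- k + n]: it leaves
   that site at the first ring of the edge in front of it. *)
Fixpoint arrival (k : int) n w : \bar R :=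
  if n is m.+1 then ring_after (W (- k + m%:Z)) (arrival k m w) w else 0%:E.

Let X (j : int * nat) := W j.1 j.2.
(** The clocks of the edges strictly before the site z. They determine every arrival time at z,
    which is therefore independent of the clock of the edge leaving z. *)
Let past (z : int) := cylinders X [set j : int * nat | (j.1 < z)%R].
Let edge (z : int) := cylinders X [set j : int * nat | j.1 = z].

Lemma clocks_indep z : mutually_independent (W z).
Proof. by apply: (mutually_independent_inj (f := fun n => (z, n))) HW.1 => m n []. Qed.

Lemma clocks_exp z n A : measurable A -> distribution P (W z n) A = exponential_prob 1 A.
Proof. exact: HW.2. Qed.

Lemma good_clocks_ae : {ae P, forall w, forall z, good_clock (W z) w}.
Proof.
have H : {ae P, forall w, forall n, good_clock (W (odflt 0%R (unpickle n))) w}.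
  by apply: ae_foralln => n; exact: (good_clock_ae (clocks_indep _) (clocks_exp _)).
by apply: filterS H => w H z; have := H (pickle z); rewrite pickleK.
Qed.

Lemma arrival_ge0 k n w : 0 <= arrival k n w.
Proof.
by elim: n => [|n IH] //=; apply: le_trans IH _; exact: next_after_ge.
Qed.

(** Both arrivals are at the site - k + n. The two leaders read the same clocks from there on, and
    [next_after] is monotone in the starting time. *)
Lemma le_arrival k m n w : arrival k n w <= arrival (k + m%:Z) (m + n) w.
Proof.
elim: n => [|n IH]; first exact: arrival_ge0.
rewrite addnS/= (_ : (- (k + m%:Z) + (m + n)%N%:Z = - k + n%:Z)%R).
  exact: le_next_after.
by rewrite PoszD; ring.
Qed.

Let measurable_ring (z y : int) (f : Omega -> \bar R) : (y < z)%R ->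
  measurable_fun (T := g_sigma_algebraType (past z)) setT f ->
  measurable_fun (T := g_sigma_algebraType (past z)) setT
    (fun w => ring_after (W y) (f w) w).
Proof.
move=> yz mf.
pose T1 := g_sigma_algebraType (past z).
have mV n : measurable_fun (T := T1) setT (fun w => \sum_(i < n.+1) W y i w)%R.
  apply: measurable_sum => i.
  by apply: (cylinders_measurable_fun (X := X) (i := (y, nat_of_ord i))).
have mp : measurable_fun setT (fun w : T1 => (f w, w)) by exact: measurable_fun_pair.
exact: (measurableT_comp (measurable_next_after mV) mp).
Qed.

Let measurable_arrival_past k n z : (- k + n%:Z <= z)%R ->
  measurable_fun (T := g_sigma_algebraType (past z)) setT (arrival k n).
Proof.
elim: n => [|n IH] nz; first exact: measurable_cst.
have nz' : (- k + n%:Z < z)%R by rewrite (lt_le_trans _ nz)// ltrD2l ltz_nat.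
by apply: measurable_ring => //; apply: IH; exact: ltW.
Qed.

Lemma measurable_arrival k n : measurable_fun setT (arrival k n).
Proof. exact: (measurable_fun_cylinders (measurable_arrival_past (lexx _))). Qed.

Let integral_past_edge z (f : g_sigma_algebraType (past z) * g_sigma_algebraType (edge z) -> \bar R) :
  measurable_fun setT f -> (forall p, 0 <= f p) ->
  \int[P]_w f (w, w) = \int[P]_w \int[P]_v f (w, v).
Proof.
move=> mf f0.
apply: (@indep_integral _ _ _ _ _ _ _ P (id : Omega -> g_sigma_algebraType (past z))
  (id : Omega -> g_sigma_algebraType (edge z)) f) => //.
- exact: measurable_id_cylinders.
- exact: measurable_id_cylinders.
- move=> A B sA sB; apply: (indep_blocks (X := X)) sA sB; first exact: HW.1.
  by apply/seteqP; split => // j /= [jz je]; move: jz; rewrite je ltxx.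
Qed.

Let measurable_past_edge z (tau : g_sigma_algebraType (past z) -> \bar R) t a :
  measurable_fun setT tau ->
  measurable_fun setT (fun p : g_sigma_algebraType (past z) * g_sigma_algebraType (edge z) =>
    arrival_tail t a (ring_after (W z) (tau p.1) p.2)).
Proof.
move=> mf; apply: (measurableT_comp (measurable_arrival_tail _ _)).
pose T1 := g_sigma_algebraType (past z).
pose T2 := g_sigma_algebraType (edge z).
have mV n : measurable_fun (T := T2) setT (fun w => \sum_(i < n.+1) W z i w)%R.
  apply: measurable_sum => i.
  by apply: (cylinders_measurable_fun (X := X) (i := (z, nat_of_ord i))).
have mp : measurable_fun setT (fun p : T1 * T2 => (tau p.1, p.2)).
  by apply: measurable_fun_pair => //; exact: measurableT_comp.
exact: (measurableT_comp (measurable_next_after mV) mp).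
Qed.

Let ring_step1 z t a (tau : Omega -> \bar R) (F : Omega -> \bar R) :
  measurable_fun (T := g_sigma_algebraType (past z)) setT tau ->
  measurable_fun (T := g_sigma_algebraType (past z)) setT F ->
  (forall w, 0 <= tau w) -> (forall w, 0 <= F w) ->
  \int[P]_w (F w * arrival_tail t a (ring_after (W z) (tau w) w)) =
  \int[P]_w (F w * arrival_tail t a.+1 (tau w)).
Proof.
move=> mt mF t0 F0.
pose f (p : g_sigma_algebraType (past z) * g_sigma_algebraType (edge z)) :=
  F p.1 * arrival_tail t a (ring_after (W z) (tau p.1) p.2).
transitivity (\int[P]_w f (w, w)); first by [].
rewrite integral_past_edge; last 2 first.
- by apply: emeasurable_funM; [exact: measurableT_comp|exact: measurable_past_edge].
- by move=> p; rewrite mule_ge0// arrival_tail_ge0.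
apply: eq_integral => w _; rewrite /f/= ge0_integralZl//.
- by rewrite (arrival_tail_ring1 (clocks_indep z) (clocks_exp z)).
- exact: (measurableT_comp (measurable_arrival_tail _ _) (measurable_ring_after _ _)).
- by move=> v _; exact: arrival_tail_ge0.
Qed.

(** Both leaders leave the site z by the same clock, which is independent of their arrival times
    there: with these frozen, the claim is [arrival_tail_ring2]. *)
Let ring_step2 z t a b (tau sigma : Omega -> \bar R) :
  measurable_fun (T := g_sigma_algebraType (past z)) setT tau ->
  measurable_fun (T := g_sigma_algebraType (past z)) setT sigma ->
  (forall w, 0 <= tau w <= sigma w) ->
  \int[P]_w (arrival_tail t a (ring_after (W z) (tau w) w) *
             arrival_tail t b (ring_after (W z) (sigma w) w)) +
  \int[P]_w (arrival_tail t b.+1 (tau w) * arrival_tail t a.+1 (sigma w)) =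
  \int[P]_w (arrival_tail t b (ring_after (W z) (tau w) w) *
             arrival_tail t a (ring_after (W z) (sigma w) w)) +
  \int[P]_w (arrival_tail t a.+1 (tau w) * arrival_tail t b.+1 (sigma w)).
Proof.
move=> mt ms ts.
pose f a b (p : g_sigma_algebraType (past z) * g_sigma_algebraType (edge z)) :=
  arrival_tail t a (ring_after (W z) (tau p.1) p.2) *
  arrival_tail t b (ring_after (W z) (sigma p.1) p.2).
have mf m n : measurable_fun setT (f m n).
  by apply: emeasurable_funM; exact: measurable_past_edge.
have f0 m n p : 0 <= f m n p by rewrite mule_ge0// arrival_tail_ge0.
have E m n : \int[P]_w f m n (w, w) = \int[P]_w \int[P]_v f m n (w, v).
  exact: integral_past_edge.
have mt' := measurable_fun_cylinders mt.
have ms' := measurable_fun_cylinders ms.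
(* The same function as [f], over the full sigma-algebra, where its partial integrals are
   measurable. *)
pose h m n (p : Omega * Omega) : \bar R :=
  arrival_tail t m (ring_after (W z) (tau p.1) p.2) *
  arrival_tail t n (ring_after (W z) (sigma p.1) p.2).
have mI m n : measurable_fun setT (fun w : Omega => \int[P]_v h m n (w, v)).
  have mh : measurable_fun setT (h m n).
    have mV i : measurable_fun setT (fun w => \sum_(l < i.+1) W z l w)%R.
      exact: measurable_sum.
    have mR (g : Omega -> \bar R) c : measurable_fun setT g -> measurable_fun setT
        (fun p : Omega * Omega => arrival_tail t c (ring_after (W z) (g p.1) p.2)).
      move=> mg; apply: (measurableT_comp (measurable_arrival_tail _ _)).
      have mp : measurable_fun setT (fun p : Omega * Omega => (g p.1, p.2)).
        by apply: measurable_fun_pair => //; exact: measurableT_comp.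
      exact: (measurableT_comp (measurable_next_after mV) mp).
    by apply: emeasurable_funM; exact: mR.
  exact: (@measurable_fun_fubini_tonelli_F _ _ _ _ _ P (h m n)).
have I0 m n w : 0 <= \int[P]_v h m n (w, v) by exact: integral_ge0.
have mH m n : measurable_fun setT
    (fun w => arrival_tail t m (tau w) * arrival_tail t n (sigma w)).
  by apply: emeasurable_funM; exact: (measurableT_comp (measurable_arrival_tail _ _)).
have H0 m n w : 0 <= arrival_tail t m (tau w) * arrival_tail t n (sigma w).
  by rewrite mule_ge0// arrival_tail_ge0.
have Eab : \int[P]_w h a b (w, w) = \int[P]_w \int[P]_v h a b (w, v) by exact: E.
have Eba : \int[P]_w h b a (w, w) = \int[P]_w \int[P]_v h b a (w, v) by exact: E.
rewrite -![X in X + _]/(\int[P]_w h _ _ (w, w)) Eab Eba.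
rewrite -[LHS]ge0_integralD//; try exact: mI; rewrite -[RHS]ge0_integralD//; try exact: mI;
  apply: eq_integral => w _.
have /andP[t0 tsw] := ts w.
exact: (arrival_tail_ring2 (clocks_indep z) (clocks_exp z) t a b t0 tsw).
Qed.

Lemma measurable_arrival_tail_arrival t a k n :
  measurable_fun setT (fun w => arrival_tail t a (arrival k n w)).
Proof.
exact: (measurableT_comp (measurable_arrival_tail _ _) (measurable_arrival _ _)).
Qed.

Let mpast k n : measurable_fun (T := g_sigma_algebraType (past (- k + n%:Z)))
  setT (arrival k n) := measurable_arrival_past (lexx _).

(** By [ring_step1] going back one site adds one jump to those still to be made, until the start at
    time 0. *)
Lemma integral_arrival_tail t a k n :
  \int[P]_w arrival_tail t a (arrival k n w) = (gamma_tail (a + n) t)%:E.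
Proof.
elim: n a => [|n IH] a.
  under eq_integral do rewrite /=.
  rewrite integral_cst// addn0 subr0.
  by rewrite [X in _ * X](_ : _ = 1) ?mule1//; exact: probability_setT.
rewrite addnS -addSn -IH.
have := ring_step1 t a (@mpast k n) (@measurable_cst _ _ _ _ setT 1) (arrival_ge0 k n) (fun=> lee01).
by under eq_integral do rewrite /= mul1e; under [in RHS]eq_integral do rewrite /= mul1e.
Qed.

Let integral_arrival_tail2_fin t (a b : nat) k l m n :
  \int[P]_w (arrival_tail t a (arrival k m w) * arrival_tail t b (arrival l n w))
    \is a fin_num.
Proof.
rewrite ge0_fin_numE; last first.
  by apply: integral_ge0 => w _; rewrite mule_ge0// arrival_tail_ge0.
have := ltry (gamma_tail (a + m) t); rewrite -(integral_arrival_tail t a k m).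
apply: le_lt_trans; apply: ge0_le_integral => //.
- by move=> w _; rewrite mule_ge0// arrival_tail_ge0.
- by apply: emeasurable_funM; exact: measurable_arrival_tail_arrival.
- exact: measurable_arrival_tail_arrival.
- move=> w _; rewrite -[leRHS]mule1 lee_pmul ?arrival_tail_ge0//.
  by case: (arrival l n w) => [r| |]//=; rewrite lee_fin gamma_tail_le1.
Qed.

(* By [ring_step2] the antisymmetric part in [(a, b)] for the walk at [n.+1] is
   that in [(a.+1, b.+1)] for the walk at [n]. *)
Lemma integral_arrival_tail2 t (a b : nat) k m n :
  \int[P]_w (arrival_tail t a (arrival k n w) *
             arrival_tail t b (arrival (k + m%:Z) (m + n) w)) +
    (gamma_tail (b + n) t * gamma_tail (a + n + m) t)%:E =
  \int[P]_w (arrival_tail t b (arrival k n w) *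
             arrival_tail t a (arrival (k + m%:Z) (m + n) w)) +
    (gamma_tail (a + n) t * gamma_tail (b + n + m) t)%:E.
Proof.
elim: n a b => [|n IH] a b.
  (* The k-leader is at its starting site at the constant time 0, so the expectation factors. *)
  have E i j : \int[P]_w (arrival_tail t i (arrival k 0 w) *
      arrival_tail t j (arrival (k + m%:Z) (m + 0) w)) = (gamma_tail i t * gamma_tail (j + m) t)%:E.
    under eq_integral do rewrite /= subr0.
    rewrite addn0 ge0_integralZl//.
    - by rewrite integral_arrival_tail EFinM.
    - exact: measurable_arrival_tail_arrival.
    - by move=> w _; exact: arrival_tail_ge0.
    - by rewrite lee_fin gamma_tail_ge0.
  by rewrite !E !addn0 addeC.
have e : (- (k + m%:Z) + (m + n)%N%:Z = - k + n%:Z)%R by rewrite PoszD; ring.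
have ms : measurable_fun (T := g_sigma_algebraType (past (- k + n%:Z)))
    setT (arrival (k + m%:Z) (m + n)) by rewrite -e; exact: mpast.
have ts w : 0 <= arrival k n w <= arrival (k + m%:Z) (m + n) w.
  by rewrite arrival_ge0 le_arrival.
have step := ring_step2 t a b (@mpast k n) ms ts.
have {IH} := IH a.+1 b.+1; rewrite !addSn => IH.
rewrite !addnS addSn.
(* Finiteness of the four expectations permits the cancellation in the reals. *)
have := integral_arrival_tail2_fin t a b k (k + m%:Z) n.+1 (m + n).+1.
have := integral_arrival_tail2_fin t b a k (k + m%:Z) n.+1 (m + n).+1.
have := integral_arrival_tail2_fin t b.+1 a.+1 k (k + m%:Z) n (m + n).
have := integral_arrival_tail2_fin t a.+1 b.+1 k (k + m%:Z) n (m + n).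
move: step IH; rewrite [arrival k n.+1]/= [arrival _ (_ + n).+1]/= e.
move: (\int[P]_w _) (\int[P]_w _) (\int[P]_w _) (\int[P]_w _).
move=> [A| |] [B| |] [C| |] [D| |]//; rewrite -!EFinD => -[s1] [s2] _ _ _ _; congr (_%:E).
by apply: (addIr (C + D)%R); rewrite addrACA; lra.
Qed.

Let measurable_late t k n : measurable [set w | t%:E < arrival k n w].
Proof. exact: (measurable_set_lte (measurable_cst _) (measurable_arrival _ _)). Qed.

Lemma prob_arrival_gt t k n :
  P [set w | t%:E < arrival k n w] = (gamma_tail n t)%:E.
Proof.
rewrite -(integral_arrival_tail t 0 k n).
rewrite -[X in P X]setIT -integral_indic//.
by apply: eq_integral => w _; rewrite arrival_tail0// ?arrival_ge0.
Qed.

Lemma measurable_arrival_at t k n :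
  measurable [set w | arrival k n w <= t%:E < arrival k n.+1 w].
Proof.
rewrite (_ : [set w | _] = [set w | t%:E < arrival k n.+1 w] `\` [set w | t%:E < arrival k n w]).
  exact: measurableD.
apply/seteqP; split => w /= [].
  by move=> /andP[a b]; split => //; apply/negP; rewrite -leNgt.
by move=> b /negP; rewrite -leNgt => a; rewrite a.
Qed.

Lemma prob_arrival_at t k n : (0 <= t)%R ->
  P [set w | arrival k n w <= t%:E < arrival k n.+1 w] = (poisson_weight n t)%:E.
Proof.
move=> t0.
have -> : [set w | arrival k n w <= t%:E < arrival k n.+1 w] =
    [set w | t%:E < arrival k n.+1 w] `\` [set w | t%:E < arrival k n w].
  apply/seteqP; split => w /= [].
    by move=> /andP[a b]; split => //; apply/negP; rewrite -leNgt.
  by move=> b /negP; rewrite -leNgt => a; rewrite a.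
have sub : [set w | t%:E < arrival k n w] `<=` [set w | t%:E < arrival k n.+1 w].
  by move=> w /= tn; apply: lt_le_trans tn _; exact: next_after_ge.
rewrite measureD//; last by rewrite ltey_eq fin_num_measure.
rewrite setIC (setIidl sub).
have E m := prob_arrival_gt t k m.
rewrite [X in X - _]E [X in _ - X]E gamma_tailS// -EFinB addrAC subrr add0r //.
Qed.

(** Let tau and sigma be the two arrivals at - k + n. The event is C minus {t < tau}. Averaging over
    the edge clock gives P C = E[H_1(tau) H_0(sigma)]. In the exchanged expectation
    E[H_0(tau) H_1(sigma)] the event t < tau forces t < sigma, hence H_1(sigma) = 1, and the value
    is T_n. The case (a, b) = (1, 0) of [integral_arrival_tail2] relates the two. *)
Lemma prob_arrival_at_not_behind t k m n :
  P [set w | arrival k n w <= t%:E < arrival k n.+1 w /\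
             t%:E < arrival (k + m%:Z) (m + n) w] =
  (gamma_tail n.+1 t * gamma_tail (n + m) t - gamma_tail n t * gamma_tail (n + m).+1 t)%:E.
Proof.
set A := [set w | _]; pose B := [set w | t%:E < arrival k n w].
pose C := [set w | t%:E < arrival k n.+1 w] `&` [set w | t%:E < arrival (k + m%:Z) (m + n) w].
have BC : B `<=` C.
  move=> w /= tn; split; apply: lt_le_trans tn _; first exact: next_after_ge.
  exact: le_arrival.
have AE : A = C `\` B.
  apply/seteqP; split => w /=.
    by move=> [/andP[a b] c]; split; [split|apply/negP; rewrite -leNgt].
  by move=> [[b c] /negP]; rewrite -leNgt => a; split => //; exact/andP.
have mC : measurable C by exact: measurableI.
have PC : P C = \int[P]_w (arrival_tail t 1 (arrival k n w) *
    arrival_tail t 0 (arrival (k + m%:Z) (m + n) w)).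
  rewrite -[X in P X]setIT -integral_indic//.
  transitivity (\int[P]_w (arrival_tail t 0 (arrival (k + m%:Z) (m + n) w) *
      arrival_tail t 0 (ring_after (W (- k + n%:Z)) (arrival k n w) w))).
    apply: eq_integral => w _; rewrite -/(arrival k n.+1 w) !arrival_tail0 ?arrival_ge0//.
    by rewrite muleC -EFinM /C indicI.
  have e : (- (k + m%:Z) + (m + n)%N%:Z = - k + n%:Z)%R by rewrite PoszD; ring.
  rewrite (ring_step1 t 0 (@mpast k n) _ (arrival_ge0 k n))//.
  - by apply: eq_integral => w _; rewrite muleC.
  - by rewrite -e; exact: (measurableT_comp (measurable_arrival_tail _ _) (@mpast _ _)).
  - by move=> w; exact: arrival_tail_ge0.
have D : \int[P]_w (arrival_tail t 0 (arrival k n w) *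
    arrival_tail t 1 (arrival (k + m%:Z) (m + n) w)) = (gamma_tail n t)%:E.
  rewrite -(integral_arrival_tail t 0 k n); apply: eq_integral => w _.
  have [tn|nt] := ltP t%:E (arrival k n w).
    by rewrite [X in _ * X]arrival_tail_gt ?mule1// (lt_le_trans tn)// le_arrival.
  by rewrite arrival_tail0 ?arrival_ge0// indicE memNset ?mul0e//= ltNge nt.
have := integral_arrival_tail2 t 1 0 k m n.
rewrite -PC D add0n => H.
have mB : measurable B by exact: measurable_late.
have [c Pc] : exists c, P C = c%:E by exists (fine (P C)); rewrite fineK// fin_num_measure.
rewrite AE measureD//; last by rewrite ltey_eq fin_num_measure.
rewrite setIC (setIidl BC) [X in _ - X]prob_arrival_gt [X in X - _]Pc.
move: H; rewrite Pc -!EFinD => -[H].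
by congr (_%:E); rewrite !add1n addSn in H; lra.
Qed.
End arrival.

(** * Induction along continuous time *)

Section real_induction.
Context {R : realType}.
Implicit Types (Q : R -> Prop) (a b t : R).

Lemma near_right_ball Q t : (\forall s \near t^'+, Q s) ->
  exists2 e, 0 < e & forall s, t < s < t + e -> Q s.
Proof.
move=> /nbhs_ballP[e /= e0 He]; exists e => // s /andP[ts se]; apply: He => //=.
by rewrite /ball/= ltr0_norm ?subr_lt0// opprB ltrBlDl.
Qed.

Lemma near_left_ball Q t : (\forall s \near t^'-, Q s) ->
  exists2 e, 0 < e & forall s, t - e < s < t -> Q s.
Proof.
move=> /nbhs_ballP[e /= e0 He]; exists e => // s /andP[es st]; apply: He => //=.
by rewrite /ball/= gtr0_norm ?subr_gt0// ltrBlDl -ltrBlDr.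
Qed.

(** The supremum of the times up to which Q has held satisfies Q by the left condition, and by the
    right condition it cannot lie before a failure. *)
Lemma real_induction Q a b : Q a ->
  (forall t, a <= t -> Q t -> \forall s \near t^'+, Q s) ->
  (forall t, a < t < b -> (forall s, a <= s < t -> Q s) -> Q t) ->
  forall t, a <= t < b -> Q t.
Proof.
move=> Qa right left t0 /andP[at0 t0b]; apply: contrapT => nQ.
pose A := [set t | a <= t <= t0 /\ forall s, a <= s <= t -> Q s].
have Aa : A a.
  by split; [rewrite lexx|move=> s; rewrite -eq_le => /eqP <-].
have ubA : ubound A t0 by move=> t [/andP[]].
have supA : has_sup A by split; [exists a|exists t0].
set u := sup A.
have au : a <= u by apply: ub_le_sup => //; exists t0.
have ut0 : u <= t0 by apply: ge_sup => //; exists a.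
have Qlt s : a <= s < u -> Q s.
  move=> /andP[as_ su].
  have [t At st] : exists2 t, A t & s < t by apply: sup_gt => //; exists a.
  by apply: At.2; rewrite as_ ltW.
have Qu : Q u.
  move: au; rewrite le_eqVlt => /orP[/eqP <-//|au].
  by apply: left => //; rewrite au (le_lt_trans ut0).
have ut0' : u < t0.
  by rewrite lt_neqAle ut0 andbT; apply/eqP => ut; apply: nQ; rewrite -ut.
have [e e0 He] := near_right_ball (right _ au Qu).
pose v := Num.min (u + e / 2) t0.
have uv : u < v by rewrite lt_min ut0' ltrDl divr_gt0.
have : v <= u.
  apply: ub_le_sup; first by exists t0.
  split; first by rewrite (le_trans au (ltW uv))/= ge_min lexx orbT.
  move=> s /andP[as_ sv]; have [su|us|->//] := ltgtP s u; first by apply: Qlt; rewrite as_.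
  apply: He; rewrite us (le_lt_trans sv)// /v gt_min; apply/orP; left.
  by rewrite ltrD2l ltr_pdivrMr// mulr_natr mulr2n ltrDl.
by rewrite leNgt uv.
Qed.
End real_induction.

(** * The trajectory: leaders follow the arrival times *)

Section leader_path.
Context {d : measure_display} {Omega : measurableType d} {R : realType}.
Variable P : probability Omega R.
Variable W : int -> nat -> {RV P >-> R}.
Variable w : Omega.
Variable e : R -> int -> int.
Hypothesis gw : forall z, good_clock (W z) w.
Hypothesis unbounded : forall k (t : R), exists n, (t%:E < arrival W k n w)%E.
Hypothesis e0 : e 0 = fun y => - y.
Hypothesis path_e : tasep_path (rings W w) e.

(** The type at z is constant just before and just after any time, so only the update at that time
    has to preserve p. *)
Let site_induction (p : int -> Prop) (z : int) a b : 0 <= a -> p (e a z) ->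
  (forall t (xi : int -> int), a < t < b ->
    (forall x, \forall s \near t^'-, e s x = xi x) ->
    (forall x, rings W w x t -> e t x = ring_update xi x x /\
       e t (x + 1) = ring_update xi x (x + 1)) ->
    (forall x, ~ rings W w (x - 1) t -> ~ rings W w x t -> e t x = xi x) ->
    p (xi z) -> p (e t z)) ->
  forall t, a <= t < b -> p (e t z).
Proof.
move=> a0 pa step; apply: real_induction => // [t at_ pt|t /andP[at_ tb] H].
  have := path_e.1 t z (le_trans a0 at_); apply: filterS => s ->; exact: pt.
have [xi [L J N]] := path_e.2 t (le_lt_trans a0 at_).
apply: (step t xi) => //; first by rewrite at_.
have [r r0 Hr] := near_left_ball (L z).
pose s := Num.max a (t - r / 2).
have st : s < t by rewrite gt_max at_ ltrBlDr ltrDl divr_gt0.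
rewrite -(Hr s); first by apply: H; rewrite st le_max lexx.
by rewrite st andbT lt_max; apply/orP; right; lra.
Qed.

Let left_limit (p : int -> Prop) (z : int) a b v : a < b ->
  (forall t, a <= t < b -> p (e t z)) ->
  (\forall s \near b^'-, e s z = v) -> p v.
Proof.
move=> ab H /near_left_ball[r r0 Hr].
pose s := Num.max a (b - r / 2).
have sb : s < b by rewrite gt_max ab ltrBlDr ltrDl divr_gt0.
rewrite -(Hr s); first by apply: H; rewrite sb le_max lexx.
by rewrite sb andbT lt_max; apply/orP; right; lra.
Qed.

Lemma ring_update_l xi x : ring_update xi x x = Num.min (xi x) (xi (x + 1)).
Proof. by rewrite /ring_update eqxx; case: ltP. Qed.

Lemma ring_update_r xi x : ring_update xi x (x + 1) = Num.max (xi x) (xi (x + 1)).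
Proof.
have xx : (x + 1 == x) = false by lia.
by rewrite /ring_update eqxx xx; case: ltP.
Qed.

Lemma arrival_fin k n : exists2 a : R, 0 <= a & arrival W k n w = a%:E.
Proof.
elim: n => [|n [a a0 IH]]; first by exists 0.
have [gn gu] := (good_clock_nd (gw (- k + n%:Z)), (gw (- k + n%:Z)).2).
have [m am E] := next_after_attained gn gu (ltry a).
exists (\sum_(i < m.+1) W (- k + n%:Z) i w).
  by apply: (le_trans a0); rewrite -lee_fin ltW.
by rewrite /= IH.
Qed.

Lemma arrival_lt k n : (arrival W k n w < arrival W k n.+1 w)%E.
Proof.
have [a a0 E] := arrival_fin k n; rewrite /= E.
by apply: next_after_gt; [exact: good_clock_nd|exact: (gw _).2|exact: ltry].
Qed.

Let front (k : int) (n : nat) (t : R) :=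
  k <= e t (- k + n%:Z) /\ forall z : int, - k + n%:Z < z -> e t z < k.

(* Between two jumps of the leader its site receives types from behind only,
   and the sites in front of it exchange types among themselves only. *)
Let front_const k n (a b : R) : 0 <= a -> front k n a ->
  (forall t, a < t < b -> ~ rings W w (- k + n%:Z) t) ->
  forall t, a <= t < b -> front k n t.
Proof.
set x := - k + n%:Z => a0 [ea fa] nr.
have H0 : forall t, a <= t < b -> k <= e t x.
  apply: (site_induction (p := fun i => k <= i)) => // t xi tab L J N kx.
  have [rx|rx] := pselect (rings W w (x - 1) t); last by rewrite N//; exact: nr.
  by have [_] := J _ rx; rewrite ring_update_r subrK => ->; rewrite le_max kx orbT.
(* Outward from x: only the left neighbour can raise the type of a site. That neighbour is x itself
   for j = 0, across a silent edge, and a site already known to stay below k afterwards. *)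
have H j : forall t, a <= t < b -> e t (x + j.+1%:Z) < k.
  elim: j => [|j IH].
    apply: (site_induction (p := fun i => i < k)) => //; first by apply: fa; lia.
    move=> t xi tab L J N xk.
    have [rx|rx] := pselect (rings W w (x + 1) t).
      by have [-> _] := J _ rx; rewrite ring_update_l gt_min xk.
    by rewrite N// addrK; exact: nr.
  apply: (site_induction (p := fun i => i < k)) => //; first by apply: fa; lia.
  move=> t xi tab L J N xk; have /andP[at_ tb] := tab.
  have [rx|rx] := pselect (rings W w (x + j.+2%:Z) t).
    by have [-> _] := J _ rx; rewrite ring_update_l gt_min xk.
  have ej : x + j.+2%:Z = x + j.+1%:Z + 1 by lia.
  have [ry|ry] := pselect (rings W w (x + j.+1%:Z) t); last first.
    by rewrite N// ej addrK.
  have [_] := J _ ry; rewrite -ej => ->; rewrite ej ring_update_r gt_max -ej xk andbT.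
  apply: (left_limit (p := fun i => i < k) at_ _ (L (x + j.+1%:Z))) => s /andP[as_ st].
  by apply: IH; rewrite as_ (lt_trans st).
move=> t tab; split; first exact: H0.
move=> z xz; have -> : z = x + (absz (z - x - 1)%R).+1%:Z by lia.
exact: H.
Qed.

(** Just before the jump all types beyond x are below k. The ring of the edge x puts the larger of
    the types at x and x + 1 on x + 1, hence one that is at least k, and sites further out can only
    receive types from beyond x. *)
Let front_arrival k n a : arrival W k n w = a%:E -> front k n a.
Proof.
elim: n a => [|n IH] a.
  by move=> [<-]; rewrite /front e0 addr0 opprK; split => // z; lia.
have [b b0 E] := arrival_fin k n.
set x := - k + n%:Z => Ea.
have ba : b < a by rewrite -lte_fin -E -Ea; exact: arrival_lt.
have nr t : b < t < a -> ~ rings W w x t.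
  move=> /andP[bt ta] [m tE]; move: ta; rewrite ltNge => /negP; apply.
  by rewrite -lee_fin -Ea /= E tE; apply: next_after_le; rewrite -tE lte_fin.
have F : forall t, b <= t < a -> front k n t by apply: front_const => //; exact: IH.
have [xi [L J N]] := path_e.2 a (le_lt_trans b0 ba).
have kx : k <= xi x.
  by apply: (left_limit (p := fun i => k <= i) ba _ (L x)) => t /F[].
have xk z : x < z -> xi z < k.
  move=> xz; apply: (left_limit (p := fun i => i < k) ba _ (L z)) => t /F[_]; exact.
have rx : rings W w x a.
  have gn := good_clock_nd (gw x).
  have [m _ Em] := next_after_attained gn (gw x).2 (ltry b).
  by exists m; move: Ea; rewrite /= E /ring_after Em => -[].
have ex : - k + n.+1%:Z = x + 1 by rewrite /x; lia.
rewrite /front ex; split.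
  by have [_ ->] := J _ rx; rewrite ring_update_r le_max kx.
move=> z xz.
have [rz|rz] := pselect (rings W w z a).
  by have [-> _] := J _ rz; rewrite ring_update_l gt_min xk//; lia.
have [ry|ry] := pselect (rings W w (z - 1) a); last by rewrite N// xk//; lia.
have [_] := J _ ry; rewrite ring_update_r subrK => ->.
by rewrite gt_max !xk//; lia.
Qed.

Let arrival_interval k n t : (arrival W k n w <= t%:E < arrival W k n.+1 w)%E -> front k n t.
Proof.
move=> /andP[nt tn].
have [a a0 Ea] := arrival_fin k n; have [b b0 Eb] := arrival_fin k n.+1.
apply: (front_const a0 (front_arrival Ea) (b := b)).
  move=> s /andP[as_ sb] [m sE]; move: sb; rewrite ltNge => /negP; apply.
  by rewrite -lee_fin -Eb /= Ea sE; apply: next_after_le; rewrite -sE lte_fin.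
by rewrite -!lee_fin -!lte_fin -Ea -Eb nt.
Qed.

Lemma arrival_nd k : {homo (fun n => arrival W k n w) : m n / (m <= n)%N >-> (m <= n)%E}.
Proof.
by apply: homo_leq => [n|? ? ?|n]; [exact: lexx|exact: le_trans|exact/ltW/arrival_lt].
Qed.

Let exists_interval k t : 0 <= t -> exists n, (arrival W k n w <= t%:E < arrival W k n.+1 w)%E.
Proof.
move=> t0; have ex := unbounded k t.
case: (ex_minnP ex) => -[|n] tn nmin; first by move: tn; rewrite /= lte_fin ltNge t0.
by exists n; rewrite tn andbT leNgt; apply/negP => /nmin; rewrite ltnn.
Qed.

Let leaderE k n t : (arrival W k n w <= t%:E < arrival W k n.+1 w)%E ->
  leader_position k (e t) = - k + n%:Z /\ leader_type k (e t) = e t (- k + n%:Z).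
Proof.
move=> /arrival_interval[kx xk].
have L : is_leader k (e t) (e t (- k + n%:Z)) (- k + n%:Z).
  split => // z y kz ez; rewrite leNgt; apply/negP => /xk; rewrite ez; lia.
have uniq i x : is_leader k (e t) i x -> x = - k + n%:Z.
  move=> [ki xi H]; apply/eqP; rewrite eq_le (H _ _ kx erefl) andbT leNgt; apply/negP => /xk.
  by rewrite xi; lia.
split; apply: xget_unique.
- by exists (e t (- k + n%:Z)).
- by move=> y [i /uniq].
- by exists (- k + n%:Z).
- by move=> i [x L']; have [_ <- _] := L'; rewrite (uniq _ _ L').
Qed.

Lemma leader_position_arrival k n t : 0 <= t ->
  leader_position k (e t) = - k + n%:Z <->
  (arrival W k n w <= t%:E < arrival W k n.+1 w)%E.
Proof.
move=> t0; split=> [|/leaderE[]//].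
have [m mt] := exists_interval k t0; have [-> _] := leaderE mt.
by move=> E; have <- : m = n by lia.
Qed.

(** A type at least k + m at this site means that the (k + m)-leader is there or beyond, hence has
    arrived. Conversely, if it has arrived, it is still there: by [le_arrival] it leaves no earlier
    than the k-leader, so both leaders are the same particle. *)
Lemma leader_type_arrival k (m n : nat) t : 0 <= t ->
  leader_position k (e t) = - k + n%:Z ->
  leader_type k (e t) < k + m%:Z <->
  (t%:E < arrival W (k + m%:Z) (m + n) w)%E.
Proof.
move=> t0 /(leader_position_arrival _ _ t0) nt; have [_ ->] := leaderE nt.
have ex : - k + n%:Z = - (k + m%:Z) + (m + n)%N%:Z by rewrite PoszD; lia.
have [tl|lt] := ltP t%:E (arrival W (k + m%:Z) (m + n) w); split => //.
- move=> _; rewrite ltNge; apply/negP => le_l.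
  have [n' n't] := exists_interval (k + m%:Z) t0.
  have [_ fr] := arrival_interval n't.
  have mn : (m + n <= n')%N.
    by rewrite leqNgt; apply/negP => lt'; have := fr (- k + n%:Z); lia.
  move: tl; rewrite ltNge => /negP; apply; apply: le_trans (arrival_nd _ mn) _.
  by have /andP[] := n't.
- move=> le_l; have : (arrival W (k + m%:Z) (m + n) w <= t%:E < arrival W (k + m%:Z) (m + n).+1 w)%E.
    rewrite lt/=; have /andP[_ tn] := nt; apply: (lt_le_trans tn).
    by have := le_arrival W k m n.+1 w; rewrite addnS.
  by move=> /arrival_interval[]; rewrite -ex; lia.
Qed.
End leader_path.

(** * Joint law of the position and the type of the leader *)

Section leader_law.
Context {d : measure_display} {Omega : measurableType d} {R : realType}.
Variable P : probability Omega R.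

Lemma measurable_foralln (F : nat -> Omega -> Prop) :
  (forall n, measurable [set w | F n w]) -> measurable [set w | forall n, F n w].
Proof.
move=> mF; rewrite (_ : [set w | _] = \bigcap_n [set w | F n w]); last first.
  by apply/seteqP; split => w /= H; [move=> n _; exact: H|move=> n; exact: H].
exact: bigcapT_measurable.
Qed.

Lemma measurable_forall_int (F : int -> Omega -> Prop) :
  (forall i, measurable [set w | F i w]) -> measurable [set w | forall i, F i w].
Proof.
move=> mF; rewrite (_ : [set w | _] =
    [set w | forall n, F (odflt 0 (unpickle n)) w]); last first.
  apply/seteqP; split => w /= H; first by move=> n; exact: H.
  by move=> i; have := H (pickle i); rewrite pickleK.
exact: measurable_foralln.
Qed.

Lemma measurable_exists_int (F : int -> Omega -> Prop) :
  (forall i, measurable [set w | F i w]) -> measurable [set w | exists i, F i w].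
Proof.
move=> mF; rewrite (_ : [set w | _] = ~` [set w | forall i, ~ F i w]); last first.
  apply/seteqP; split => w /=; first by move=> [i Fi] /(_ i).
  by move=> /existsNP[i /contrapT]; exists i.
apply: measurableC; apply: measurable_forall_int => i.
exact: (measurableC (mF i)).
Qed.

Lemma measurable_const_prop (Q : Prop) : measurable [set w : Omega | Q].
Proof.
have [q|nq] := pselect Q.
  by rewrite (_ : [set w | _] = setT)//; apply/seteqP; split => w.
by rewrite (_ : [set w | _] = set0)//; apply/seteqP; split => w.
Qed.

Lemma measurable_imp (Q : Prop) (F : Omega -> Prop) :
  measurable [set w | F w] -> measurable [set w | Q -> F w].
Proof.
move=> mF; have [q|nq] := pselect Q.
  by rewrite (_ : [set w | _] = [set w | F w])//; apply/seteqP; split => w //= /(_ q).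
by rewrite (_ : [set w | _] = setT)//; apply/seteqP; split => w //= _ /nq.
Qed.

Lemma probability_ae_eq (A B : set Omega) : measurable A -> measurable B ->
  {ae P, forall w, A w <-> B w} -> P A = P B.
Proof.
move=> mA mB AB.
rewrite -[X in P X]setIT -[X in _ = P X]setIT -!integral_indic//.
apply: ge0_ae_eq_integral => //.
- by apply/measurable_EFinP; exact: measurable_indic.
- by apply/measurable_EFinP; exact: measurable_indic.
- apply: filterS AB => w AB _; congr (_%:E); rewrite !indicE; congr (_%:R); congr nat_of_bool.
  by apply/idP/idP; rewrite !inE => /AB.
Qed.

Section measurability.
Variable e : Omega -> int -> int.
Hypothesis me : forall x i, measurable [set w | e w x = i].
Variable k : int.

Lemma measurable_is_leader i x : measurable [set w | is_leader k (e w) i x].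
Proof.
rewrite (_ : [set w | _] = [set w | k <= i] `&` [set w | e w x = i] `&`
    [set w | forall z y, k <= z -> ~ y <= x -> ~ e w y = z]); last first.
  apply/seteqP; split => w /=.
    by move=> [ki xi H]; split => // z y kz yx yz; apply: yx; exact: H yz.
  by move=> [[ki xi] H]; split => // z y kz yz; apply: contrapT => yx; exact: H yz.
apply: measurableI; first apply: measurableI => //.
  exact: measurable_const_prop.
do 2 (apply: measurable_forall_int => ?); do 2 apply: measurable_imp.
exact: (measurableC (me _ _)).
Qed.

Lemma is_leader_unique (eta : int -> int) i x j y :
  is_leader k eta i x -> is_leader k eta j y -> x = y /\ i = j.
Proof.
move=> [ki xi H] [kj yj G]; have xy : x = y by have := H _ _ kj yj; have := G _ _ ki xi; lia.
by split => //; rewrite -xi -yj xy.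
Qed.

Let measurable_no_leader : measurable [set w | ~ exists i x, is_leader k (e w) i x].
Proof.
apply: (@measurableC _ _ [set w | exists i x, is_leader k (e w) i x]);
  do 2 (apply: measurable_exists_int => ?); exact: measurable_is_leader.
Qed.

(** Splits on the existence of a leader; without one, [xget] returns its default value 0. *)
Lemma measurable_leader_position y : measurable [set w | leader_position k (e w) = y].
Proof.
rewrite (_ : [set w | _] = [set w | exists i, is_leader k (e w) i y] `|`
    [set w | (0%:Z = y) /\ ~ exists i x, is_leader k (e w) i x]); last first.
  apply/seteqP; split => w /=.
    rewrite /leader_position; case: xgetP => [x -> [i Li] <-|NL <-].
      by left; exists i.
    by right; split => // -[i [x Li]]; apply: (NL x); exists i.
  move=> [[i Li]|[<- NL]]; rewrite /leader_position.
    by apply: xget_unique; [exists i|move=> z [j Lj]; have [] := is_leader_unique Lj Li].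
  by apply: xgetPN => x [i Li]; apply: NL; exists i, x.
apply: measurableU; first by apply: measurable_exists_int => ?; exact: measurable_is_leader.
apply: (measurableI _ _ (measurable_const_prop _)); exact: measurable_no_leader.
Qed.

Lemma measurable_leader_type i : measurable [set w | leader_type k (e w) = i].
Proof.
rewrite (_ : [set w | _] = [set w | exists x, is_leader k (e w) i x] `|`
    [set w | k = i /\ ~ exists i x, is_leader k (e w) i x]); last first.
  apply/seteqP; split => w /=.
    rewrite /leader_type; case: xgetP => [j -> [x Lx] <-|NL <-].
      by left; exists x.
    by right; split => // -[j [x Li]]; apply: (NL j); exists x.
  move=> [[x Lx]|[<- NL]]; rewrite /leader_type.
    by apply: xget_unique; [exists x|move=> j [z Lz]; have [] := is_leader_unique Lz Lx].
  by apply: xgetPN => j [x Li]; apply: NL; exists j, x.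
apply: measurableU; first by apply: measurable_exists_int => ?; exact: measurable_is_leader.
apply: (measurableI _ _ (measurable_const_prop _)); exact: measurable_no_leader.
Qed.

(** Holds for every state, also without a leader, because the default value is k. *)
Lemma le_leader_type (eta : int -> int) : k <= leader_type k eta.
Proof. by rewrite /leader_type; case: xgetP => [i -> [x []]|]. Qed.
End measurability.

Variable W : int -> nat -> {RV P >-> R}.
Variable eta : R -> Omega -> int -> int.
Hypothesis tasep : multitype_TASEP W (fun y : int => - y) eta.

Lemma first_ring_le (z : int) s w : good_clock (W z) w ->
  ((W z 0%N w)%:E <= ring_after (W z) s w)%E.
Proof.
move=> gz; apply: le_ereal_inf_tmp => _ [n _ <-]; case: ifP => [_|_]; last exact: leey.
by have := good_clock_nd gz (leq0n n); rewrite big_ord1 lee_fin.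
Qed.

(** The arrival after a jump is no earlier than the first ring of the edge crossed, and the first
    waiting times of successive edges are independent exponentials, hence unbounded. *)
Lemma arrival_unbounded_ae :
  {ae P, forall w, forall k (t : R), exists n, (t%:E < arrival W k n w)%E}.
Proof.
have [HW _ _ _] := tasep.
have H : {ae P, forall w, forall p q : nat,
    exists n, q%:R < W (- (odflt 0 (unpickle p)) + n%:Z) 0%N w}.
  apply: ae_foralln => p; apply: ae_foralln => q; set k := odflt _ _.
  pose V n := W (- k + n%:Z) 0%N.
  have Vi : mutually_independent V.
    apply: (mutually_independent_inj (X := fun j : int * nat => W j.1 j.2)
      (f := fun n : nat => (- k + n%:Z, 0%N))) HW.1 => m n [].
    lia.
  exists (\bigcap_n [set w | V n w <= q%:R]); split.
  - by apply: bigcapT_measurable => n; exact: measurable_set_le.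
  - exact: (exponential_seq_unbounded Vi (fun n => HW.2 _ _)).
  - move=> w /= N n _ /=; rewrite leNgt; apply/negP => qn; apply: N; by exists n.
apply: filterS2 H (good_clocks_ae HW) => w H gw k t.
have [n] := H (pickle k) (Num.truncn t).+1; rewrite pickleK/= => tn.
exists n.+1; apply: lt_le_trans (first_ring_le _ (gw _)); rewrite lte_fin.
exact: lt_trans (truncnS_gt t) tn.
Qed.

Lemma leader_arrival_ae (t : R) : 0 <= t ->
  {ae P, forall w, forall k n,
   (leader_position k (eta t w) = - k + n%:Z <->
    (arrival W k n w <= t%:E < arrival W k n.+1 w)%E) /\
   (leader_position k (eta t w) = - k + n%:Z -> forall m : nat,
    leader_type k (eta t w) < k + m%:Z <->
    (t%:E < arrival W (k + m%:Z) (m + n) w)%E)}.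
Proof.
move=> t0; have [HW _ eta0 etaP] := tasep.
have G : {ae P, forall w, eta 0 w = (fun y => - y) /\ tasep_path (rings W w) (eta ^~ w)}.
  by apply: filterS2 eta0 etaP => w; split.
apply: filterS3 G (good_clocks_ae HW) arrival_unbounded_ae => w [e0 pe] gw ub k n.
have H := leader_position_arrival gw ub e0 pe.
split; first exact: H.
by move=> Ln m; apply: (leader_type_arrival gw ub e0 pe).
Qed.

Lemma prob_leader_position (t : R) k n : 0 <= t ->
  P [set w | leader_position k (eta t w) = - k + n%:Z] = (poisson_weight n t)%:E.
Proof.
move=> t0; have [HW me _ _] := tasep.
rewrite -(prob_arrival_at HW k n t0); apply: probability_ae_eq.
- by apply: measurable_leader_position => y i; exact: me.
- exact: measurable_arrival_at.
- by apply: filterS (leader_arrival_ae t0) => w /(_ k n)[].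
Qed.

Lemma prob_leader_type (t : R) k (m n : nat) : 0 <= t ->
  P ([set w | leader_type k (eta t w) < k + m%:Z] `&`
     [set w | leader_position k (eta t w) = - k + n%:Z]) =
  (poisson_weight n t * gamma_tail (n + m) t - gamma_tail n t * poisson_weight (n + m) t)%:E.
Proof.
move=> t0; have [HW me _ _] := tasep.
have mp : measurable [set w | leader_position k (eta t w) = - k + n%:Z].
  by apply: measurable_leader_position => y i; exact: me.
have ml : measurable [set w | leader_type k (eta t w) < k + m%:Z].
  rewrite (_ : [set w | _] = [set w | exists i : int, i < k + m%:Z /\ leader_type k (eta t w) =
    i]); last first.
    by apply/seteqP; split => w /= => [lt|[i [? ->]]]//; exists (leader_type k (eta t w)).
  apply: measurable_exists_int => i; apply: (measurableI _ _ (measurable_const_prop _)).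
  by apply: measurable_leader_type => y j; exact: me.
have ma : measurable [set w | (t%:E < arrival W (k + m%:Z) (m + n) w)%E].
  exact: (measurable_set_lte (measurable_cst _) (measurable_arrival W _ _)).
transitivity (P [set w | (arrival W k n w <= t%:E < arrival W k n.+1 w)%E /\
             (t%:E < arrival W (k + m%:Z) (m + n) w)%E]).
  apply: probability_ae_eq.
  - exact: measurableI.
  - by apply: measurableI => //; exact: measurable_arrival_at.
  - apply: filterS (leader_arrival_ae t0) => w /(_ k n)[Hp Ht]; split => /=.
      by move=> [lt Lp]; split; [exact/Hp|exact/Ht].
    by move=> [/Hp Lp lt]; split => //; exact/Ht.
(* Inserting T_(i+1) = T_i + p_i for i = n and i = n + m cancels the products T_n T_(n+m). *)
rewrite prob_arrival_at_not_behind// !gamma_tailS//; congr (_%:E); ring.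
Qed.
End leader_law.

Lemma floor_bounds (R : realType) (r : R) : (Num.floor r)%:~R <= r < (Num.floor r)%:~R + 1.
Proof.
rewrite -floor_ge_int lexx/= ltNge.
have -> : (Num.floor r)%:~R + 1 = (Num.floor r + 1)%:~R :> R by rewrite intrD.
by rewrite -floor_ge_int -ltNge ltrDl.
Qed.

(** * The conditional law and its limit *)

Section conditional.
Context {d : measure_display} {Omega : measurableType d} {R : realType}.
Variable P : probability Omega R.
Variable W : int -> nat -> {RV P >-> R}.
Variable eta : R -> Omega -> int -> int.
Hypothesis tasep : multitype_TASEP W (fun y : int => - y) eta.

Let conditional (t : R) k y := conditional_law P
  (fun w => (leader_type k (eta t w) - k)%:~R / Num.sqrt t)
  [set w | leader_position k (eta t w) = y].

Lemma conditional_leader_type_lt0 (t : R) k y a : a < 0 ->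
  conditional t k y `]-oo, a]%classic = 0%E.
Proof.
move=> a0; rewrite /conditional /conditional_law.
rewrite (_ : _ @^-1` _ = set0) ?set0I ?measure0 ?mul0e//.
apply/seteqP; split => // w /=; rewrite in_itv/= leNgt => /negP; apply.
apply: (lt_le_trans a0); rewrite divr_ge0// ?sqrtr_ge0// ler0z subr_ge0.
exact: le_leader_type.
Qed.

(** The integer L1 - k is at most a sqrt t exactly when it is less than the floor of a sqrt t plus
    1; this is the successor in M. *)
Lemma conditional_leader_type (t : R) k (n : nat) a : 0 < t -> 0 <= a ->
  let M := (n + `|Num.floor (a * Num.sqrt t)|.+1)%N in
  conditional t k (- k + n%:Z) `]-oo, a]%classic =
  (gamma_tail M t - gamma_tail n t * (poisson_weight M t / poisson_weight n t))%:E.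
Proof.
move=> t0 a0 M; rewrite /conditional /conditional_law.
set m := `|Num.floor (a * Num.sqrt t)|.+1%N in M *.
have st : 0 < Num.sqrt t by rewrite sqrtr_gt0.
have w0 : 0 < poisson_weight n t.
  by rewrite !mulr_gt0 ?invr_gt0 ?expR_gt0 ?exprn_gt0// ltr0n fact_gt0.
have -> : (fun w => (leader_type k (eta t w) - k)%:~R / Num.sqrt t) @^-1` `]-oo, a] =
    [set w | leader_type k (eta t w) < k + m%:Z].
  have f0 : 0 <= Num.floor (a * Num.sqrt t) by rewrite floor_ge0 mulr_ge0// ltW.
  have -> : m%:Z = Num.floor (a * Num.sqrt t) + 1 by rewrite /m -addn1 PoszD gez0_abs.
  by apply/seteqP; split => w /=;
    rewrite in_itv/= ler_pdivrMr// -floor_ge_int addrA ltzD1 lerBlDl.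
rewrite [X in (X / _)%E](prob_leader_type tasep k m n (ltW t0)).
rewrite [X in (_ / X)%E](prob_leader_position tasep k n (ltW t0)).
rewrite inver gt_eqF// -EFinM; congr (_%:E).
by rewrite -/M; field; rewrite gt_eqF.
Qed.
End conditional.

Theorem theorem5p2 (R : realType) (d : measure_display)
    (Omega : measurableType d) (P : probability Omega R)
    (W : int -> nat -> {RV P >-> R}) (eta : R -> Omega -> int -> int)
    (k : int) (x : R) :
  multitype_TASEP W (fun y : int => - y) eta ->
  let L1 (t : R) (w : Omega) : int := leader_type k (eta t w) in
  let X1 (t : R) (w : Omega) : int := leader_position k (eta t w) in
  probability_density (limit_density x) /\
  converges_in_distribution
    (fun t : R =>
       conditional_law P (fun w => (L1 t w - k)%:~R / Num.sqrt t)
         [set w | X1 t w = Num.floor (t + x * Num.sqrt t)])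
    (law_with_density (limit_density x)).
Proof.
move=> tasep L1 X1; split; first exact: limit_density_probability.
move=> a _; rewrite law_limit_density_itv.
case: ifPn => [a0|]; last first.
  rewrite -ltNge => a0.
  rewrite [X in X @ _ --> _](_ : _ = cst 0%E); first exact: cvg_cst.
  by apply/funext => t; exact: conditional_leader_type_lt0.
pose y t := Num.floor (t + x * Num.sqrt t).
pose f t := Num.floor (a * Num.sqrt t).
(* The k-leader starts at - k, so it is at y t after k + y t jumps; for large t this number is
   non-negative and the absolute value disappears. *)
pose j t := absz (k + y t).
pose M t := (j t + `|f t|.+1)%N.
have f0 t : 0 <= f t by rewrite floor_ge0 mulr_ge0// sqrtr_ge0.
have jE : \forall t \near +oo, (j t)%:Z = k + y t.
  (* For s = sqrt t >= B: t + x s >= s (s - |x|) >= s (|k| + 1) >= - k. *)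
  pose B : R := `|x| + `|k%:~R| + 1.
  near=> t.
  have B0 : 0 <= B by rewrite !addr_ge0.
  have Bt2 : B ^+ 2 <= t by near: t; apply: nbhs_pinfty_ge; exact: num_real.
  have Bt : B <= Num.sqrt t by rewrite -(ger0_norm B0) -sqrtr_sqr ler_wsqrtr.
  have t0 : 0 <= t by near: t; apply: nbhs_pinfty_ge; exact: num_real.
  rewrite /j gez0_abs// -lerBlDl sub0r floor_ge_int mulrNz.
  have := ler_norm (- x); have := ler_norm (- k%:~R : R); rewrite !normrN => k1 x1.
  have st := sqr_sqrtr t0.
  move: Bt; rewrite /B => Bt.
  have n1 := normr_ge0 x; have n2 := normr_ge0 (k%:~R : R).
  set s := Num.sqrt t in st Bt *; set nx := `|x| in n1 x1 Bt *; set nk := `|_| in n2 k1 Bt *.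
  have h1 : 0 <= s * (s - nx - nk - 1) by apply: mulr_ge0; lra.
  have h2 : 0 <= (nx + x) * s by apply: mulr_ge0; lra.
  have h3 : 0 <= (s - 1) * (nk + 1) by apply: mulr_ge0; lra.
  by rewrite -st; nra.
(* The shift by k, at most two floors and the added 1 stay within this constant. *)
have MB : \forall t \near +oo, `|(j t)%:R - (t + x * Num.sqrt t)| <= `|k%:~R| + 3
    /\ `|(M t)%:R - (t + (x + a) * Num.sqrt t)| <= `|k%:~R| + 3 :> R.
  near=> t.
  have jZ : (j t)%:Z = k + y t by near: t; exact: jE.
  have jR : (j t)%:R = k%:~R + (y t)%:~R :> R by rewrite -intrD -jZ.
  have MR : (M t)%:R = k%:~R + (y t)%:~R + ((f t)%:~R + 1) :> R.
    by rewrite /M natrD jR -natr1 -[in RHS](gez0_abs (f0 t)).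
  have /andP[y1 y2] := floor_bounds (t + x * Num.sqrt t).
  have /andP[f1 f2] := floor_bounds (a * Num.sqrt t).
  rewrite -/(y t) in y1 y2; rewrite -/(f t) in f1 f2.
  have k1 := ler_norm (k%:~R : R).
  have := ler_norm (- k%:~R : R); rewrite normrN => k2.
  rewrite MR jR mulrDl.
  by split; rewrite ler_norml; apply/andP; split; lra.
apply: (@cvg_trans _ ((gamma_tail (M t) t - gamma_tail (j t) t *
    (poisson_weight (M t) t / poisson_weight (j t) t))%:E @[t --> +oo])); last first.
  apply: cvg_EFin; first exact: nearW.
  by apply: (limit_cdf_cvg (j := j) (M := M) (K := `|k%:~R| + 3)); apply: filterS MB => t [].
apply: near_eq_cvg; near=> t.
have t0 : 0 < t by near: t; apply: nbhs_pinfty_gt; exact: num_real.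
have jZ : (j t)%:Z = k + y t by near: t; exact: jE.
have yE : y t = - k + (j t)%:Z by rewrite jZ addKr.
by rewrite -/(y t) yE /X1; apply/esym; exact: (conditional_leader_type tasep k (j t) t0 a0).
Unshelve. all: by end_near.
Qed.
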